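(* Let $d\ge 1$ and assume $1<p<\infty$ and $s>1+\frac dp$. Then for any $M>0$, there exist $f,g\in\mathcal S(\mathbb R^d)$ such that $$\|J^s(fg)-fJ^sg\|_p>M\Bigl(\|J^sf\|_p\|g\|_\infty+\|J^{s-1}g\|_p\|\partial f\|_{\mathrm{BMO}}\Bigr).$$
   Context: $\mathcal S(\mathbb R^d)$ is the space of Schwartz functions, $\|\cdot\|_p$ the $L^p(\mathbb R^d)$ norm. $J^s=(1-\Delta)^{s/2}$ is the Fourier multiplier with symbol $(1+|\xi|^2)^{s/2}$. $\partial=(\partial_1,\dots,\partial_d)$ is the gradient; norms of vector-valued functions are taken componentwise. The BMO norm is $\|u\|_{\mathrm{BMO}}=\sup_Q\frac1{|Q|}\int_Q|u-u_Q|\,dy$ ($u_Q$ the average over $Q$, supremum over all cubes $Q\subset\mathbb R^d$). *)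

(* Defs.v *)
From HB Require Import structures.
From mathcomp Require Import all_boot all_order all_algebra complex.
From mathcomp Require Import all_classical all_reals all_analysis.

Set Implicit Arguments.
Unset Strict Implicit.
Unset Printing Implicit Defensive.
Import Order.TTheory GRing.Theory Num.Theory.
Import numFieldNormedType.Exports.
Import Normc.

Local Open Scope classical_set_scope.
Local Open Scope ring_scope.
Local Open Scope complex_scope.

(* R^d is 'rV[R]_d, with the sigma-algebra generated by the coordinates
   (i.e. the Borel sets). *)
Definition measure_rV_display : measure_display.
Proof. exact: default_measure_display. Qed.

Section measurable_rV.
Context {R : realType} (n : nat).

Definition rV_measurable : set (set 'rV[R]_n) :=
  g_sigma_preimage (fun (i : 'I_n) (x : 'rV[R]_n) => x ord0 i).

Let rV_set0 : rV_measurable set0.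
Proof. exact: sigma_algebra0. Qed.

Let rV_setC A : rV_measurable A -> rV_measurable (~` A).
Proof. exact: sigma_algebraC. Qed.

Let rV_bigcup (F : (set 'rV[R]_n)^nat) : (forall i, rV_measurable (F i)) ->
  rV_measurable (\bigcup_i (F i)).
Proof. exact: sigma_algebra_bigcup. Qed.

HB.instance Definition _ := @isMeasurable.Build measure_rV_display
  'rV[R]_n rV_measurable rV_set0 rV_setC rV_bigcup.

End measurable_rV.

Section measurable_coordinates.
Context {R : realType}.

Lemma measurable_coord n (i : 'I_n) :
  measurable_fun [set: 'rV[R]_n] (fun x : 'rV[R]_n => x ord0 i).
Proof.
move=> _ Y mY; rewrite setTI; apply: sub_sigma_algebra => /=.
rewrite -bigcup_seq/=; exists i => /=; first by rewrite mem_index_enum.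
by exists Y => //; rewrite setTI.
Qed.

Lemma measurable_fun_rVP d (T : measurableType d) n (f : T -> 'rV[R]_n) :
  (forall i, measurable_fun [set: T] (fun t => f t ord0 i)) ->
  measurable_fun [set: T] f.
Proof.
move=> mf; rewrite /measurable_fun => _ A mA; rewrite setTI.
pose G := [set B : set 'rV[R]_n | measurable (f @^-1` B)].
suff : @rV_measurable R n `<=` G by apply.
apply: smallest_sub.
- split => [|B|F]; rewrite /G/=.
  + by rewrite preimage_set0.
  + by move=> mB; rewrite setTD preimage_setC; exact: measurableC.
  + by move=> mF; rewrite preimage_bigcup; exact: bigcup_measurable.
- rewrite -bigcup_seq => B [i _] [C mC <-]; rewrite /G /= setTI.
  by have := mf i measurableT _ mC; rewrite setTI.
Qed.

End measurable_coordinates.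

Section lebesgue_rV.
Context {R : realType}.

Definition cons_rV n (xv : R * 'rV[R]_n) : 'rV[R]_n.+1 :=
  \row_i (if unlift ord0 i is Some j then xv.2 ord0 j else xv.1).

Definition uncons_rV n (v : 'rV[R]_n.+1) : R * 'rV[R]_n :=
  (v ord0 ord0, \row_j v ord0 (lift ord0 j)).

Lemma cons_rVK n : cancel (@cons_rV n) (@uncons_rV n).
Proof.
move=> [x v]; rewrite /uncons_rV mxE unlift_none; congr pair.
by apply/rowP => j; rewrite !mxE liftK.
Qed.

Lemma uncons_rVK n : cancel (@uncons_rV n) (@cons_rV n).
Proof.
move=> v; apply/rowP => i; rewrite mxE.
by case: unliftP => [j|] -> //; rewrite mxE.
Qed.

Lemma measurable_cons_rV n : measurable_fun setT (@cons_rV n).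
Proof.
apply: measurable_fun_rVP => i; under eq_fun do rewrite mxE.
case: unliftP => [j _|_]; last exact: measurable_fst.
by apply: (measurableT_comp (measurable_coord j)); exact: measurable_snd.
Qed.

Lemma measurable_uncons_rV n : measurable_fun setT (@uncons_rV n).
Proof.
apply: measurable_fun_pair; first exact: measurable_coord.
apply: measurable_fun_rVP => i; under eq_fun do rewrite mxE.
exact: measurable_coord.
Qed.

Section step.
Variables (n : nat) (mu : {sigma_finite_measure set 'rV[R]_n -> \bar R}).

Definition lebesgue_cons : set 'rV[R]_n.+1 -> \bar R :=
  pushforward (@lebesgue_measure R \x mu)%E (@cons_rV n).

Let lebesgue_cons0 : lebesgue_cons set0 = 0%E.
Proof. by apply: measure0 => ?; exact: measurable_cons_rV. Qed.

Let lebesgue_cons_ge0 A : (0 <= lebesgue_cons A)%E.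
Proof. by apply: measure_ge0 => ?; exact: measurable_cons_rV. Qed.

Let lebesgue_cons_sigma_additive : semi_sigma_additive lebesgue_cons.
Proof.
by apply: measure_semi_sigma_additive => ?; exact: measurable_cons_rV.
Qed.

HB.instance Definition _ := isMeasure.Build _ _ _ lebesgue_cons
  lebesgue_cons0 lebesgue_cons_ge0 lebesgue_cons_sigma_additive.

Let lebesgue_cons_sigma_finite : sigma_finite setT lebesgue_cons.
Proof.
have /sigma_finiteP[F [FT ndF Foo]] := sigma_finiteT (@lebesgue_measure R).
have /sigma_finiteP[G [GT ndG Goo]] := sigma_finiteT mu.
exists (fun k => @uncons_rV n @^-1` (F k `*` G k)).
  apply/esym; rewrite -subTset => v _.
  have [i _ Fi] : (\bigcup_i F i) (uncons_rV v).1 by rewrite -FT.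
  have [j _ Gj] : (\bigcup_i G i) (uncons_rV v).2 by rewrite -GT.
  exists (maxn i j) => //; split => /=.
  - by move: Fi; exact/subsetPset/ndF/leq_maxl.
  - by move: Gj; exact/subsetPset/ndG/leq_maxr.
move=> k; have [mF Fk] := Foo k; have [mG Gk] := Goo k; split.
  rewrite -[X in measurable X]setTI.
  by apply: measurable_uncons_rV => //; exact: measurableX.
rewrite /lebesgue_cons /pushforward -comp_preimage.
rewrite (_ : _ \o _ = id); last by apply/funext => x /=; rewrite cons_rVK.
by rewrite preimage_id product_measure1E// lte_mul_pinfty// ge0_fin_numE.
Qed.

HB.instance Definition _ := Measure_isSigmaFinite.Build _ _ _ lebesgue_cons
  lebesgue_cons_sigma_finite.

End step.

(* Lebesgue measure on R^n, as an iterated product. *)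
Fixpoint lebesgue_rV n : {sigma_finite_measure set 'rV[R]_n -> \bar R} :=
  match n with
  | 0 => dirac (0 : 'rV[R]_0)
  | n'.+1 => lebesgue_cons (lebesgue_rV n')
  end.

Lemma lebesgue_rV_box n (A : 'I_n -> set (measurableTypeR R)) :
  (forall i, measurable (A i)) ->
  lebesgue_rV n [set x : 'rV[R]_n | forall i, A i (x ord0 i)] =
  (\prod_(i < n) lebesgue_measure (A i))%E.
Proof.
elim: n A => [|n IHn] A mA.
  rewrite big_ord0 /= diracE mem_set//; by case.
rewrite big_ord_recl -IHn//= /lebesgue_cons /pushforward.
pose B := [set v : 'rV[R]_n | forall i, A (lift ord0 i) (v ord0 i)].
rewrite -[X in lebesgue_rV n X]/B.
have mB : measurable B.
  rewrite (_ : B = \bigcap_(i in [set: 'I_n])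
      ((fun x : 'rV[R]_n => x ord0 i) @^-1` A (lift ord0 i))).
    apply: fin_bigcap_measurable => [|i _]; first exact: finite_finset.
    rewrite -[X in measurable X]setTI.
    by apply: (measurable_coord i) => //; exact: mA.
  by apply/seteqP; split => [x Bx i _|x Bx i]; exact: Bx.
rewrite -product_measure1E//; congr (product_measure1 _ _ _).
apply/seteqP; split => [[x v] /= Av|[x v] [/= Ax Bv] i].
  split => /=; first by have := Av ord0; rewrite mxE unlift_none.
  by move=> i; have := Av (lift ord0 i); rewrite mxE liftK.
by rewrite mxE; case: unliftP => [j|] ->.
Qed.

End lebesgue_rV.

Definition dotprod (R : realType) d (x y : 'rV[R]_d) : R :=
  \sum_(i < d) x ord0 i * y ord0 i.

(* |x|^2 for the Euclidean norm; the library norm on 'rV[R]_d is the sup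
   norm. *)
Definition sqnorm (R : realType) d (x : 'rV[R]_d) : R := dotprod x x.

Section complex_valued.
Context {R : realType} (d : nat).
Implicit Types (f u : 'rV[R]_d -> R[i]) (x y xi : 'rV[R]_d).

(* R[i] has no normed R-module structure in the library: differentiation acts on
   the real and imaginary parts. *)
Definition cdifferentiable f x : Prop :=
  differentiable (fun y => complex.Re (f y)) x /\
  differentiable (fun y => complex.Im (f y)) x.

Definition partial (i : 'I_d) f : 'rV[R]_d -> R[i] := fun x =>
  'D_(delta_mx ord0 i) (fun y => complex.Re (f y)) x +i*
  'D_(delta_mx ord0 i) (fun y => complex.Im (f y)) x.

(* A multi-index is represented by the list of the directions of
   differentiation. *)
Definition partials (l : seq 'I_d) f : 'rV[R]_d -> R[i] := foldr partial f l.

Definition schwartz f : Prop := forall l : seq 'I_d,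
  (forall x, cdifferentiable (partials l f) x) /\
  (forall k : nat, exists C : R, forall x,
     (1 + sqnorm x) ^+ k * normc (partials l f x) <= C).

Definition cintegral (D : set 'rV[R]_d) f : R[i] :=
  Rintegral (lebesgue_rV d) D (fun x => complex.Re (f x)) +i*
  Rintegral (lebesgue_rV d) D (fun x => complex.Im (f x)).

Definition cis (t : R) : R[i] := cos t +i* sin t.

(* The frequency variable is normalised with the phase exp(-i x.xi), so that
   the symbol of 1 - Delta is 1 + |xi|^2. *)
Definition fourier f : 'rV[R]_d -> R[i] := fun xi =>
  cintegral setT (fun x => f x * cis (- dotprod x xi)).

Definition inv_fourier f : 'rV[R]_d -> R[i] := fun x =>
  (((2 * pi) ^+ d)^-1)%:C *
  cintegral setT (fun xi => f xi * cis (dotprod x xi)).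

Definition fourier_multiplier (m : 'rV[R]_d -> R) f : 'rV[R]_d -> R[i] :=
  inv_fourier (fun xi => (m xi)%:C * fourier f xi).

(* J^s = (1 - Delta)^(s/2) *)
Definition bessel (s : R) f : 'rV[R]_d -> R[i] :=
  fourier_multiplier (fun xi => (1 + sqnorm xi) `^ (s / 2)) f.

Definition cLnorm (p : \bar R) f : \bar R :=
  Lnorm (lebesgue_rV d) p (fun x => (normc (f x))%:E).

Definition cube (a : 'rV[R]_d) (r : R) : set 'rV[R]_d :=
  [set x | forall i, a ord0 i <= x ord0 i <= a ord0 i + r].

Definition average (Q : set 'rV[R]_d) u : R[i] :=
  ((fine (lebesgue_rV d Q))^-1)%:C * cintegral Q u.

Definition mean_oscillation (Q : set 'rV[R]_d) u : \bar R :=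
  ((fine (lebesgue_rV d Q))^-1%:E *
   \int[lebesgue_rV d]_(y in Q) (normc (u y - average Q u))%:E)%E.

Definition BMO_norm u : \bar R :=
  ereal_sup [set mean_oscillation (cube ar.1 ar.2) u |
             ar in [set ar : 'rV[R]_d * R | 0 < ar.2]].

(* The sum over the components dominates the max and Euclidean conventions, and
   is equivalent to them up to a constant depending only on d. *)
Definition BMO_norm_gradient f : \bar R :=
  (\sum_(i < d) BMO_norm (partial i f))%E.

End complex_valued.

(* Main.v *)
Require Import Defs.
From mathcomp Require Import all_boot all_order all_algebra complex.
From mathcomp Require Import all_classical all_reals all_analysis.
From mathcomp Require Import measurable_realfun ess_sup_inf ring lra.

Set Implicit Arguments.
Unset Strict Implicit.
Unset Printing Implicit Defensive.
Import Order.TTheory GRing.Theory Num.Theory.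
Import numFieldNormedType.Exports.
Import Normc.

Local Open Scope classical_set_scope.
Local Open Scope ring_scope.
Local Open Scope complex_scope.

(** The function f is a superposition of N bumps x_0 exp (- 4^(-k) |x|^2), one for
    each dyadic scale ([profile]), and g is the wave packet
    exp (i l x_0) exp (- |x|^2) of high frequency l ([wave]).

    For a wave of frequency l, the leading part of J^s (f g) - f J^s g is
    - i s l^(s-1) (d_0 f) g, so its L^p norm is at least of order l^(s-1) times
    the size of d_0 f near the origin, where all the bumps of f have slope close
    to 1: this is of order N l^(s-1) ([commutator_lower_bound]). On the other side
    the norm of J^(s-1) g is at most of order l^(s-1), but the factor that comes with it,
    the BMO norm of the gradient of f, is bounded independently of N
    ([BMO_profile_bounded]): the gradient of a bump is nearly constant on cubes
    much smaller than its width and small on average over much larger ones, so the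
    scales contribute to the oscillation on a given cube as a geometric series
    ([sum_min_dyadic]). The remaining product, of the norm of J^s f and the
    supremum of g, does not depend on l, and is dominated by l^(s-1) since s > 1.
    Hence N is chosen first, large with respect to M, and then l, large with
    respect to N.

    The asymptotics come from [bessel_modulated]: J^s of exp (i l x_0) phi is
    exp (i l x_0) times the multiplier operator applied to phi whose symbol is
    shifted by l. Expanding the shifted symbol as l^s (1 + s xi_0 / l + o(1/l))
    gives [bessel_expansion], uniformly in x by dominated convergence on the
    Fourier side. The functions phi involved are sums of Gaussians times 1 or x_0, whose
    transforms and inverse transforms are computed explicitly ([gauss_pair],
    [coord_gauss_pair]).

    The upper bounds in L^p need decay in x with constants of the right growth in
    l. [csymbol_decay] provides it by integration by parts on the Fourier side, for
    a class of symbols stable under differentiation, with derivatives controlled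
    uniformly in l ([elem], [symbol]). *)

(** * Integrals on the line *)

Section integral_on_R.
Context {R : realType}.
Local Notation leb := (@lebesgue_measure R).

Definition decay_wt1 (x : R) : R := (1 + x ^+ 2)^-1.

Lemma decay_wt1_gt0 x : 0 < decay_wt1 x.
Proof. by rewrite invr_gt0 ltr_pwDl// sqr_ge0. Qed.

Lemma decay_wt1_le1 x : decay_wt1 x <= 1.
Proof.
by rewrite /decay_wt1 invf_le1 ?lerDl ?sqr_ge0// ltr_pwDl// sqr_ge0.
Qed.

Lemma continuous_decay_wt1 : continuous decay_wt1.
Proof. exact: continuous_oneDsqrV. Qed.

Lemma measurable_decay_wt1 : measurable_fun [set: R] decay_wt1.
Proof. exact: continuous_measurable_fun continuous_decay_wt1. Qed.

Lemma integrable_decay_wt1 : leb.-integrable setT (EFin \o decay_wt1).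
Proof.
apply/integrableP; split; first by apply/measurable_EFinP; exact: measurable_decay_wt1.
under eq_integral do rewrite /= ger0_norm ?(ltW (decay_wt1_gt0 _))//.
rewrite ge0_symfun_integralT; last 3 first.
- by move=> x; exact/ltW/decay_wt1_gt0.
- exact: continuous_decay_wt1.
- by move=> x /=; rewrite /decay_wt1 sqrrN.
rewrite -set_itvcy integral0y_oneDsqr -EFinM ltry//.
Qed.

Lemma decay_wt1N x : decay_wt1 (- x) = decay_wt1 x.
Proof. by rewrite /decay_wt1 sqrrN. Qed.

Lemma cvg_decay_wt1 (C : R) : (C * decay_wt1 n.+1%:R) @[n --> \oo] --> (0 : R).
Proof.
rewrite -(mulr0 C); apply: cvgMr.
apply: (@squeeze_cvgr _ _ _ _ (cst 0) (fun n => n.+1%:R^-1)).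
- apply: nearW => n; rewrite (ltW (decay_wt1_gt0 _))/= /decay_wt1 lef_pV2 ?posrE//.
  rewrite -natrX -[1]/(1%:R) -natrD ler_nat.
  by apply: leq_trans (leq_addl _ _); rewrite expnS expn1 leq_pmulr.
- exact: cvg_cst.
- exact: cvg_harmonic.
Unshelve. all: by end_near. Qed.

(** The fundamental theorem of calculus gives F n - F (- n) on the interval
    from - n to n, and this vanishes in the limit; dominated convergence
    passes to the whole line. *)
Lemma Rintegral_derive_eq0 (F f : R -> R) (C : R) :
  (forall x : R, is_derive x (1 : R) F (f x)) -> continuous f ->
  (forall x, `|F x| <= C * decay_wt1 x) -> (forall x, `|f x| <= C * decay_wt1 x) ->
  \int[leb]_x f x = 0.
Proof.
move=> dF cf bF bf.
have C0 : 0 <= C.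
  by have := le_trans (normr_ge0 _) (bF 0); rewrite pmulr_lge0 ?decay_wt1_gt0.
have mf : measurable_fun [set: R] f by exact: continuous_measurable_fun.
have iw : leb.-integrable setT (fun x => (C * decay_wt1 x)%:E).
  by apply: (@integrableZl _ _ _ _ _ measurableT C _ integrable_decay_wt1).
pose A (n : nat) := `[- n.+1%:R, n.+1%:R]%classic : set R.
have mA n : measurable (A n) by exact: measurable_itv.
have H1 : (\int[leb]_x ((f \_ (A n)) x)%:E)%E @[n --> \oo] --> (\int[leb]_x (f x)%:E)%E.
  apply: (@dominated_cvg _ _ _ leb _ measurableT _ _ (fun x => (C * decay_wt1 x)%:E)) => //.
  - move=> n; apply/measurable_EFinP.
    by apply/(measurable_restrictT _ _).1; [exact: mA|exact: measurable_funS mf].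
  - move=> x _; apply: cvg_EFin; first exact: nearW.
    apply: cvg_near_cst; near=> n => /=.
    rewrite patchE mem_set// /A/= in_itv/= -ler_norml.
    near: n; have /= := nbhs_infty_ger `|x|; apply: filterS => n /le_trans -> //.
    by rewrite ler_nat.
  - move=> n x _; rewrite /= lee_fin patchE; case: ifPn => _ //.
    by rewrite normr0 mulr_ge0// ltW// decay_wt1_gt0.
have H2 n : (\int[leb]_x ((f \_ (A n)) x)%:E)%E = (F n.+1%:R - F (- n.+1%:R))%:E.
  transitivity (\int[leb]_(x in A n) (f x)%:E)%E.
    by rewrite [RHS]integral_mkcond restrict_EFin.
  rewrite EFinB.
  rewrite /A (@continuous_FTC2 _ f F) //.
  - by rewrite gtrN.
  - exact: continuous_subspaceT.
  - split.
    + by move=> x _; have [] := dF x.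
    + by apply: cvg_at_right_filter; exact/differentiable_continuous/derivable1_diffP.
    + by apply: cvg_at_left_filter; exact/differentiable_continuous/derivable1_diffP.
  - by move=> x _; rewrite derive1E; have [_ ->] := dF x.
have F0 : F (n.+1%:R) @[n --> \oo] --> (0 : R).
  apply/norm_cvg0P/(squeeze_cvgr _ (cvg_cst 0) (cvg_decay_wt1 C)).
  by apply: nearW => n; rewrite normr_ge0 bF.
have F0' : F (- n.+1%:R) @[n --> \oo] --> (0 : R).
  apply/norm_cvg0P/(squeeze_cvgr _ (cvg_cst 0) (cvg_decay_wt1 C)).
  by apply: nearW => n; rewrite normr_ge0/= -decay_wt1N bF.
rewrite /Rintegral; have -> : (\int[leb]_x (f x)%:E)%E = 0%:E; last by [].
have H3 : (\int[leb]_x ((f \_ (A n)) x)%:E)%E @[n --> \oo] --> 0%:E.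
  under eq_fun do rewrite H2.
  apply: cvg_EFin; first exact: nearW.
  by rewrite -(subr0 0); exact: cvgB.
apply: (cvg_unique _ H1 H3).
Unshelve. all: by end_near. Qed.

End integral_on_R.

(** * Lebesgue measure in dimension n + 1 as a product *)

Section fubini_rV.
Context {R : realType}.
Local Notation leb := (@lebesgue_measure R).
Local Notation mu := (@lebesgue_rV R).

(** A measure that agrees with Lebesgue measure on half-open intervals is
    Lebesgue measure, and translation preserves their lengths. *)
Lemma ge0_integral_shift (c : R) (f : measurableTypeR R -> \bar R) :
  measurable_fun setT f -> (forall x, 0 <= f x)%E ->
  (\int[leb]_x f (x + c)%R = \int[leb]_x f x)%E.
Proof.
move=> mf f0.
have mphi : measurable_fun (setT : set (measurableTypeR R))
    ((fun x => x + c) : measurableTypeR R -> measurableTypeR R).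
  exact: measurable_funD.
pose nu := pushforward leb ((fun x => x + c) : measurableTypeR R -> measurableTypeR R).
have lebE A : measurable A -> leb A = nu A.
  apply: lebesgue_measure_unique => X -[[a b] _ <-] /=.
  rewrite /nu/= /pushforward.
  have -> : (fun x => x + c) @^-1` `]a, b] = `]a - c, b - c]%classic.
    by apply/seteqP; split => x /=; rewrite !in_itv/= ltrBlDr lerBrDr.
  rewrite !lebesgue_measure_itv/= !lte_fin ltrD2r; case: ifPn => // _.
  by rewrite -!EFinB opprB addrA subrK.
transitivity (\int[nu]_x f x)%E.
  by rewrite (ge0_integral_pushforward mphi)//= => x _; exact: f0.
by apply: eq_measure_integral => A mA _; exact/esym/lebE.
Qed.

(** [lebesgue_rV] is built over the generated sigma-algebra of R, which is
    only convertible to the canonical one; the integration theorems apply to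
    the latter. *)
Let measurable_cons n : measurable_fun (setT : set (measurableTypeR R * 'rV[R]_n)%type)
    (@cons_rV R n : measurableTypeR R * 'rV[R]_n -> 'rV[R]_n.+1).
Proof. exact: measurable_cons_rV. Qed.

Lemma ge0_integral_cons_prod n (f : 'rV[R]_n.+1 -> \bar R) :
  measurable_fun setT f -> (forall x, 0 <= f x)%E ->
  (\int[mu n.+1]_x f x = \int[(leb \x mu n)%E]_z (f \o @cons_rV R n) z)%E.
Proof.
move=> mf f0; have H := ge0_integral_pushforward (@measurable_cons n)
  (leb \x mu n)%E measurableT mf (fun x _ => f0 x).
by have mc := @measurable_cons n; rewrite -[RHS]H; apply: eq_measure_integral.
Qed.

Lemma ge0_integral_cons n (f : 'rV[R]_n.+1 -> \bar R) :
  measurable_fun setT f -> (forall x, 0 <= f x)%E ->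
  (\int[mu n.+1]_x f x = \int[leb]_t \int[mu n]_v f (cons_rV (t, v)))%E.
Proof.
move=> mf f0; rewrite ge0_integral_cons_prod// fubini_tonelli1//.
  exact: measurableT_comp mf (@measurable_cons n).
by move=> x; exact: f0.
Qed.

Lemma cons_rV0 n (t : R) (v : 'rV[R]_n) : cons_rV (t, v) ord0 ord0 = t.
Proof. by rewrite mxE unlift_none. Qed.

Lemma cons_rVS n (t : R) (v : 'rV[R]_n) j :
  cons_rV (t, v) ord0 (lift ord0 j) = v ord0 j.
Proof. by rewrite mxE liftK. Qed.

(** The common majorant of the Fourier integrands. Being a product of
    one-variable majorants, it makes domination stable under slicing along a
    coordinate, on which the inductions on the dimension rest. *)
Definition decay_wt n (x : 'rV[R]_n) : R := \prod_(i < n) decay_wt1 (x ord0 i).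

Lemma decay_wt_cons n t (v : 'rV[R]_n) : decay_wt (cons_rV (t, v)) = decay_wt1 t * decay_wt v.
Proof.
rewrite /decay_wt big_ord_recl cons_rV0; congr *%R.
by apply: eq_bigr => j _; rewrite cons_rVS.
Qed.

Lemma decay_wt_gt0 n (x : 'rV[R]_n) : 0 < decay_wt x.
Proof. by apply: prodr_gt0 => i _; exact: decay_wt1_gt0. Qed.

Lemma measurable_decay_wt n : measurable_fun [set: 'rV[R]_n] (@decay_wt n).
Proof.
rewrite /decay_wt; apply: measurable_prod => i _.
exact: measurableT_comp measurable_decay_wt1 (measurable_coord i).
Qed.

Lemma integral_decay_wt_lty n : (\int[mu n]_x (decay_wt x)%:E < +oo)%E.
Proof.
elim: n => [|n IHn].
  rewrite integral_dirac//; last by apply/measurable_EFinP; exact: measurable_decay_wt.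
  by rewrite diracT mul1e ltry.
rewrite ge0_integral_cons; last 2 first.
  by apply/measurable_EFinP; exact: measurable_decay_wt.
  by move=> x; rewrite lee_fin ltW// decay_wt_gt0.
under eq_integral => t _.
  under eq_integral do rewrite decay_wt_cons EFinM.
  rewrite ge0_integralZl//; last 3 first.
    by apply/measurable_EFinP; exact: measurable_decay_wt.
    by move=> x _; rewrite lee_fin ltW// decay_wt_gt0.
    by rewrite lee_fin ltW// decay_wt1_gt0.
  over.
rewrite ge0_integralZr//; last 3 first.
  by apply/measurable_EFinP; exact: measurable_decay_wt1.
  by move=> x _; rewrite lee_fin ltW// decay_wt1_gt0.
  by apply: integral_ge0 => x _; rewrite lee_fin ltW// decay_wt_gt0.
apply: lte_mul_pinfty => //.
- by apply: integral_ge0 => x _; rewrite lee_fin ltW// decay_wt1_gt0.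
- rewrite ge0_fin_numE; last first.
    by apply: integral_ge0 => x _; rewrite lee_fin ltW// decay_wt1_gt0.
  exact: integrable_lty (@integrable_decay_wt1 R).
Qed.

Definition dominated n (f : 'rV[R]_n -> R) :=
  measurable_fun setT f /\ exists C : R, forall x, `|f x| <= C * decay_wt x.

Lemma dominated_integrable n (f : 'rV[R]_n -> R) :
  dominated f -> (mu n).-integrable setT (EFin \o f).
Proof.
move=> [mf [C fC]].
apply: (@le_integrable _ _ _ _ _ measurableT _ (fun x => (C * decay_wt x)%:E)).
- exact/measurable_EFinP.
- move=> x _ /=; rewrite lee_fin.
  exact: le_trans (fC x) (ler_norm _).
- apply: (@integrableZl _ _ _ _ _ measurableT C (EFin \o @decay_wt n)).
  apply/integrableP; split; first by apply/measurable_EFinP; exact: measurable_decay_wt.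
  under eq_integral do rewrite /= ger0_norm ?(ltW (decay_wt_gt0 _))//.
  exact: integral_decay_wt_lty.
Qed.

Lemma dominated_cons n (f : 'rV[R]_n.+1 -> R) t : dominated f ->
  dominated (fun v => f (cons_rV (t, v))).
Proof.
move=> [mf [C fC]]; split.
  apply: measurableT_comp mf _; apply: measurableT_comp (@measurable_cons_rV R n) _.
  exact: measurable_pair1.
by exists (C * decay_wt1 t) => v; rewrite (le_trans (fC _))// decay_wt_cons mulrA.
Qed.

Lemma integrable_cons_prod n (f : 'rV[R]_n.+1 -> R) : dominated f ->
  (leb \x mu n)%E.-integrable setT ((EFin \o f) \o @cons_rV R n).
Proof.
move=> df; have [mf _] := df.
have mef : measurable_fun setT (EFin \o f) by exact/measurable_EFinP.
have /integrableP[_ foo] := dominated_integrable df.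
apply/integrableP; split; first exact: measurableT_comp mef (@measurable_cons n).
rewrite ge0_integral_cons_prod in foo => //.
exact: measurableT_comp.
Qed.

Lemma integral_cons_prod n (f : 'rV[R]_n.+1 -> R) : dominated f ->
  (\int[mu n.+1]_x (f x)%:E =
   \int[(leb \x mu n)%E]_z ((EFin \o f) \o @cons_rV R n) z)%E.
Proof.
move=> df; have [mf _] := df.
have mef : measurable_fun setT (EFin \o f) by exact/measurable_EFinP.
have mc := @measurable_cons n.
have H := integral_pushforward mc mef (integrable_cons_prod df) measurableT.
by rewrite -[RHS]H; apply: eq_measure_integral.
Qed.

Lemma Rintegral_cons n (f : 'rV[R]_n.+1 -> R) : dominated f ->
  Rintegral (mu n.+1) setT f =
  Rintegral leb setT (fun t => Rintegral (mu n) setT (fun v => f (cons_rV (t, v)))).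
Proof.
move=> df; rewrite /Rintegral integral_cons_prod//; congr fine.
rewrite -integral12_prod_meas1; last exact: integrable_cons_prod.
apply: eq_integral => t _; rewrite fineK//.
by apply: integrable_fin_num => //; exact: dominated_integrable (dominated_cons t df).
Qed.

(** Here the inner integral is over the first coordinate, the order suited
    to integrating by parts in that coordinate. *)
Lemma Rintegral_cons_swap n (f : 'rV[R]_n.+1 -> R) : dominated f ->
  Rintegral (mu n.+1) setT f =
  Rintegral (mu n) setT (fun v => Rintegral leb setT (fun t => f (cons_rV (t, v)))).
Proof.
move=> df; rewrite /Rintegral integral_cons_prod//; congr fine.
rewrite -integral21_prod_meas1; last exact: integrable_cons_prod.
apply: eq_integral => v _; rewrite fineK//.
have [mf [C fC]] := df.
apply: integrable_fin_num => //.
apply: (@le_integrable _ (measurableTypeR R) _ leb setT measurableT _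
  (fun t => (C * decay_wt v * decay_wt1 t)%:E)).
- apply/measurable_EFinP; apply: measurableT_comp mf _.
  apply: measurableT_comp (@measurable_cons n) _.
  exact: measurable_pair2.
- move=> t _ /=; rewrite lee_fin -mulrA [decay_wt v * _]mulrC -decay_wt_cons.
  exact: le_trans (fC _) (ler_norm _).
- exact: (@integrableZl _ _ _ _ _ measurableT (C * decay_wt v) _ (@integrable_decay_wt1 R)).
Qed.

Lemma cons_rV_shift0 n (c t : R) (v : 'rV[R]_n) :
  cons_rV (t, v) + c *: delta_mx ord0 ord0 = cons_rV (t + c, v).
Proof.
apply/rowP => i; rewrite !mxE; case: unliftP => [j|] -> /=.
  by rewrite mulr0 addr0.
by rewrite mulr1.
Qed.

Lemma cons_rV_shiftS n (c t : R) (v : 'rV[R]_n) j :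
  cons_rV (t, v) + c *: delta_mx ord0 (lift ord0 j) =
  cons_rV (t, v + c *: delta_mx ord0 j).
Proof.
apply/rowP => i; rewrite !mxE; case: unliftP => [k|] -> /=.
  by rewrite !mxE (inj_eq lift_inj).
by rewrite mulr0 addr0.
Qed.

Lemma cons_rV_line0 n (h t : R) (v : 'rV[R]_n) :
  cons_rV (h + t, v) = h *: delta_mx ord0 ord0 + cons_rV (t, v).
Proof. by rewrite addrC -cons_rV_shift0 addrC. Qed.

Lemma cons_rV_lineS n (h t : R) (v : 'rV[R]_n) j :
  cons_rV (t, h *: delta_mx ord0 j + v) =
  h *: delta_mx ord0 (lift ord0 j) + cons_rV (t, v).
Proof. by rewrite [RHS]addrC cons_rV_shiftS addrC. Qed.

Lemma ge0_integral_shift0 n (c : R) (f : 'rV[R]_n.+1 -> \bar R) :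
  measurable_fun setT f -> (forall x, 0 <= f x)%E ->
  (\int[mu n.+1]_x f (x + c *: delta_mx ord0 ord0)%R = \int[mu n.+1]_x f x)%E.
Proof.
move=> mf f0.
have ms : measurable_fun setT (fun x : 'rV[R]_n.+1 => x + c *: delta_mx ord0 ord0).
  apply: measurable_fun_rVP => i; under eq_fun do rewrite mxE.
  by apply: measurable_funD => //; exact: measurable_coord.
rewrite !ge0_integral_cons//; last exact: measurableT_comp mf ms.
under eq_integral do under eq_integral do rewrite cons_rV_shift0.
rewrite (ge0_integral_shift c (f := fun t => \int[mu n]_v f (cons_rV (t, v)))%E)//.
  apply: (@measurable_fun_fubini_tonelli_F _ _ _ _ _ (mu n) (f \o @cons_rV R n)) => //.
    exact: measurableT_comp mf (@measurable_cons n).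
  by move=> x; exact: f0.
by move=> t; apply: integral_ge0 => v _.
Qed.

Lemma Rintegral_shift0 n (c : R) (f : 'rV[R]_n.+1 -> R) :
  measurable_fun setT f ->
  Rintegral (mu n.+1) setT (fun x => f (x + c *: delta_mx ord0 ord0)) =
  Rintegral (mu n.+1) setT f.
Proof.
move=> mf; rewrite /Rintegral; congr fine; rewrite integralE [RHS]integralE.
have mef : measurable_fun setT (EFin \o f) by exact/measurable_EFinP.
have mp : measurable_fun setT ((EFin \o f)^\+)%E by exact: measurable_funepos.
have mn : measurable_fun setT ((EFin \o f)^\-)%E by exact: measurable_funeneg.
have p0 x : (0 <= ((EFin \o f)^\+)%E x)%E by exact: funepos_ge0.
have n0 x : (0 <= ((EFin \o f)^\-)%E x)%E by exact: funeneg_ge0.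
rewrite -[X in _ = (X - _)%E](ge0_integral_shift0 c mp p0).
rewrite -[X in _ = (_ - X)%E](ge0_integral_shift0 c mn n0).
by apply: (f_equal2 (fun a b => (a - b)%E)); apply: eq_integral => x _;
  rewrite ?funeposE ?funenegE.
Qed.

(** A directional derivative only sees the line through the point, so it
    transfers along any map that is affine on that line. *)
Lemma is_derive_line (V W : normedModType R) (G : W -> R) (A : V -> W) v w x dG :
  (forall h y, A (h *: v + y) = h *: w + A y) ->
  is_derive (A x) w G dG -> is_derive x v (G \o A) dG.
Proof.
move=> AE [dG1 dG2].
have E : (fun h : R => h^-1 *: (((G \o A) \o shift x) (h *: v) - (G \o A) x)) =
         (fun h => h^-1 *: ((G \o shift (A x)) (h *: w) - G (A x))).
  by apply/funext => h /=; rewrite AE.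
by split; [rewrite /derivable E|rewrite /derive E].
Qed.

(** Slicing along the first coordinate reduces every other direction to a
    smaller dimension; in the first direction it is the one-variable
    statement on each line. *)
Lemma Rintegral_partial_eq0 n (j : 'I_n) (G G' : 'rV[R]_n -> R) :
  dominated G -> dominated G' ->
  (forall x, is_derive x (delta_mx ord0 j) G (G' x)) ->
  (forall x, continuous (fun t : R => G' (t *: delta_mx ord0 j + x))) ->
  Rintegral (mu n) setT G' = 0.
Proof.
elim: n j G G' => [[]//|n IHn] j G G' dG dG' GG' cG'.
have [k|] := unliftP ord0 j => jE; subst j.
  rewrite Rintegral_cons//.
  transitivity (Rintegral leb setT (fun=> 0)); last by rewrite Rintegral_cst// mul0r.
  apply: eq_Rintegral => t _.
  apply: (IHn k (fun v => G (cons_rV (t, v)))); try exact: dominated_cons.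
  - move=> v; apply: (@is_derive_line _ _ G (fun v => cons_rV (t, v)) _ _ _ _ _ (GG' _)).
    by move=> h y; exact: cons_rV_lineS.
  - move=> v; have E : (fun h : R => G' (cons_rV (t, h *: delta_mx ord0 k + v))) =
        (fun h => G' (h *: delta_mx ord0 (lift ord0 k) + cons_rV (t, v))).
      by apply/funext => h; rewrite cons_rV_lineS.
    by rewrite E; exact: cG'.
rewrite Rintegral_cons_swap//.
transitivity (Rintegral (mu n) setT (fun=> 0)); last by rewrite Rintegral_cst// mul0r.
apply: eq_Rintegral => v _.
have [[_ [C GC]] [_ [C' GC']]] := (dG, dG').
apply: (@Rintegral_derive_eq0 _ (fun t => G (cons_rV (t, v))) _
  (Num.max (C * decay_wt v) (C' * decay_wt v))).
- move=> t; apply: (@is_derive_line _ _ G (fun t => cons_rV (t, v)) _ _ _ _ _ (GG' _)).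
  by move=> h y; rewrite -cons_rV_line0 -[h *: _]/(h * 1) mulr1.
- have E : (fun t : R => G' (cons_rV (t, v))) =
      (fun h => G' (h *: delta_mx ord0 ord0 + cons_rV (0, v))).
    by apply/funext => h; rewrite -cons_rV_line0 addr0.
  by rewrite E; exact: cG'.
- move=> t; rewrite (le_trans (GC _))// decay_wt_cons mulrCA mulrC ler_wpM2r//.
    exact/ltW/decay_wt1_gt0.
  by rewrite le_max lexx.
- move=> t; rewrite (le_trans (GC' _))// decay_wt_cons mulrCA mulrC ler_wpM2r//.
    exact/ltW/decay_wt1_gt0.
  by rewrite le_max lexx orbT.
Qed.

End fubini_rV.

(** * Calculus for coordinates, squared norm and Gaussian weights *)

Section smooth.
Context {R : realType}.
Implicit Types (n : nat).

Lemma is_derive_lineE (V : normedModType R) (G : V -> R) (x v : V) dG :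
  is_derive (0 : R) (1 : R) (fun h => G (h *: v + x)) dG -> is_derive x v G dG.
Proof.
move=> [dG1 dG2].
have E : (fun h : R => h^-1 *: ((G \o shift x) (h *: v) - G x)) =
    (fun h => h^-1 *: (((fun h => G (h *: v + x)) \o shift 0) (h *: 1) - G (0 *: v + x))).
  by apply/funext => h /=; rewrite -[h *: 1]/(h * 1) mulr1 addr0 scale0r add0r.
by split; [rewrite /derivable E|rewrite /derive E].
Qed.

Lemma is_derive_comp1 (V : normedModType R) (G : V -> R) (phi : R -> R) (x v : V) dG dphi :
  is_derive x v G dG -> is_derive (G x) 1 phi dphi ->
  is_derive x v (fun y => phi (G y)) (dphi * dG).
Proof.
move=> hG hphi; apply: is_derive_lineE.
have h1 : is_derive (0 : R) (1 : R) (fun h => G (h *: v + x)) dG.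
  apply: (@is_derive_line _ R^o _ G (fun h => h *: v + x) 1 v 0).
    by move=> h y; rewrite scalerDl addrA -[h *: 1]/(h * 1) mulr1.
  by rewrite scale0r add0r.
by apply: (@is_derive1_comp _ phi (fun h => G (h *: v + x))); rewrite scale0r add0r.
Qed.

Lemma differentiable_comp1 (V : normedModType R) (G : V -> R) (phi : R -> R) (x : V) dphi :
  differentiable G x -> is_derive (G x) (1 : R) phi dphi ->
  differentiable (fun y => phi (G y)) x.
Proof.
move=> hG [h _]; apply: (differentiable_comp (f := G) (g := phi)) => //.
exact/derivable1_diffP.
Qed.

Lemma is_derive_coord n (x v : 'rV[R]_n) i :
  is_derive x v (fun y : 'rV[R]_n => y ord0 i) (v ord0 i).
Proof.
apply: (@is_derive_line _ _ R^o id (fun y : 'rV[R]_n => y ord0 i) v (v ord0 i)).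
by move=> h y; rewrite !mxE.
Qed.

Lemma differentiable_coordinate n (x : 'rV[R]_n) i :
  differentiable (fun y : 'rV[R]_n => y ord0 i) x.
Proof. exact: differentiable_coord. Qed.

Lemma is_derive_sqnorm n (x v : 'rV[R]_n) :
  is_derive x v (@sqnorm R n) (2 * dotprod x v).
Proof.
have -> : @sqnorm R n = \sum_(i < n) (fun y : 'rV[R]_n => y ord0 i * y ord0 i).
  by apply/funext => y; rewrite fct_sumE.
apply: is_derive_eq.
  apply: is_derive_sum => i; apply: is_deriveM; exact: is_derive_coord.
rewrite mulr_sumr; apply: eq_bigr => i _.
by rewrite /GRing.scale/=; ring.
Qed.

Lemma differentiable_sqnorm n (x : 'rV[R]_n) : differentiable (@sqnorm R n) x.
Proof.
have -> : @sqnorm R n = \sum_(i < n) (fun y : 'rV[R]_n => y ord0 i * y ord0 i).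
  by apply/funext => y; rewrite fct_sumE.
by apply: differentiable_sum => i; apply: differentiableM; exact: differentiable_coordinate.
Qed.

Lemma measurable_sqnorm n : measurable_fun setT (@sqnorm R n).
Proof.
apply: measurable_sum => i.
by apply: measurable_funM; exact: measurable_coord.
Qed.

Lemma sqnorm_ge0 n (x : 'rV[R]_n) : 0 <= sqnorm x.
Proof. by apply: sumr_ge0 => i _; rewrite -expr2 sqr_ge0. Qed.

Lemma sqr_coord_le n (x : 'rV[R]_n) i : x ord0 i ^+ 2 <= sqnorm x.
Proof.
rewrite /sqnorm /dotprod (bigD1 i)//= expr2 lerDl.
by apply: sumr_ge0 => j _; rewrite -expr2 sqr_ge0.
Qed.

Lemma coord_le n (x : 'rV[R]_n) i : `|x ord0 i| <= 1 + sqnorm x.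
Proof.
have := sqr_coord_le x i; rewrite -[x ord0 i ^+ 2]real_normK ?num_real// => h.
apply: le_trans (lerD (lexx 1) h).
have := sqr_ge0 (`|x ord0 i| - 1); nra.
Qed.

Lemma dotprod_delta n (x : 'rV[R]_n) j : dotprod x (delta_mx ord0 j) = x ord0 j.
Proof.
rewrite /dotprod (bigD1 j)//= mxE !eqxx mulr1 big1 ?addr0// => i ij.
by rewrite mxE (negbTE ij) andbF mulr0.
Qed.

(** Each of the n factors 1 + x_i^2 is at most 1 + |x|^2: enough powers of
    the latter give domination. *)
Lemma decay_wt_ge n (x : 'rV[R]_n) : ((1 + sqnorm x) ^+ n)^-1 <= decay_wt x.
Proof.
rewrite /decay_wt; under eq_bigr do rewrite /decay_wt1.
rewrite prodfV lef_pV2 ?posrE; last 2 first.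
- by rewrite exprn_gt0// ltr_pwDl// sqnorm_ge0.
- by apply: prodr_gt0 => i _; rewrite ltr_pwDl// sqr_ge0.
rewrite -[X in _ <= _ ^+ X]card_ord -prodr_const.
by apply: ler_prod => i _; rewrite addr_ge0 ?sqr_ge0//= lerD2l sqr_coord_le.
Qed.

(** Raise 1 + y <= (1 + 1/c) exp (c y) to the power m + 1, with c = b / (m +
    1). *)
Lemma pow_expR_bound (b : R) m : 0 < b ->
  exists2 C : R, 0 <= C & forall y, 0 <= y -> (1 + y) ^+ m * expR (- (b * y)) <= C.
Proof.
move=> b0; pose c := b / m.+1%:R.
have c0 : 0 < c by rewrite divr_gt0.
exists ((1 + c^-1) ^+ m.+1) => [|y y0].
  by rewrite exprn_ge0// addr_ge0// invr_ge0 ltW.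
have h : 1 + y <= (1 + c^-1) * expR (c * y).
  apply: le_trans (ler_wpM2l _ (expR_ge1Dx _)); last by rewrite addr_ge0// invr_ge0 ltW.
  rewrite mulrDl mul1r mulrDr mulr1 mulKf ?gt_eqF//.
  have : 0 <= c * y by rewrite mulr_ge0// ltW.
  have : 0 <= c^-1 by rewrite invr_ge0 ltW.
  by lra.
rewrite expRN ler_pdivrMr ?expR_gt0//.
have -> : expR (b * y) = expR (c * y) ^+ m.+1.
  by rewrite -expRM_natl /c; congr expR; field.
rewrite -exprMn; apply: le_trans (lerXn2r m.+1 _ _ h); rewrite ?nnegrE.
- by rewrite exprS ler_peMl// ?exprn_ge0 ?addr_ge0// lerDl.
- by rewrite addr_ge0.
- by rewrite (le_trans _ h)// addr_ge0.
Qed.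

End smooth.

(** * Amplitudes closed under differentiation *)

Section symbol_class.
Context {R : realType} {n : nat}.
Local Notation V := 'rV[R]_n.+1.
Local Notation e0 := (delta_mx ord0 ord0 : V).

(** The symbol of 1 - Delta after a frequency shift by l in the first
    direction. *)
Definition bracket (l : R) (x : V) : R := 1 + sqnorm (x + l *: e0).

Lemma bracket_ge1 l x : 1 <= bracket l x.
Proof. by rewrite lerDl sqnorm_ge0. Qed.

Lemma bracket_gt0 l x : 0 < bracket l x.
Proof. exact: lt_le_trans (bracket_ge1 l x). Qed.

Lemma bracket_neq0 l x : bracket l x != 0.
Proof. by rewrite gt_eqF// bracket_gt0. Qed.

Lemma sqnormDe0 l (x : V) :
  sqnorm (x + l *: e0) = sqnorm x + 2 * l * x ord0 ord0 + l ^+ 2.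
Proof.
rewrite /sqnorm /dotprod !big_ord_recl.
rewrite (eq_bigr (fun i => x ord0 (lift ord0 i) * x ord0 (lift ord0 i))).
  by rewrite !mxE /=; ring.
by move=> i _; rewrite !mxE /= mulr0 addr0.
Qed.

(** An inequality of Peetre type: the shift costs one factor in l and one in
    x. *)
Lemma bracket_le l x : bracket l x <= 2 * (1 + l ^+ 2) * (1 + sqnorm x).
Proof.
rewrite /bracket sqnormDe0; have := sqr_coord_le x ord0; have := sqnorm_ge0 x.
have := sqr_ge0 (x ord0 ord0 - l); have := sqr_ge0 l.
set s := sqnorm x; set y := x _ _ => *; nra.
Qed.

(** Amplitudes of polynomial growth in x, uniformly in the frequency
    parameter l. The class is stable under partial derivatives because the
    logarithmic derivative of [bracket] is twice [elem_dir], again an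
    amplitude bounded uniformly in l. Stability allows repeated integration
    by parts, and uniformity keeps the resulting constants independent of l. *)
Inductive elem : (R -> V -> R) -> Prop :=
| elem_cst c : elem (fun _ _ => c)
| elem_coord i : elem (fun _ x => x ord0 i)
| elem_cos c : elem (fun _ x => cos (c * x ord0 ord0))
| elem_sin c : elem (fun _ x => sin (c * x ord0 ord0))
| elem_gauss b : 0 <= b -> elem (fun _ x => expR (- (b * sqnorm x)))
| elem_bracket : elem (fun l x => (bracket l x)^-1)
| elem_dir i : elem (fun l x => (x + l *: e0) ord0 i * (bracket l x)^-1)
| elem_add a b : elem a -> elem b -> elem (fun l x => a l x + b l x)
| elem_mul a b : elem a -> elem b -> elem (fun l x => a l x * b l x).

Lemma is_derive_bracket l x i :
  is_derive x (delta_mx ord0 i) (bracket l) (2 * (x + l *: e0) ord0 i).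
Proof.
have H : is_derive x (delta_mx ord0 i) (fun x : V => sqnorm (x + l *: e0))
    (2 * dotprod (x + l *: e0) (delta_mx ord0 i)).
  apply: (@is_derive_line _ _ _ _ (fun x => x + l *: e0)); last exact: is_derive_sqnorm.
  by move=> h y; rewrite addrA.
have := is_deriveD (is_derive_cst (1 : R) x (delta_mx ord0 i)) H.
by rewrite add0r dotprod_delta.
Qed.

Lemma differentiable_bracket l x : differentiable (bracket l) x.
Proof.
apply: differentiableD => //.
apply: (differentiable_comp (f := fun x => x + l *: e0)); last exact: differentiable_sqnorm.
exact: differentiableD.
Qed.

Lemma measurable_shift_e0 l : measurable_fun setT (fun x : V => x + l *: e0).
Proof.
apply: measurable_fun_rVP => i; under eq_fun do rewrite mxE.
by apply: measurable_funD => //; exact: measurable_coord.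
Qed.

Lemma measurable_bracket l : measurable_fun setT (bracket l).
Proof.
apply: measurable_funD => //.
exact: measurableT_comp (@measurable_sqnorm _ _) (measurable_shift_e0 l).
Qed.

Lemma is_derive_invr (y : R) : y != 0 ->
  is_derive y (1 : R) (fun z => z^-1) (- y ^- 2).
Proof.
move=> y0; have := @is_deriveV R id y _ _ y0 (is_derive_id y 1).
by rewrite /GRing.scale/= mulr1.
Qed.

Lemma elem_differentiable a : elem a -> forall l x, differentiable (a l) x.
Proof.
elim=> {a} => [c|i|c|c|b b0||i|a b _ IHa _ IHb|a b _ IHa _ IHb] l x.
- exact: differentiable_cst.
- exact: differentiable_coordinate.
- apply: (differentiable_comp1 _ (is_derive_cos _)).
  by apply: differentiableM => //; exact: differentiable_coordinate.
- apply: (differentiable_comp1 _ (is_derive_sin _)).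
  by apply: differentiableM => //; exact: differentiable_coordinate.
- apply: (differentiable_comp1 _ (is_derive_expR _)).
  by apply: differentiableN; apply: differentiableM => //; exact: differentiable_sqnorm.
- exact: differentiable_comp1 (differentiable_bracket l x) (is_derive_invr (bracket_neq0 l x)).
- apply: differentiableM.
    under eq_fun do rewrite mxE.
    by apply: differentiableD => //; exact: differentiable_coordinate.
  exact: differentiable_comp1 (differentiable_bracket l x) (is_derive_invr (bracket_neq0 l x)).
- exact: differentiableD.
- exact: differentiableM.
Qed.

Lemma elem_measurable a : elem a -> forall l, measurable_fun setT (a l).
Proof.
have mV l : measurable_fun setT (fun x : V => (bracket l x)^-1).
  under eq_fun do rewrite -powR_inv1 ?(ltW (bracket_gt0 _ _))//.
  exact: measurableT_comp (measurable_powR _) (measurable_bracket l).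
elim=> {a} => [c|i|c|c|b b0||i|a b _ IHa _ IHb|a b _ IHa _ IHb] l.
- exact: measurable_cst.
- exact: measurable_coord.
- apply: measurableT_comp; first exact: continuous_measurable_fun (@continuous_cos R).
  by apply: measurable_funM => //; exact: measurable_coord.
- apply: measurableT_comp; first exact: continuous_measurable_fun (@continuous_sin R).
  by apply: measurable_funM => //; exact: measurable_coord.
- apply: measurableT_comp; first exact: measurable_expR.
  apply: measurableT_comp => //; apply: measurable_funM => //.
  exact: measurable_sqnorm.
- exact: mV.
- apply: measurable_funM; last exact: mV.
  exact: measurableT_comp (measurable_coord i) (measurable_shift_e0 l).
- exact: measurable_funD.
- exact: measurable_funM.
Qed.

Lemma elem_bound a : elem a ->
  exists C : R, exists k : nat, 0 <= C /\ forall l x, `|a l x| <= C * (1 + sqnorm x) ^+ k.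
Proof.
have ge1 k (x : V) : 1 <= (1 + sqnorm x) ^+ k by rewrite exprn_ege1// lerDl sqnorm_ge0.
have one (f : R -> V -> R) : (forall l x, `|f l x| <= 1) ->
    exists C : R, exists k : nat, 0 <= C /\ forall l x, `|f l x| <= C * (1 + sqnorm x) ^+ k.
  by move=> f1; exists 1, 0; split => // l x; rewrite expr0 mulr1.
elim=> {a} => [c|i|c|c|b b0||i|a b _ IHa _ IHb|a b _ IHa _ IHb].
- by exists `|c|, 0; split => // l x; rewrite expr0 mulr1.
- by exists 1, 1; split => // l x; rewrite mul1r expr1 coord_le.
- by apply: one => l x; exact: cos_max.
- by apply: one => l x; exact: sin_max.
- apply: one => l x; rewrite ger0_norm ?expR_ge0// -expR0 ler_expR.
  by rewrite oppr_le0 mulr_ge0// sqnorm_ge0.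
- apply: one => l x; rewrite ger0_norm ?invr_ge0 ?(ltW (bracket_gt0 _ _))//.
  by rewrite invf_le1 ?bracket_gt0// bracket_ge1.
- apply: one => l x; rewrite normrM [X in _ * X]ger0_norm ?invr_ge0 ?(ltW (bracket_gt0 _ _))//.
  by rewrite ler_pdivrMr ?bracket_gt0// mul1r coord_le.
- have [C [k [C0 aC]]] := IHa; have [D [m [D0 bD]]] := IHb.
  exists (C + D), (k + m)%N; split; first exact: addr_ge0.
  move=> l x; rewrite (le_trans (ler_normD _ _))// mulrDl lerD//.
    by rewrite (le_trans (aC l x))// ler_wpM2l// exprD ler_peMr// (le_trans _ (ge1 k x)).
  by rewrite (le_trans (bD l x))// ler_wpM2l// exprD ler_peMl// (le_trans _ (ge1 m x)).
- have [C [k [C0 aC]]] := IHa; have [D [m [D0 bD]]] := IHb.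
  exists (C * D), (k + m)%N; split; first exact: mulr_ge0.
  by move=> l x; rewrite normrM exprD mulrACA ler_pM.
Qed.

Lemma elem_deriv a i : elem a -> exists2 a', elem a' &
  forall l x, is_derive x (delta_mx ord0 i) (a l) (a' l x).
Proof.
have dV (l : R) (x : V) : is_derive x (delta_mx ord0 i) (fun x => (bracket l x)^-1)
    (-2 * ((x + l *: e0) ord0 i * (bracket l x)^-1) * (bracket l x)^-1).
  apply: is_derive_eq (is_derive_comp1 (is_derive_bracket l x i) (is_derive_invr (bracket_neq0 l x))) _.
  by field; rewrite bracket_neq0.
have eV := elem_bracket.
have eN a0 : elem a0 -> elem (fun l x => - a0 l x).
  move=> h; have -> : (fun l x => - a0 l x) = (fun l x => (-1) * a0 l x).
    by apply/funext => l; apply/funext => x; rewrite mulN1r.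
  by apply: elem_mul => //; exact: elem_cst.
elim=> {a} => [c|j|c|c|b b0||j|a b ea [a' ea' da] eb [b' eb' db]|a b ea [a' ea' da] eb [b' eb' db]].
- exists (fun _ _ => 0); first exact: elem_cst.
  by move=> l x; exact: is_derive_cst.
- exists (fun _ _ => (delta_mx ord0 i : V) ord0 j); first exact: elem_cst.
  by move=> l x; exact: is_derive_coord.
- exists (fun _ x => - sin (c * x ord0 ord0) * (c * (delta_mx ord0 i : V) ord0 ord0)).
    apply: elem_mul; last exact: elem_cst.
    by apply: eN; exact: elem_sin.
  move=> l x; apply: (is_derive_comp1 _ (is_derive_cos _)).
  exact: is_deriveZ (is_derive_coord _ _ _).
- exists (fun _ x => cos (c * x ord0 ord0) * (c * (delta_mx ord0 i : V) ord0 ord0)).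
    by apply: elem_mul; [exact: elem_cos|exact: elem_cst].
  move=> l x; apply: (is_derive_comp1 _ (is_derive_sin _)).
  exact: is_deriveZ (is_derive_coord _ _ _).
- exists (fun _ x => expR (- (b * sqnorm x)) * ((- 2 * b) * x ord0 i)).
    apply: elem_mul; first exact: elem_gauss.
    by apply: elem_mul; [exact: elem_cst|exact: elem_coord].
  move=> l x.
  have H : is_derive x (delta_mx ord0 i) (fun x : V => - (b * sqnorm x)) _ :=
    is_deriveN (is_deriveZ b (is_derive_sqnorm x (delta_mx ord0 i))).
  apply: is_derive_eq (is_derive_comp1 H (is_derive_expR _)) _.
  by rewrite dotprod_delta /GRing.scale/=; ring.
- exists (fun l x => -2 * ((x + l *: e0) ord0 i * (bracket l x)^-1) * (bracket l x)^-1) => //.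
  apply: elem_mul => //; apply: elem_mul; [exact: elem_cst|exact: elem_dir].
- exists (fun l x => (x + l *: e0) ord0 j * (bracket l x)^-1 *
      (-2 * ((x + l *: e0) ord0 i * (bracket l x)^-1)) +
      (delta_mx ord0 i : V) ord0 j * (bracket l x)^-1).
    apply: elem_add; apply: elem_mul => //; last exact: elem_cst.
      exact: elem_dir.
    by apply: elem_mul; [exact: elem_cst|exact: elem_dir].
  move=> l x.
  have H : is_derive x (delta_mx ord0 i) (fun x : V => (x + l *: e0) ord0 j)
      ((delta_mx ord0 i : V) ord0 j).
    apply: (@is_derive_line _ _ _ (fun y : V => y ord0 j) (fun x : V => x + l *: e0) _ (delta_mx ord0 i)).
      by move=> h y; rewrite addrA.
    exact: is_derive_coord.
  apply: is_derive_eq (is_deriveM H (dV l x)) _.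
  by rewrite /GRing.scale/=; ring.
- exists (fun l x => a' l x + b' l x); first exact: elem_add.
  by move=> l x; exact: is_deriveD.
- exists (fun l x => a l x * b' l x + b l x * a' l x).
    by apply: elem_add; exact: elem_mul.
  by move=> l x; exact: is_deriveM.
Qed.

End symbol_class.

(** * Dominated functions and trigonometric characters *)

Section dominated_functions.
Context {R : realType} {n : nat}.
Local Notation V := 'rV[R]_n.
Local Notation mu := (@lebesgue_rV R n).
Local Notation "\int f" := (Rintegral mu setT f) (at level 36, f at level 36).
Implicit Types f g : V -> R.

Lemma dominated_norm_le f g : measurable_fun setT f -> dominated g ->
  (forall x, `|f x| <= `|g x|) -> dominated f.
Proof. by move=> mf [_ [C gC]] fg; split => //; exists C => x; exact: le_trans (fg x) (gC x). Qed.

Lemma dominatedD f g : dominated f -> dominated g -> dominated (fun x => f x + g x).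
Proof.
move=> [mf [C fC]] [mg [D gD]]; split; first exact: measurable_funD.
by exists (C + D) => x; rewrite (le_trans (ler_normD _ _))// mulrDl lerD.
Qed.

Lemma dominatedZ (c : R) f : dominated f -> dominated (fun x => c * f x).
Proof.
move=> [mf [C fC]]; split; first exact: measurable_funM.
by exists (`|c| * C) => x; rewrite normrM -mulrA ler_wpM2l.
Qed.

Lemma dominatedN f : dominated f -> dominated (fun x => - f x).
Proof.
move=> [mf [C fC]]; split; first exact: measurableT_comp.
by exists C => x; rewrite normrN.
Qed.

Lemma dominatedM_le1 f g : dominated f -> measurable_fun setT g ->
  (forall x, `|g x| <= 1) -> dominated (fun x => f x * g x).
Proof.
move=> df mg g1; have [mf _] := df.
apply: (dominated_norm_le _ df); first exact: measurable_funM.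
by move=> x; rewrite normrM ler_piMr.
Qed.

Lemma measurable_dotprod (x : V) : measurable_fun setT (dotprod x).
Proof.
by apply: measurable_sum => i; apply: measurable_funM => //; exact: measurable_coord.
Qed.

Lemma is_derive_dotprod (x y v : V) : is_derive y v (dotprod x) (dotprod x v).
Proof.
apply: (@is_derive_line _ _ R^o id (dotprod x) v (dotprod x v)).
move=> h z; rewrite -[h *: dotprod x v]/(h * dotprod x v) /dotprod mulr_sumr -big_split/=.
by apply: eq_bigr => i _; rewrite !mxE; ring.
Qed.

Lemma continuous_dotprod (x : V) : continuous (dotprod x).
Proof.
have -> : dotprod x = \sum_(i < n) (fun y : V => x ord0 i * y ord0 i).
  by apply/funext => y; rewrite fct_sumE.
move=> y; apply: differentiable_continuous; apply: differentiable_sum => i.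
by apply: differentiableM => //; exact: differentiable_coordinate.
Qed.

Lemma dotprodC (x y : V) : dotprod x y = dotprod y x.
Proof. by apply: eq_bigr => i _; rewrite mulrC. Qed.

Lemma measurable_cos_dot (t : R) (x : V) :
  measurable_fun setT (fun y => cos (t * dotprod x y)).
Proof.
apply: measurableT_comp; first exact: continuous_measurable_fun (@continuous_cos R).
by apply: measurable_funM => //; exact: measurable_dotprod.
Qed.

Lemma measurable_sin_dot (t : R) (x : V) :
  measurable_fun setT (fun y => sin (t * dotprod x y)).
Proof.
apply: measurableT_comp; first exact: continuous_measurable_fun (@continuous_sin R).
by apply: measurable_funM => //; exact: measurable_dotprod.
Qed.

Lemma dominated_cos t x f : dominated f -> dominated (fun y => f y * cos (t * dotprod x y)).
Proof.
move=> df; apply: dominatedM_le1 => // [|y]; first exact: measurable_cos_dot.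
exact: cos_max.
Qed.

Lemma dominated_sin t x f : dominated f -> dominated (fun y => f y * sin (t * dotprod x y)).
Proof.
move=> df; apply: dominatedM_le1 => // [|y]; first exact: measurable_sin_dot.
exact: sin_max.
Qed.

Lemma IntD f g : dominated f -> dominated g ->
  \int (fun x => f x + g x) = \int f + \int g.
Proof. by move=> df dg; rewrite RintegralD//; exact: dominated_integrable. Qed.

Lemma IntZ c f : dominated f -> \int (fun x => c * f x) = c * \int f.
Proof. by move=> df; rewrite RintegralZl//; exact: dominated_integrable. Qed.

Lemma IntN f : dominated f -> \int (fun x => - f x) = - \int f.
Proof.
by move=> df; under eq_Rintegral do rewrite -mulN1r; rewrite IntZ// mulN1r.
Qed.

Lemma continuous_line (f : V -> R) (x v : V) :
  continuous f -> continuous (fun t : R => f (t *: v + x)).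
Proof.
move=> cf t; apply: (@continuous_comp _ _ _ (fun t : R => t *: v + x) f); last exact: cf.
by apply: continuousD; [exact: scalel_continuous|exact: cvg_cst].
Qed.

Lemma continuous_trig (t : R) (x z : V) :
  {for z, continuous (fun y => cos (t * dotprod x y))} /\
  {for z, continuous (fun y => sin (t * dotprod x y))}.
Proof.
have cd : {for z, continuous (fun y => t * dotprod x y)}.
  by apply: continuousM; [exact: (@cst_continuous _ _ t)|exact: continuous_dotprod].
split.
  exact: (@continuous_comp _ _ _ (fun y => t * dotprod x y) cos z cd (@continuous_cos R _)).
exact: (@continuous_comp _ _ _ (fun y => t * dotprod x y) sin z cd (@continuous_sin R _)).
Qed.

(** Integration by parts against a character: the derivative of the product
    has integral zero. *)
Lemma Int_partial_cos (j : 'I_n) (u u' : V -> R) t x :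
  dominated u -> dominated u' -> continuous u -> continuous u' ->
  (forall y, is_derive y (delta_mx ord0 j) u (u' y)) ->
  \int (fun y => u' y * cos (t * dotprod x y)) =
  t * x ord0 j * \int (fun y => u y * sin (t * dotprod x y)).
Proof.
move=> du du' cu cu' uu'; apply/eqP; rewrite -subr_eq0; apply/eqP.
have dd : dominated (fun y => - (t * x ord0 j) * (u y * sin (t * dotprod x y))).
  by apply: dominatedZ; exact: dominated_sin.
rewrite -mulNr -IntZ -?IntD//; try exact: dominated_cos; last exact: dominated_sin.
apply: (@Rintegral_partial_eq0 _ _ j (fun y => u y * cos (t * dotprod x y))).
- exact: dominated_cos.
- by apply: dominatedD => //; exact: dominated_cos.
- move=> y.
  have H := is_derive_comp1 (is_deriveZ t (is_derive_dotprod x y (delta_mx ord0 j)))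
    (is_derive_cos _).
  apply: is_derive_eq (is_deriveM (uu' y) H) _.
  by rewrite dotprod_delta /GRing.scale/=; ring.
- move=> y; apply: (@continuous_line (fun y => u' y * cos (t * dotprod x y) +
    - (t * x ord0 j) * (u y * sin (t * dotprod x y)))) => z.
  have [cc cs] := continuous_trig t x z.
  exact: (continuousD (continuousM (cu' z) cc)
    (continuousM (@cst_continuous _ _ _ z) (continuousM (cu z) cs))).
Qed.

Lemma Int_partial_sin (j : 'I_n) (u u' : V -> R) t x :
  dominated u -> dominated u' -> continuous u -> continuous u' ->
  (forall y, is_derive y (delta_mx ord0 j) u (u' y)) ->
  \int (fun y => u' y * sin (t * dotprod x y)) =
  - (t * x ord0 j * \int (fun y => u y * cos (t * dotprod x y))).
Proof.
move=> du du' cu cu' uu'; apply/eqP; rewrite -addr_eq0; apply/eqP.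
have dd : dominated (fun y => t * x ord0 j * (u y * cos (t * dotprod x y))).
  by apply: dominatedZ; exact: dominated_cos.
rewrite -IntZ -?IntD//; try exact: dominated_sin; last exact: dominated_cos.
apply: (@Rintegral_partial_eq0 _ _ j (fun y => u y * sin (t * dotprod x y))).
- exact: dominated_sin.
- by apply: dominatedD => //; exact: dominated_sin.
- move=> y.
  have H := is_derive_comp1 (is_deriveZ t (is_derive_dotprod x y (delta_mx ord0 j)))
    (is_derive_sin _).
  apply: is_derive_eq (is_deriveM (uu' y) H) _.
  by rewrite dotprod_delta /GRing.scale/=; ring.
- move=> y; apply: (@continuous_line (fun y => u' y * sin (t * dotprod x y) +
    t * x ord0 j * (u y * cos (t * dotprod x y)))) => z.
  have [cc cs] := continuous_trig t x z.
  exact: (continuousD (continuousM (cu' z) cs)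
    (continuousM (@cst_continuous _ _ _ z) (continuousM (cu z) cc))).
Qed.

End dominated_functions.

(** * Symbols: amplitudes times a power of the bracket and a Gaussian *)

Section symbols.
Context {R : realType} {n : nat}.
Local Notation V := 'rV[R]_n.+1.
Local Notation e0 := (delta_mx ord0 ord0 : V).

Definition weight (s b l : R) (x : V) : R := bracket l x `^ s * expR (- (b * sqnorm x)).

(** Differentiation preserves the weight and changes only the amplitude, so
    that one estimate on the weight serves all derivatives. *)
Definition symbol (s b : R) (u : R -> V -> R) :=
  exists2 a, elem a & forall l x, u l x = a l x * weight s b l x.

Lemma is_derive_weight s b l x i :
  is_derive x (delta_mx ord0 i) (weight s b l)
    ((2 * s * ((x + l *: e0) ord0 i / bracket l x) - 2 * b * x ord0 i) * weight s b l x).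
Proof.
have H : is_derive x (delta_mx ord0 i) (fun x : V => - (b * sqnorm x)) _ :=
  is_deriveN (is_deriveZ b (is_derive_sqnorm x (delta_mx ord0 i))).
have H1 := is_derive_comp1 H (is_derive_expR _).
have H2 := is_derive_comp1 (is_derive_bracket l x i) (is_derive1_powR s (bracket_gt0 l x)).
apply: is_derive_eq (is_deriveM H2 H1) _.
rewrite /weight dotprod_delta /GRing.scale/= powRD; last by rewrite bracket_neq0 implybT.
by rewrite powR_inv1 ?(ltW (bracket_gt0 _ _))//; field; rewrite bracket_neq0.
Qed.

Lemma differentiable_weight s b l x : differentiable (weight s b l) x.
Proof.
apply: differentiableM.
  exact: differentiable_comp1 (differentiable_bracket l x) (is_derive1_powR s (bracket_gt0 l x)).
apply: (differentiable_comp1 _ (is_derive_expR _)).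
by apply: differentiableN; apply: differentiableM => //; exact: differentiable_sqnorm.
Qed.

Lemma symbol_differentiable s b u : symbol s b u -> forall l x, differentiable (u l) x.
Proof.
move=> [a ea ua] l x; have -> : u l = fun x => a l x * weight s b l x by exact/funext.
by apply: differentiableM; [exact: elem_differentiable|exact: differentiable_weight].
Qed.

Lemma symbol_continuous s b u : symbol s b u -> forall l, continuous (u l).
Proof.
by move=> su l x; apply: differentiable_continuous; exact: symbol_differentiable su l x.
Qed.

Lemma symbol_measurable s b u : symbol s b u -> forall l, measurable_fun setT (u l).
Proof.
move=> [a ea ua] l; have -> : u l = fun x => a l x * weight s b l x by exact/funext.
apply: measurable_funM; first exact: elem_measurable.
apply: measurable_funM.
  exact: measurableT_comp (measurable_powR _) (measurable_bracket l).
apply: measurableT_comp; first exact: measurable_expR.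
by apply: measurableT_comp => //; apply: measurable_funM => //; exact: measurable_sqnorm.
Qed.

Lemma symbolD s b u v : symbol s b u -> symbol s b v ->
  symbol s b (fun l x => u l x + v l x).
Proof.
move=> [a ea ua] [c ec vc]; exists (fun l x => a l x + c l x); first exact: elem_add.
by move=> l x; rewrite ua vc mulrDl.
Qed.

Lemma symbolM s b a u : elem a -> symbol s b u -> symbol s b (fun l x => a l x * u l x).
Proof.
move=> ea [c ec uc]; exists (fun l x => a l x * c l x); first exact: elem_mul.
by move=> l x; rewrite uc mulrA.
Qed.

Lemma symbolZ s b (c : R) u : symbol s b u -> symbol s b (fun l x => c * u l x).
Proof. exact: (symbolM (elem_cst c)). Qed.

Lemma symbolN s b u : symbol s b u -> symbol s b (fun l x => - u l x).
Proof.
move=> su; have -> : (fun l x => - u l x) = (fun l x => (-1) * u l x).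
  by apply/funext => l; apply/funext => x; rewrite mulN1r.
exact: symbolZ.
Qed.

Lemma symbol_deriv s b u i : symbol s b u -> exists2 u', symbol s b u' &
  forall l x, is_derive x (delta_mx ord0 i) (u l) (u' l x).
Proof.
move=> [a ea ua]; have [a' ea' da] := elem_deriv i ea.
exists (fun l x => (a' l x + a l x * (2 * s * ((x + l *: e0) ord0 i / bracket l x) +
    (- 2 * b) * x ord0 i)) * weight s b l x).
  exists (fun l x => a' l x + a l x * (2 * s * ((x + l *: e0) ord0 i / bracket l x) +
    (- 2 * b) * x ord0 i)) => //.
  apply: elem_add => //; apply: elem_mul => //; apply: elem_add.
    by apply: elem_mul; [exact: elem_cst|exact: elem_dir].
  by apply: elem_mul; [exact: elem_cst|exact: elem_coord].
move=> l x; have -> : u l = fun x => a l x * weight s b l x by exact/funext.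
apply: is_derive_eq (is_deriveM (da l x) (is_derive_weight s b l x i)) _.
by rewrite /GRing.scale/=; ring.
Qed.

(** The Gaussian absorbs every power of 1 + |x|^2: that of the amplitude,
    that of [bracket_le], the k requested, and the dimension for [decay_wt].
    What remains is the power of 1 + l^2. *)
Lemma symbol_poly_bound s b u k : 0 <= s -> 0 < b -> symbol s b u ->
  exists2 C : R, 0 <= C &
    forall l x, (1 + sqnorm x) ^+ k * `|u l x| <= C * (1 + l ^+ 2) `^ s * decay_wt x.
Proof.
move=> s0 b0 [a ea ua]; have [A [p [A0 aA]]] := elem_bound ea.
pose q := (Num.trunc s).+1.
have [B B0 expB] := pow_expR_bound (k + p + q + n.+1) b0.
exists (A * 2 `^ s * B); first by rewrite !mulr_ge0// powR_ge0.
move=> l x; rewrite ua normrM.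
have y1 : 1 <= 1 + sqnorm x by rewrite lerDl sqnorm_ge0.
have y0 : 0 < 1 + sqnorm x by exact: lt_le_trans y1.
have wge0 : 0 <= weight s b l x by rewrite mulr_ge0 ?powR_ge0 ?expR_ge0.
rewrite (ger0_norm wge0).
have h1 : bracket l x `^ s <= 2 `^ s * (1 + l ^+ 2) `^ s * (1 + sqnorm x) ^+ q.
  have l1 : 0 <= 1 + l ^+ 2 by rewrite addr_ge0// sqr_ge0.
  apply: (@le_trans _ _ ((2 * (1 + l ^+ 2) * (1 + sqnorm x)) `^ s)).
    apply: ge0_ler_powR => //; last exact: bracket_le.
      by rewrite nnegrE ltW// bracket_gt0.
    by rewrite nnegrE !mulr_ge0// ltW.
  rewrite powRM ?mulr_ge0 ?(ltW y0)// powRM// ler_wpM2l ?mulr_ge0 ?powR_ge0//.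
  rewrite -powR_mulrn ?(ltW y0)// ler_powR//.
  by rewrite ltW// truncnS_gt.
have h2 : expR (- (b * sqnorm x)) * (1 + sqnorm x) ^+ (k + p + q) <= B * decay_wt x.
  have := expB _ (sqnorm_ge0 x); rewrite exprD => h.
  have : expR (- (b * sqnorm x)) * (1 + sqnorm x) ^+ (k + p + q) <=
      B * ((1 + sqnorm x) ^+ n.+1)^-1.
    rewrite ler_pdivlMr ?exprn_gt0//; apply: le_trans h.
    by rewrite le_eqVlt; apply/orP; left; apply/eqP; ring.
  move/le_trans; apply; rewrite ler_wpM2l//; exact: decay_wt_ge.
apply: (@le_trans _ _ ((1 + sqnorm x) ^+ k * (A * (1 + sqnorm x) ^+ p *
   (2 `^ s * (1 + l ^+ 2) `^ s * (1 + sqnorm x) ^+ q * expR (- (b * sqnorm x)))))).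
  rewrite ler_wpM2l ?exprn_ge0 ?(ltW y0)// ler_pM//.
  by rewrite /weight ler_wpM2r// expR_ge0.
have -> : (1 + sqnorm x) ^+ k * (A * (1 + sqnorm x) ^+ p *
   (2 `^ s * (1 + l ^+ 2) `^ s * (1 + sqnorm x) ^+ q * expR (- (b * sqnorm x)))) =
   A * 2 `^ s * (1 + l ^+ 2) `^ s *
   (expR (- (b * sqnorm x)) * (1 + sqnorm x) ^+ (k + p + q)).
  by rewrite !exprD; ring.
have -> : A * 2 `^ s * B * (1 + l ^+ 2) `^ s * decay_wt x =
   A * 2 `^ s * (1 + l ^+ 2) `^ s * (B * decay_wt x) by ring.
by rewrite ler_wpM2l// !mulr_ge0// powR_ge0.
Qed.

Lemma symbol_dominated s b u l : 0 <= s -> 0 < b -> symbol s b u -> dominated (u l).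
Proof.
move=> s0 b0 su; split; first exact: symbol_measurable su l.
have [C C0 uC] := symbol_poly_bound 0 s0 b0 su.
by exists (C * (1 + l ^+ 2) `^ s) => x; have := uC l x; rewrite expr0 mul1r.
Qed.

End symbols.

(** * Oscillatory integrals of complex functions *)

Section complex_integral.
Context {R : realType} {n : nat}.
Local Notation V := 'rV[R]_n.
Local Notation mu := (@lebesgue_rV R n).
Implicit Types (u f g : V -> R[i]).

Lemma complexP (z w : R[i]) : complex.Re z = complex.Re w ->
  complex.Im z = complex.Im w -> z = w.
Proof. by case: z => a b; case: w => c d /= -> ->. Qed.

Lemma cReD (z w : R[i]) : complex.Re (z + w) = complex.Re z + complex.Re w.
Proof. by case: z; case: w. Qed.

Lemma cImD (z w : R[i]) : complex.Im (z + w) = complex.Im z + complex.Im w.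
Proof. by case: z; case: w. Qed.

Lemma cReM (z w : R[i]) :
  complex.Re (z * w) = complex.Re z * complex.Re w - complex.Im z * complex.Im w.
Proof. by case: z; case: w. Qed.

Lemma cImM (z w : R[i]) :
  complex.Im (z * w) = complex.Re z * complex.Im w + complex.Im z * complex.Re w.
Proof. by case: z; case: w. Qed.

Lemma normc_le (z : R[i]) : normc z <= `|complex.Re z| + `|complex.Im z|.
Proof.
case: z => a b /=; rewrite -[leRHS]ger0_norm ?addr_ge0// -sqrtr_sqr ler_wsqrtr//.
by rewrite sqrrD !real_normK ?num_real// lerD2r lerDl mulrn_wge0// mulr_ge0.
Qed.

Lemma Re_le_normc (z : R[i]) : `|complex.Re z| <= normc z.
Proof. by case: z => a b /=; rewrite -sqrtr_sqr ler_wsqrtr// lerDl sqr_ge0. Qed.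

Lemma Im_le_normc (z : R[i]) : `|complex.Im z| <= normc z.
Proof. by case: z => a b /=; rewrite -sqrtr_sqr ler_wsqrtr// lerDr sqr_ge0. Qed.

Lemma normc_ge0 (z : R[i]) : 0 <= normc z.
Proof. by case: z => a b /=; rewrite sqrtr_ge0. Qed.

Lemma normc_real (a : R) : normc a%:C = `|a|.
Proof. by rewrite /= expr0n/= addr0 sqrtr_sqr. Qed.

Lemma normc_cis (t : R) : normc (cis t) = 1.
Proof. by rewrite /= cos2Dsin2 sqrtr1. Qed.

Lemma ler_normcD (z w : R[i]) : normc (z + w) <= normc z + normc w.
Proof. exact: (@le_normcD R z w). Qed.

Lemma cisD (a b : R) : cis (a + b) = cis a * cis b.
Proof.
by apply: complexP; rewrite ?cReM ?cImM /= ?cosD ?sinD; ring.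
Qed.

Lemma cReN (z : R[i]) : complex.Re (- z) = - complex.Re z.
Proof. by case: z. Qed.

Lemma cImN (z : R[i]) : complex.Im (- z) = - complex.Im z.
Proof. by case: z. Qed.

Definition cdominated u :=
  dominated (fun x => complex.Re (u x)) /\ dominated (fun x => complex.Im (u x)).

Lemma cdominatedD f g : cdominated f -> cdominated g -> cdominated (fun x => f x + g x).
Proof.
move=> [f1 f2] [g1 g2]; split.
  by under eq_fun do rewrite cReD; exact: dominatedD.
by under eq_fun do rewrite cImD; exact: dominatedD.
Qed.

Lemma cdominatedZ (c : R[i]) f : cdominated f -> cdominated (fun x => c * f x).
Proof.
move=> [f1 f2]; split.
  under eq_fun do rewrite cReM; apply: dominatedD; first exact: dominatedZ.
  by apply: dominatedN; exact: dominatedZ.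
by under eq_fun do rewrite cImM; apply: dominatedD; exact: dominatedZ.
Qed.

Lemma cdominated_cis t x f : cdominated f ->
  cdominated (fun y => f y * cis (t * dotprod x y)).
Proof.
move=> [f1 f2]; split.
  under eq_fun do rewrite cReM/=; apply: dominatedD; first exact: dominated_cos.
  by apply: dominatedN; exact: dominated_sin.
under eq_fun do rewrite cImM/=; apply: dominatedD; first exact: dominated_sin.
exact: dominated_cos.
Qed.

Lemma cintegralD f g : cdominated f -> cdominated g ->
  cintegral setT (fun x => f x + g x) = cintegral setT f + cintegral setT g.
Proof.
move=> [f1 f2] [g1 g2]; apply: complexP; rewrite /= -IntD//.
  by apply: eq_Rintegral => x _; rewrite cReD.
by apply: eq_Rintegral => x _; rewrite cImD.
Qed.

Lemma cintegralZ c f : cdominated f ->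
  cintegral setT (fun x => c * f x) = c * cintegral setT f.
Proof.
move=> [f1 f2]; apply: complexP; rewrite ?cReM ?cImM /= -?IntZ// -?IntN -?IntD;
  try (do 1?apply: dominatedN; exact: dominatedZ).
  by apply: eq_Rintegral => x _; rewrite cReM.
by apply: eq_Rintegral => x _; rewrite cImM.
Qed.

Lemma normc_cintegral_le f (K : R) : cdominated f ->
  (forall x, normc (f x) <= K * decay_wt x) ->
  normc (cintegral setT f) <= 2 * K * Rintegral mu setT (@decay_wt R n).
Proof.
move=> [f1 f2] fK.
have dw : dominated (@decay_wt R n).
  split; first exact: measurable_decay_wt.
  by exists 1 => x; rewrite mul1r ger0_norm// ltW// decay_wt_gt0.
have B (h : V -> R) : dominated h -> (forall x, `|h x| <= normc (f x)) ->
    `|Rintegral mu setT h| <= K * Rintegral mu setT (@decay_wt R n).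
  move=> dh hf; apply: le_trans (le_normr_Rintegral _ _) _ => //.
    exact: dominated_integrable.
  rewrite -IntZ//; apply: le_Rintegral => //.
  - apply: dominated_integrable; case: dh => mh [C hC]; split; first exact: measurableT_comp.
    by exists C => x; rewrite normr_id.
  - by apply: dominated_integrable; exact: dominatedZ.
  - by move=> x _; exact: le_trans (hf x) (fK x).
apply: le_trans (normc_le _) _; rewrite -mulrA mulr_natl mulr2n lerD//= B// => x.
  exact: Re_le_normc.
exact: Im_le_normc.
Qed.

(** The unnormalised Fourier integral: t = -1 gives the transform and t = 1
    its inverse. A real t also serves as the variable of the differential
    equation that determines Gaussian transforms. *)
Definition phase_int (t : R) u (x : V) : R[i] :=
  cintegral setT (fun y => u y * cis (t * dotprod x y)).

Lemma fourierE u x : fourier u x = phase_int (-1) u x.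
Proof.
rewrite /fourier /phase_int; congr cintegral; apply/funext => y.
by rewrite mulN1r dotprodC.
Qed.

Lemma inv_fourierE u x : inv_fourier u x = (((2 * pi) ^+ n)^-1)%:C * phase_int 1 u x.
Proof.
rewrite /inv_fourier /phase_int; congr (_ * cintegral _ _); apply/funext => y.
by rewrite mul1r.
Qed.

Lemma phase_intD t f g x : cdominated f -> cdominated g ->
  phase_int t (fun y => f y + g y) x = phase_int t f x + phase_int t g x.
Proof.
move=> df dg; rewrite -cintegralD; try exact: cdominated_cis.
by congr cintegral; apply/funext => y; rewrite mulrDl.
Qed.

Lemma phase_intZ t c f x : cdominated f -> phase_int t (fun y => c * f y) x = c * phase_int t f x.
Proof.
move=> df; rewrite -cintegralZ; last exact: cdominated_cis.
by congr cintegral; apply/funext => y; rewrite mulrA.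
Qed.

(** By parts, differentiation becomes multiplication by the frequency. *)
Lemma phase_int_partial (j : 'I_n) u u' t x :
  cdominated u -> cdominated u' ->
  (forall y, cdifferentiable u y) -> (forall y, cdifferentiable u' y) ->
  (forall y, partial j u y = u' y) ->
  phase_int t u' x = (0 +i* - (t * x ord0 j)) * phase_int t u x.
Proof.
move=> [u1 u2] [u1' u2'] du du' uu'.
have c (h : V -> R) : (forall y, differentiable h y) -> continuous h.
  by move=> dh y; exact: differentiable_continuous.
have cR := c _ (fun y => (du y).1); have cI := c _ (fun y => (du y).2).
have cR' := c _ (fun y => (du' y).1); have cI' := c _ (fun y => (du' y).2).
have dR y : is_derive y (delta_mx ord0 j) (fun y => complex.Re (u y)) (complex.Re (u' y)).
  by rewrite -uu' /=; apply: derivableP; apply: diff_derivable; exact: (du y).1.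
have dI y : is_derive y (delta_mx ord0 j) (fun y => complex.Im (u y)) (complex.Im (u' y)).
  by rewrite -uu' /=; apply: derivableP; apply: diff_derivable; exact: (du y).2.
have E (v : V -> R[i]) : cdominated v -> phase_int t v x =
    (Rintegral mu setT (fun y => complex.Re (v y) * cos (t * dotprod x y)) -
     Rintegral mu setT (fun y => complex.Im (v y) * sin (t * dotprod x y))) +i*
    (Rintegral mu setT (fun y => complex.Re (v y) * sin (t * dotprod x y)) +
     Rintegral mu setT (fun y => complex.Im (v y) * cos (t * dotprod x y))).
  move=> [v1 v2]; rewrite -IntN; last exact: dominated_sin.
  rewrite -!IntD; try exact: dominated_cos; try exact: dominated_sin;
    try (apply: dominatedN; exact: dominated_sin).
  apply: complexP => /=; apply: eq_Rintegral => y _; first by rewrite cReM.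
  by rewrite cImM.
rewrite !E//.
rewrite (Int_partial_cos _ _ u1 u1')// (Int_partial_sin _ _ u2 u2')//.
rewrite (Int_partial_sin _ _ u1 u1')// (Int_partial_cos _ _ u2 u2')//.
by apply: complexP; rewrite ?cReM ?cImM /=; ring.
Qed.

End complex_integral.

(** * Decay of the oscillatory integral of a symbol *)

Section decay.
Context {R : realType} {n : nat}.
Local Notation V := 'rV[R]_n.+1.

Definition csymbol (s b : R) (u : R -> V -> R[i]) :=
  symbol s b (fun l x => complex.Re (u l x)) /\
  symbol s b (fun l x => complex.Im (u l x)).

Lemma csymbol_dominated s b u l : 0 <= s -> 0 < b -> csymbol s b u -> cdominated (u l).
Proof.
move=> s0 b0 [u1 u2]; split.
  exact: (symbol_dominated (u := fun l x => complex.Re (u l x)) l s0 b0 u1).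
exact: (symbol_dominated (u := fun l x => complex.Im (u l x)) l s0 b0 u2).
Qed.

Lemma csymbol_differentiable s b u l x : csymbol s b u -> cdifferentiable (u l) x.
Proof.
move=> [u1 u2]; split.
  exact: (symbol_differentiable (u := fun l x => complex.Re (u l x)) u1).
exact: (symbol_differentiable (u := fun l x => complex.Im (u l x)) u2).
Qed.

Lemma csymbolD s b u v : csymbol s b u -> csymbol s b v ->
  csymbol s b (fun l x => u l x + v l x).
Proof.
move=> [u1 u2] [v1 v2]; split.
  have -> : (fun l x => complex.Re (u l x + v l x)) =
     (fun l x => complex.Re (u l x) + complex.Re (v l x)).
    by apply/funext => l; apply/funext => x; rewrite cReD.
  exact: symbolD.
have -> : (fun l x => complex.Im (u l x + v l x)) =
   (fun l x => complex.Im (u l x) + complex.Im (v l x)).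
  by apply/funext => l; apply/funext => x; rewrite cImD.
exact: symbolD.
Qed.

Lemma csymbolM s b a1 a2 u : elem a1 -> elem a2 -> csymbol s b u ->
  csymbol s b (fun l x => (a1 l x +i* a2 l x) * u l x).
Proof.
move=> e1 e2 [u1 u2]; split.
  have -> : (fun l x => complex.Re ((a1 l x +i* a2 l x) * u l x)) =
     (fun l x => a1 l x * complex.Re (u l x) + - (a2 l x * complex.Im (u l x))).
    by apply/funext => l; apply/funext => x; rewrite cReM.
  by apply: symbolD; [exact: symbolM|apply: symbolN; exact: symbolM].
have -> : (fun l x => complex.Im ((a1 l x +i* a2 l x) * u l x)) =
   (fun l x => a1 l x * complex.Im (u l x) + a2 l x * complex.Re (u l x)).
  by apply/funext => l; apply/funext => x; rewrite cImM.
by apply: symbolD; exact: symbolM.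
Qed.

Lemma csymbolZ s b (c : R[i]) u : csymbol s b u -> csymbol s b (fun l x => c * u l x).
Proof. by case: c => c1 c2; apply: csymbolM; exact: elem_cst. Qed.

Lemma csymbol_partial s b u j : csymbol s b u -> exists2 u', csymbol s b u' &
  forall l x, partial j (u l) x = u' l x.
Proof.
move=> [/(@symbol_deriv _ _ _ _ _ j)[v1 sv1 d1] /(@symbol_deriv _ _ _ _ _ j)[v2 sv2 d2]].
exists (fun l x => v1 l x +i* v2 l x) => // l x.
by apply: complexP => /=; apply: derive_val.
Qed.

(** Each factor 1 + x_j^2 comes from letting 1 - d_j^2 act on the symbol. *)
Lemma csymbol_phase_int_weight s b u (r : seq 'I_n.+1) : 0 <= s -> 0 < b -> csymbol s b u ->
  exists2 u', csymbol s b u' & forall l x,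
    phase_int 1 (u' l) x = (\prod_(j <- r) (1 + x ord0 j ^+ 2))%:C * phase_int 1 (u l) x.
Proof.
move=> s0 b0 su; elim: r => [|j r [v sv vE]].
  by exists u => // l x; rewrite big_nil mul1r.
have [v' sv' v'E] := csymbol_partial j sv.
have [w sw wE] := csymbol_partial j sv'.
exists (fun l x => v l x + (-1) * w l x); first by apply: csymbolD => //; exact: csymbolZ.
move=> l x; have cd u' : csymbol s b u' -> cdominated (u' l).
  by move=> h; exact: (csymbol_dominated l s0 b0 h).
have cdiff u' : csymbol s b u' -> forall y, cdifferentiable (u' l) y.
  by move=> h y; exact: (csymbol_differentiable l y h).
rewrite phase_intD; [|exact: cd|by apply: cdominatedZ; exact: cd].
rewrite phase_intZ; last exact: cd.
rewrite (@phase_int_partial _ _ j (v' l) (w l)); [|exact: cd|exact: cd|exact: cdiff|exact: cdiff|exact: wE].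
rewrite (@phase_int_partial _ _ j (v l) (v' l)); [|exact: cd|exact: cd|exact: cdiff|exact: cdiff|exact: v'E].
rewrite vE big_cons; set P := \prod_(_ <- _) _; set o := phase_int _ _ _.
by apply: complexP; rewrite ?(cReM, cImM, cReD, cImD)/=; ring.
Qed.

(** One factor 1 + x_j^2 per coordinate multiplies up to the inverse of
    [decay_wt]; the symbol that absorbs them is integrable, with a bound
    carrying the power of 1 + l^2. *)
Lemma csymbol_decay s b u : 0 <= s -> 0 < b -> csymbol s b u ->
  exists2 C : R, 0 <= C & forall l x,
    normc (phase_int 1 (u l) x) <= C * (1 + l ^+ 2) `^ s * decay_wt x.
Proof.
move=> s0 b0 su.
have [v sv vE] := csymbol_phase_int_weight (index_enum 'I_n.+1) s0 b0 su.
have [sv1 sv2] := sv.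
have [C1 C10 B1] := symbol_poly_bound 0 s0 b0 sv1.
have [C2 C20 B2] := symbol_poly_bound 0 s0 b0 sv2.
pose I := Rintegral (@lebesgue_rV R n.+1) setT (@decay_wt R n.+1).
have I0 : 0 <= I by apply: Rintegral_ge0 => x _; exact/ltW/decay_wt_gt0.
exists (2 * (C1 + C2) * I); first by rewrite !mulr_ge0// addr_ge0.
move=> l x.
have P0 : 0 < \prod_j (1 + x ord0 j ^+ 2).
  by apply: prodr_gt0 => j _; rewrite ltr_pwDl// sqr_ge0.
have wtE : decay_wt x = (\prod_j (1 + x ord0 j ^+ 2))^-1 by rewrite -prodfV.
rewrite wtE ler_pdivlMr//.
have -> : normc (phase_int 1 (u l) x) * \prod_j (1 + x ord0 j ^+ 2) = normc (phase_int 1 (v l) x).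
  by rewrite vE normcM normc_real (gtr0_norm P0) mulrC.
apply: le_trans (normc_cintegral_le (K := (C1 + C2) * (1 + l ^+ 2) `^ s) _ _) _.
- by apply: cdominated_cis; exact: (csymbol_dominated l s0 b0 sv).
- move=> y; rewrite normcM normc_cis mulr1 (le_trans (normc_le _))// !mulrDl lerD//.
    by have := B1 l y; rewrite expr0 mul1r.
  by have := B2 l y; rewrite expr0 mul1r.
- by rewrite le_eqVlt; apply/orP; left; apply/eqP; rewrite /I; ring.
Qed.

End decay.

(** * The mass of a Gaussian *)

Section gaussian_mass.
Context {R : realType}.
Local Notation leb := (@lebesgue_measure R).
Local Notation mu := (@lebesgue_rV R).

Definition gauss n (b : R) (x : 'rV[R]_n) : R := expR (- (b * sqnorm x)).

Lemma gauss_dominated n b : 0 < b -> dominated (@gauss n b).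
Proof.
move=> b0; split.
  apply: measurableT_comp; first exact: measurable_expR.
  by apply: measurableT_comp => //; apply: measurable_funM => //; exact: measurable_sqnorm.
have [C C0 HC] := pow_expR_bound n b0; exists C => x.
rewrite ger0_norm ?expR_ge0//.
have y0 : 0 < 1 + sqnorm x by rewrite ltr_pwDl// sqnorm_ge0.
apply: le_trans (ler_wpM2l C0 (decay_wt_ge x)).
by rewrite ler_pdivlMr ?exprn_gt0// mulrC HC// sqnorm_ge0.
Qed.

(** This is a centred normal density up to its normalising factor. *)
Lemma Rintegral_gauss1 (b : R) : 0 < b ->
  leb.-integrable setT (EFin \o (fun t : R => expR (- (b * t ^+ 2)))) /\
  Rintegral leb setT (fun t : R => expR (- (b * t ^+ 2))) = Num.sqrt (pi / b).
Proof.
move=> b0; pose s := (Num.sqrt (2 * b))^-1.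
have s0 : s != 0 by rewrite invr_eq0 sqrtr_eq0 -ltNge mulr_gt0.
have s2 : s ^+ 2 = (2 * b)^-1 by rewrite exprVn sqr_sqrtr// ltW// mulr_gt0.
have peak : normal_peak s = (Num.sqrt (pi / b))^-1.
  rewrite /normal_peak s2; congr (Num.sqrt _)^-1.
  by rewrite -mulr_natr; field; rewrite gt_eqF.
have E t : expR (- (b * t ^+ 2)) = Num.sqrt (pi / b) * normal_pdf 0 s t.
  rewrite normal_pdfE// peak mulVKf; last first.
    by rewrite sqrtr_eq0 -ltNge divr_gt0// pi_gt0.
  rewrite /normal_fun s2; congr expR; rewrite -[X in _ / X]mulr_natr.
  by field; rewrite gt_eqF.
have i1 := integrable_normal_pdf 0 s.
split.
  rewrite (_ : _ \o _ = (fun t => (Num.sqrt (pi / b))%:E * (normal_pdf 0 s t)%:E)%E).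
    exact: (@integrableZl _ _ _ _ _ measurableT).
  by apply/funext => t /=; rewrite E.
under eq_Rintegral do rewrite E.
rewrite RintegralZl//.
by rewrite /Rintegral integral_normal_pdf mulr1.
Qed.

Lemma Rintegral_gauss n (b : R) : 0 < b ->
  Rintegral (mu n) setT (gauss b) = Num.sqrt (pi / b) ^+ n.
Proof.
move=> b0; have [i1 I1] := Rintegral_gauss1 b0.
elim: n => [|n IHn].
  rewrite expr0 /Rintegral integral_dirac//; last first.
    by apply/measurable_EFinP; have [] := gauss_dominated 0 b0.
  by rewrite diracT mul1e /= /gauss /sqnorm /dotprod big_ord0 mulr0 oppr0 expR0.
rewrite Rintegral_cons; last exact: gauss_dominated.
transitivity (Rintegral leb setT
    (fun t : R => Num.sqrt (pi / b) ^+ n * expR (- (b * t ^+ 2)))); last first.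
  by rewrite RintegralZl// I1 exprSr.
apply: eq_Rintegral => t _.
rewrite -IHn -RintegralZr//; last exact: dominated_integrable (gauss_dominated n b0).
apply: eq_Rintegral => v _; rewrite /gauss -expRD; congr expR.
rewrite /sqnorm /dotprod big_ord_recl cons_rV0.
under [X in _ + X]eq_bigr do rewrite cons_rVS.
by ring.
Qed.

End gaussian_mass.

(** * Gaussian Fourier integrals *)

Section gaussian_transform.
Context {R : realType} {n : nat}.
Local Notation V := 'rV[R]_n.+1.
Local Notation mu := (@lebesgue_rV R n.+1).
Local Notation "\int f" := (Rintegral mu setT f) (at level 36, f at level 36).
Context (b : R) (b0 : 0 < b).

Lemma symbol_elem_gauss (a : R -> V -> R) : elem a ->
  symbol 0 b (fun l x => a l x * gauss b x).
Proof. by move=> ea; exists a => // l x; rewrite /weight powRr0 mul1r. Qed.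

Let symbol_gauss : symbol 0 b (fun _ (x : V) => gauss b x).
Proof.
have := symbol_elem_gauss (elem_cst 1).
by under eq_fun do under eq_fun do rewrite mul1r.
Qed.

Let symbol_coord_gauss j : symbol 0 b (fun _ (x : V) => x ord0 j * gauss b x).
Proof. exact: symbol_elem_gauss (elem_coord j). Qed.

Lemma is_derive_gauss j (x : V) :
  is_derive x (delta_mx ord0 j) (gauss b) (- 2 * b * (x ord0 j * gauss b x)).
Proof.
have H : is_derive x (delta_mx ord0 j) (fun x : V => - (b * sqnorm x)) _ :=
  is_deriveN (is_deriveZ b (is_derive_sqnorm x (delta_mx ord0 j))).
apply: is_derive_eq (is_derive_comp1 H (is_derive_expR _)) _.
by rewrite dotprod_delta /GRing.scale/= /gauss; ring.
Qed.

Let dom (u : V -> R) : symbol 0 b (fun _ => u) -> dominated u.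
Proof. by move=> su; exact: (symbol_dominated 0 _ b0 su). Qed.

Let cont (u : V -> R) : symbol 0 b (fun _ => u) -> continuous u.
Proof. by move=> su; exact: (@symbol_continuous _ _ _ _ (fun _ => u) su 0). Qed.

Let Int_coord_sin j t (x : V) :
  \int (fun y => y ord0 j * gauss b y * sin (t * dotprod x y)) =
  t * x ord0 j / (2 * b) * \int (fun y => gauss b y * cos (t * dotprod x y)).
Proof.
have s1 := symbolZ (- 2 * b) (symbol_coord_gauss j).
have := Int_partial_sin t x (dom symbol_gauss) (dom s1)
  (cont symbol_gauss) (cont s1) (is_derive_gauss j).
under eq_Rintegral do rewrite -mulrA.
rewrite IntZ; last exact: dominated_sin (dom (symbol_coord_gauss j)).
set I := \int _; set J := \int _ => H.
have -> : I = (- 2 * b * I) / (- 2 * b) by field; rewrite gt_eqF.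
by rewrite H; field; rewrite gt_eqF.
Qed.

Let Int_coord_cos j t (x : V) :
  \int (fun y => y ord0 j * gauss b y * cos (t * dotprod x y)) =
  - (t * x ord0 j / (2 * b) * \int (fun y => gauss b y * sin (t * dotprod x y))).
Proof.
have s1 := symbolZ (- 2 * b) (symbol_coord_gauss j).
have := Int_partial_cos t x (dom symbol_gauss) (dom s1)
  (cont symbol_gauss) (cont s1) (is_derive_gauss j).
under eq_Rintegral do rewrite -mulrA.
rewrite IntZ; last exact: dominated_cos (dom (symbol_coord_gauss j)).
set I := \int _; set J := \int _ => H.
have -> : I = (- 2 * b * I) / (- 2 * b) by field; rewrite gt_eqF.
by rewrite H; field; rewrite gt_eqF.
Qed.

Let symbol_dot_gauss (x : V) : symbol 0 b (fun _ (y : V) => dotprod x y * gauss b y).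
Proof.
apply: symbol_elem_gauss.
have H (r : seq 'I_n.+1) : elem (fun _ (y : V) => \sum_(i <- r) x ord0 i * y ord0 i).
  elim: r => [|i r IHr].
    have -> : (fun (_ : R) (y : V) => \sum_(i <- [::]) x ord0 i * y ord0 i) = fun _ _ => 0.
      by apply/funext => l; apply/funext => y; rewrite big_nil.
    exact: elem_cst.
  have -> : (fun (_ : R) (y : V) => \sum_(i <- i :: r) x ord0 i * y ord0 i) =
      fun (_ : R) (y : V) => x ord0 i * y ord0 i + \sum_(i <- r) x ord0 i * y ord0 i.
    by apply/funext => l; apply/funext => y; rewrite big_cons.
  by apply: elem_add => //; apply: elem_mul; [exact: elem_cst|exact: elem_coord].
exact: H.
Qed.

(** Differentiation under the integral sign brings down the factor dotprod x
    y, and a Gaussian moment dominates the result. *)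
Let derive_under (phi dphi : R -> R) (x : V) t :
  (forall z, is_derive z (1 : R) phi (dphi z)) ->
  (forall z, `|phi z| <= 1) -> (forall z, `|dphi z| <= 1) ->
  measurable_fun setT phi ->
  is_derive t (1 : R) (fun t => \int (fun y => gauss b y * phi (t * dotprod x y)))
    (\int (fun y => dotprod x y * gauss b y * dphi (t * dotprod x y))).
Proof.
move=> dd p1 dp1 mphi.
have dD := dom (symbol_dot_gauss x).
pose f t (y : V) := gauss b y * phi (t * dotprod x y).
have df z y : is_derive z (1 : R) (f ^~ y) (dotprod x y * gauss b y * dphi (z * dotprod x y)).
  have H : is_derive z (1 : R) (fun z => z * dotprod x y) (dotprod x y).
    apply: is_derive_eq (is_deriveM (is_derive_id z 1) (is_derive_cst (dotprod x y) z 1)) _.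
    by rewrite /GRing.scale/= mulr0 add0r mulr1.
  apply: is_derive_eq (is_deriveZ (gauss b y) (is_derive_comp1 H (dd _))) _.
  by rewrite /GRing.scale/=; ring.
have mf z : measurable_fun setT (f z).
  apply: measurable_funM; first by case: (dom symbol_gauss).
  apply: measurableT_comp => //; apply: measurable_funM => //.
  exact: measurable_dotprod.
have intf z : mu.-integrable setT (EFin \o f z).
  apply: dominated_integrable; apply: (dominated_norm_le _ (dom symbol_gauss)) => // y.
  by rewrite normrM ler_piMr.
have d1 z y : partial1of2 f z y = dotprod x y * gauss b y * dphi (z * dotprod x y).
  by rewrite partial1of2E; apply: derive_val.
have tI : `]t - 1, t + 1[%classic t.
  by rewrite /= in_itv/= ltrBlDr ltrDl ltr01.
have intG : mu.-integrable setT (EFin \o (fun y => `|dotprod x y * gauss b y|)).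
  apply: dominated_integrable; case: dD => mD [C DC]; split.
    exact: measurableT_comp.
  by exists C => y; rewrite normr_id.
have G_ub z y : `]t - 1, t + 1[%classic z -> setT y ->
    `|partial1of2 f z y| <= `|dotprod x y * gauss b y|.
  by move=> _ _; rewrite d1 normrM ler_piMr.
have der z y : `]t - 1, t + 1[%classic z -> setT y -> derivable (f ^~ y) z 1.
  by move=> _ _; have [] := df z y.
have G0 y : 0 <= `|dotprod x y * gauss b y| by [].
have D1 := derivable_under_integral measurableT tI (fun z _ => intf z) der G0 intG G_ub.
have D2 := differentiation_under_integral measurableT tI (fun z _ => intf z) der G0 intG G_ub.
split => //; rewrite -derive1E D2.
by apply: eq_Rintegral => y _; rewrite d1.
Qed.

(** exp (c t^2) is an integrating factor. *)
Let ode_gauss (y : R -> R) (c : R) :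
  (forall t, is_derive t (1 : R) y (- (2 * c * t * y t))) ->
  forall t, y t = y 0 * expR (- (c * t ^+ 2)).
Proof.
move=> dy t.
have dE z : is_derive z (1 : R) (fun z => expR (c * z ^+ 2)) (2 * c * z * expR (c * z ^+ 2)).
  have H : is_derive z (1 : R) (fun z => c * z ^+ 2) (2 * c * z).
    apply: is_derive_eq (is_deriveZ c (is_deriveX 2 (is_derive_id z 1))) _.
    by rewrite /GRing.scale/=; ring.
  by apply: is_derive_eq (is_derive_comp1 H (is_derive_expR _)) _; ring.
have dz z : is_derive z (1 : R) (fun z => y z * expR (c * z ^+ 2)) 0.
  apply: is_derive_eq (is_deriveM (dy z) (dE z)) _.
  by rewrite /GRing.scale/=; ring.
have := is_derive_0_is_cst t 0 dz.
rewrite expr0n/= mulr0 expR0 mulr1 => <-.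
by rewrite -mulrA -expRD subrr expR0 mulr1.
Qed.

Lemma sqnormE (x : V) : sqnorm x = \sum_i x ord0 i ^+ 2.
Proof. by apply: eq_bigr => i _; rewrite expr2. Qed.

Lemma Int_sum (I : Type) (r : seq I) (F : I -> V -> R) : (forall i, dominated (F i)) ->
  \int (fun x => \sum_(i <- r) F i x) = \sum_(i <- r) \int (F i) /\
  dominated (fun x => \sum_(i <- r) F i x).
Proof.
move=> dF; elim: r => [|i r [IH1 IH2]].
  split.
    by rewrite big_nil; under eq_Rintegral do rewrite big_nil; rewrite Rintegral_cst// mul0r.
  under eq_fun do rewrite big_nil; split; first exact: measurable_cst.
  by exists 0 => x; rewrite normr0 mul0r.
split.
  by under eq_Rintegral do rewrite big_cons; rewrite IntD// IH1 big_cons.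
by under eq_fun do rewrite big_cons; exact: dominatedD.
Qed.

(** As a function of t the integral solves a linear differential equation of
    the form [ode_gauss] with c = |x|^2 / (4 b): after differentiating under
    the integral sign, integration by parts in each coordinate gives back
    the same integral. The initial value is the mass of the Gaussian. *)
Lemma Int_gauss_cos t (x : V) :
  \int (fun y => gauss b y * cos (t * dotprod x y)) =
  Num.sqrt (pi / b) ^+ n.+1 * expR (- (sqnorm x / (4 * b) * t ^+ 2)).
Proof.
pose y t := \int (fun y => gauss b y * cos (t * dotprod x y)).
have y0 : y 0 = Num.sqrt (pi / b) ^+ n.+1.
  rewrite /y -Rintegral_gauss//; apply: eq_Rintegral => z _.
  by rewrite mul0r cos0 mulr1.
rewrite -y0; apply: (ode_gauss (y := y)) => {}t.
have := derive_under x t (phi := cos) (dphi := fun z => - sin z)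
  (@is_derive_cos R) (@cos_max R) _ (continuous_measurable_fun (@continuous_cos R)).
move=> /(_ _)/is_derive_eq; apply; first by move=> z; rewrite normrN sin_max.
transitivity (- \sum_i x ord0 i * \int (fun y => y ord0 i * gauss b y * sin (t * dotprod x y))).
  have dF i : dominated (fun y : V => x ord0 i * (y ord0 i * gauss b y * sin (t * dotprod x y))).
    by apply: dominatedZ; apply: dominated_sin; exact: dom.
  have [H1 H2] := Int_sum (index_enum 'I_n.+1) dF.
  have -> : \sum_i x ord0 i * \int (fun y => y ord0 i * gauss b y * sin (t * dotprod x y)) =
      \sum_i \int (fun y : V => x ord0 i * (y ord0 i * gauss b y * sin (t * dotprod x y))).
    by apply: eq_bigr => i _; rewrite IntZ//; apply: dominated_sin; exact: dom.
  rewrite -H1 -IntN//; apply: eq_Rintegral => z _.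
  rewrite mulrN; congr (- _); rewrite /dotprod !mulr_suml; apply: eq_bigr => i _.
  by rewrite !mulrA.
under eq_bigr do rewrite Int_coord_sin.
rewrite -/(y t) sqnormE !(mulr_suml, mulr_sumr, sumrN); congr (- _).
by apply: eq_bigr => i _; field; rewrite gt_eqF.
Qed.

(** The same differential equation, with initial value 0. *)
Lemma Int_gauss_sin t (x : V) :
  \int (fun y => gauss b y * sin (t * dotprod x y)) = 0.
Proof.
pose y t := \int (fun y => gauss b y * sin (t * dotprod x y)).
have y0 : y 0 = 0.
  rewrite /y; under eq_Rintegral do rewrite mul0r sin0 mulr0.
  by rewrite Rintegral_cst// mul0r.
suff dy z : is_derive z (1 : R) y (- (2 * (sqnorm x / (4 * b)) * z * y z)).
  by rewrite -/(y t) (ode_gauss dy) y0 mul0r.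
have := derive_under x z (phi := sin) (dphi := cos)
  (@is_derive_sin R) (@sin_max R) (@cos_max R) (continuous_measurable_fun (@continuous_sin R)).
move=> /is_derive_eq; apply.
transitivity (\sum_i x ord0 i * \int (fun y => y ord0 i * gauss b y * cos (z * dotprod x y))).
  have dF i : dominated (fun y : V => x ord0 i * (y ord0 i * gauss b y * cos (z * dotprod x y))).
    by apply: dominatedZ; apply: dominated_cos; exact: dom.
  have [H1 H2] := Int_sum (index_enum 'I_n.+1) dF.
  have -> : \sum_i x ord0 i * \int (fun y => y ord0 i * gauss b y * cos (z * dotprod x y)) =
      \sum_i \int (fun y : V => x ord0 i * (y ord0 i * gauss b y * cos (z * dotprod x y))).
    by apply: eq_bigr => i _; rewrite IntZ//; apply: dominated_cos; exact: dom.
  rewrite -H1; apply: eq_Rintegral => w _.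
  by rewrite /dotprod !mulr_suml; apply: eq_bigr => i _; rewrite !mulrA.
under eq_bigr do rewrite Int_coord_cos.
rewrite -/(y z) sqnormE !(mulr_suml, mulr_sumr) -sumrN.
by apply: eq_bigr => i _; field; rewrite gt_eqF.
Qed.

Lemma phase_int_gauss t (x : V) : phase_int t (fun y => (gauss b y)%:C) x =
  (Num.sqrt (pi / b) ^+ n.+1 * gauss (t ^+ 2 / (4 * b)) x)%:C.
Proof.
rewrite /phase_int; apply: complexP => /=.
  rewrite -[LHS]/(\int _) (_ : gauss _ x = expR (- (sqnorm x / (4 * b) * t ^+ 2))); last first.
    by rewrite /gauss; congr expR; field; rewrite gt_eqF.
  rewrite -Int_gauss_cos; apply: eq_Rintegral => y _.
  by rewrite mul0r subr0.
rewrite -[RHS](Int_gauss_sin t x); apply: eq_Rintegral => y _.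
by rewrite mul0r addr0.
Qed.

Lemma csymbol_real s (u : R -> V -> R) : symbol s b u -> csymbol s b (fun l x => (u l x)%:C).
Proof.
move=> su; split => //=; exists (fun _ _ => 0); first exact: elem_cst.
by move=> l x; rewrite mul0r.
Qed.

Lemma partial_real j (u : V -> R) x du : is_derive x (delta_mx ord0 j) u du ->
  partial j (fun y => (u y)%:C) x = du%:C.
Proof.
move=> H; apply: complexP => /=; first by apply: derive_val.
exact: derive_cst.
Qed.

Let csymbol_cdom (u : V -> R) : symbol 0 b (fun _ => u) -> cdominated (fun y => (u y)%:C).
Proof. by move=> su; exact: (csymbol_dominated 0 (lexx 0) b0 (csymbol_real su)). Qed.

Let csymbol_cdiff (u : V -> R) : symbol 0 b (fun _ => u) ->
  forall y, cdifferentiable (fun y => (u y)%:C) y.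
Proof. by move=> su y; exact: (csymbol_differentiable 0 y (csymbol_real su)). Qed.

(** A coordinate times a Gaussian is a multiple of a derivative of the
    Gaussian. *)
Lemma phase_int_coord_gauss t j (x : V) : phase_int t (fun y => (y ord0 j * gauss b y)%:C) x =
  (0 +i* (t * x ord0 j / (2 * b))) * phase_int t (fun y => (gauss b y)%:C) x.
Proof.
have s1 := symbolZ (- 2 * b) (symbol_coord_gauss j).
have H := @phase_int_partial _ _ j _ _ t x (csymbol_cdom symbol_gauss) (csymbol_cdom s1)
  (csymbol_cdiff symbol_gauss) (csymbol_cdiff s1)
  (fun y => partial_real (is_derive_gauss j y)).
have E : phase_int t (fun y : V => (- 2 * b * (y ord0 j * gauss b y))%:C) x =
    (- 2 * b)%:C * phase_int t (fun y => (y ord0 j * gauss b y)%:C) x.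
  rewrite -phase_intZ; last exact: csymbol_cdom (symbol_coord_gauss j).
  by congr (phase_int _ _ _); apply/funext => y; apply: complexP; rewrite ?cReM ?cImM /=; ring.
rewrite E in H.
have b2 : (- 2 * b)%:C != 0.
  by rewrite fmorph_eq0 mulf_eq0 (gt_eqF b0) orbF oppr_eq0 pnatr_eq0.
apply: (mulfI b2); rewrite H mulrA; congr (_ * _).
by apply: complexP; rewrite ?cReM ?cImM /=; [ring|field; rewrite gt_eqF].
Qed.

(** The second moment appears on differentiating the coordinate times the
    Gaussian. *)
Lemma phase_int_coord2_gauss t j (x : V) :
  phase_int t (fun y => (y ord0 j * (y ord0 j * gauss b y))%:C) x =
  ((1 - t ^+ 2 * x ord0 j ^+ 2 / (2 * b)) / (2 * b))%:C * phase_int t (fun y => (gauss b y)%:C) x.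
Proof.
have s1 := symbol_coord_gauss j.
have s2 := symbolM (elem_coord j) s1.
have s3 := symbolD symbol_gauss (symbolZ (- 2 * b) s2).
have d y : is_derive y (delta_mx ord0 j) (fun y : V => y ord0 j * gauss b y)
    (gauss b y + - 2 * b * (y ord0 j * (y ord0 j * gauss b y))).
  apply: is_derive_eq (is_deriveM (is_derive_coord y _ j) (is_derive_gauss j y)) _.
  by rewrite /GRing.scale/= mxE !eqxx/=; ring.
have H := @phase_int_partial _ _ j _ _ t x (csymbol_cdom s1) (csymbol_cdom s3)
  (csymbol_cdiff s1) (csymbol_cdiff s3) (fun y => partial_real (d y)).
have E : phase_int t (fun y : V => (gauss b y + - 2 * b * (y ord0 j * (y ord0 j * gauss b y)))%:C) x =
    phase_int t (fun y => (gauss b y)%:C) x +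
    (- 2 * b)%:C * phase_int t (fun y => (y ord0 j * (y ord0 j * gauss b y))%:C) x.
  rewrite -phase_intZ; last exact: csymbol_cdom s2.
  rewrite -phase_intD; [|exact: csymbol_cdom|apply: cdominatedZ; exact: csymbol_cdom s2].
  by congr (phase_int _ _ _); apply/funext => y; apply: complexP;
    rewrite ?(cReD, cImD, cReM, cImM)/=; ring.
rewrite E phase_int_coord_gauss in H.
have b2 : (- 2 * b)%:C != 0.
  by rewrite fmorph_eq0 mulf_eq0 (gt_eqF b0) orbF oppr_eq0 pnatr_eq0.
apply: (mulfI b2); apply: (addrI (phase_int t (fun y => (gauss b y)%:C) x)); rewrite H.
set o := phase_int _ _ _.
by apply: complexP; rewrite ?(cReD, cImD, cReM, cImM)/=; field; rewrite gt_eqF.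
Qed.

End gaussian_transform.

(** * First-order expansion of the shifted multiplier *)

Section multiplier_expansion.
Context {R : realType} {n : nat}.
Local Notation V := 'rV[R]_n.+1.

(** Replacing r by the larger integer k moves y^r further from 1 on the same
    side, and y^k - 1 factors. *)
Lemma powR_sub1_le (r y : R) (k : nat) : 0 <= r -> r <= k%:R -> 0 < y ->
  `|y `^ r - 1| <= k%:R * `|y - 1| * (1 + y) ^+ k.
Proof.
move=> r0 rk y0.
have H : `|y `^ r - 1| <= `|y ^+ k - 1|.
  have [y1|y1] := leP 1 y.
    have a1 : 1 <= y `^ r by rewrite -[leLHS](powRr0 y) ler_powR.
    have a2 : y `^ r <= y ^+ k by rewrite -powR_mulrn ?(ltW y0)// ler_powR.
    by rewrite !ger0_norm ?subr_ge0// ?lerD2r// (le_trans a1).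
  have a1 : y `^ r <= 1.
    have p1 : (1 : R) `^ r = 1 by rewrite powR1.
    by rewrite -p1 ge0_ler_powR// ?nnegrE ltW.
  have a2 : y ^+ k <= y `^ r.
    by rewrite -powR_mulrn ?(ltW y0)//; apply: ger_powR => //; rewrite y0 ltW.
  by rewrite !ler0_norm ?subr_le0// ?(le_trans a2)// lerN2 lerD2r.
apply: le_trans H _; rewrite -[X in _ - X](expr1n _ k) subrXX normrM.
have -> : k%:R * `|y - 1| * (1 + y) ^+ k = `|y - 1| * (k%:R * (1 + y) ^+ k) by ring.
rewrite ler_wpM2l//.
apply: le_trans (ler_norm_sum _ _ _) _.
apply: (@le_trans _ _ (\sum_(i < k) (1 + y) ^+ k)); last first.
  by rewrite sumr_const card_ord mulr_natl.
apply: ler_sum => i _; rewrite expr1n mulr1 ger0_norm ?exprn_ge0 ?(ltW y0)//.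
apply: (@le_trans _ _ ((1 + y) ^+ (k.-1 - i))).
  by apply: lerXn2r; rewrite ?nnegrE ?addr_ge0 ?(ltW y0)// lerDr.
by rewrite ler_weXn2l// ?lerDl ?(ltW y0)// (leq_trans (leq_subr _ _))// leq_pred.
Qed.

(** With l = m + 1, this is l times the remainder of the expansion l^(-s)
    bracket^(s/2) = 1 + s x_0 / l + o(1/l). *)
Definition defect (s : R) (m : nat) (x : V) : R :=
  m.+1%:R * ((m.+1%:R `^ s)^-1 * bracket m.+1%:R x `^ (s / 2) - 1) - s * x ord0 ord0.

(** In the variable 1/l the normalised multiplier is smooth near 0, with
    value 1 there. *)
Lemma bracket_rescale (s l : R) (x : V) : 0 < l ->
  (l `^ s)^-1 * bracket l x `^ (s / 2) =
  (1 + (2 * x ord0 ord0 * l^-1 + (1 + sqnorm x) * l^-1 ^+ 2)) `^ (s / 2).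
Proof.
move=> l0; have l2 : l `^ s = (l ^+ 2) `^ (s / 2).
  by rewrite -powR_mulrn ?(ltW l0)// -powRrM mulrC divfK.
have -> : 1 + (2 * x ord0 ord0 * l^-1 + (1 + sqnorm x) * l^-1 ^+ 2) =
    (l ^+ 2)^-1 * bracket l x.
  by rewrite /bracket sqnormDe0; field; rewrite gt_eqF.
rewrite powRM ?invr_ge0 ?exprn_ge0 ?(ltW l0)// ?(ltW (bracket_gt0 _ _))//.
congr (_ * _); rewrite l2.
have L : 0 <= l ^+ 2 by rewrite exprn_ge0// ltW.
by rewrite -(powR_inv1 L) -powRrM mulN1r powRN.
Qed.

(** Growth in x is polynomial uniformly in l, so that the expansion stays
    dominated after multiplication by a rapidly decaying function. *)
Lemma defect_bound s : 0 <= s -> exists C : R, exists k : nat, 0 <= C /\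
  forall m x, `|defect s m x| <= C * (1 + sqnorm x) ^+ k.
Proof.
move=> s0; pose k := (Num.trunc (s / 2)).+1.
exists (k%:R * 3 * 5 ^+ k + s), k.+1; split.
  by rewrite addr_ge0// !mulr_ge0.
move=> m x; rewrite /defect; set l : R := m.+1%:R.
have l1 : 1 <= l by rewrite /l ler1n.
have l0 : 0 < l by exact: lt_le_trans l1.
have li : 0 < l^-1 by rewrite invr_gt0.
have li1 : l^-1 <= 1 by rewrite invf_le1.
have Y1 : 1 <= 1 + sqnorm x by rewrite lerDl sqnorm_ge0.
have Y0 : 0 < 1 + sqnorm x by exact: lt_le_trans Y1.
have Yk : 1 <= (1 + sqnorm x) ^+ k by exact: exprn_ege1.
set Y := 1 + sqnorm x in Y1 Y0 Yk *.
have x0Y : `|x ord0 ord0| <= Y by exact: coord_le.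
rewrite mulrDl; apply: le_trans (ler_normB _ _) _; apply: lerD; last first.
  rewrite normrM (ger0_norm s0) ler_wpM2l//; apply: le_trans x0Y _.
  by rewrite exprS ler_peMr// ltW.
rewrite bracket_rescale// -/Y; set q := _ + _ * _ ^+ 2.
have qE : 1 + q = (l ^+ 2)^-1 * bracket l x.
  by rewrite /q /Y /bracket sqnormDe0; field; rewrite gt_eqF.
have y0 : 0 < 1 + q by rewrite qE mulr_gt0 ?bracket_gt0// invr_gt0 exprn_gt0.
have hq : `|q| <= 3 * Y * l^-1.
  apply: le_trans (ler_normD _ _) _.
  rewrite expr2 !normrM !(ger0_norm (ltW li)) (ger0_norm (ltW Y0)) (@ger0_norm _ 2)//.
  have h1 : 2 * `|x ord0 ord0| * l^-1 <= 2 * Y * l^-1.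
    by rewrite ler_wpM2r ?(ltW li)// ler_wpM2l.
  have h2 : Y * (l^-1 * l^-1) <= Y * l^-1.
    by rewrite ler_wpM2l ?(ltW Y0)// ler_piMr// ltW.
  by apply: le_trans (lerD h1 h2) _; rewrite le_eqVlt; apply/orP; left; apply/eqP; ring.
have r0 : 0 <= s / 2 by rewrite divr_ge0.
have rk : s / 2 <= k%:R by rewrite ltW// truncnS_gt.
have h := powR_sub1_le r0 rk y0.
have q1 : 1 + q - 1 = q by ring.
rewrite q1 in h.
rewrite normrM (ger0_norm (ltW l0)).
have h5 : (1 + (1 + q)) ^+ k <= 5 ^+ k * Y ^+ k.
  rewrite -exprMn; apply: lerXn2r; first by rewrite nnegrE addr_ge0// ltW.
    by rewrite nnegrE mulr_ge0// ltW.
  have q3 : q <= 3 * Y.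
    apply: le_trans (ler_norm _) (le_trans hq _).
    by rewrite ler_piMr// mulr_ge0// ltW.
  by apply: (@le_trans _ _ (1 + (1 + 3 * Y))); [rewrite !lerD2l|lra].
apply: (@le_trans _ _ (l * (k%:R * (3 * Y * l^-1) * (5 ^+ k * Y ^+ k)))).
  rewrite ler_wpM2l ?(ltW l0)//; apply: le_trans h _.
  rewrite ler_pM//; last by rewrite ler_wpM2l.
  by rewrite exprn_ge0// addr_ge0// ltW.
rewrite le_eqVlt; apply/orP; left; apply/eqP; rewrite exprS.
by field; rewrite gt_eqF.
Qed.

(** Up to the limit value, this is the difference quotient at 0 of the
    normalised multiplier as a function of 1/l. *)
Lemma defect_cvg s (x : V) : defect s m x @[m --> \oo] --> (0 : R).
Proof.
pose p (h : R) := (1 + (2 * x ord0 ord0 * h + (1 + sqnorm x) * h ^+ 2)) `^ (s / 2).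
have dp : is_derive (0 : R) (1 : R) p (s * x ord0 ord0).
  have H : is_derive (0 : R) (1 : R)
      (fun h => 1 + (2 * x ord0 ord0 * h + (1 + sqnorm x) * h ^+ 2)) (2 * x ord0 ord0).
    have H1 := is_deriveZ (2 * x ord0 ord0) (is_derive_id (0 : R) 1).
    have H2 := is_deriveZ (1 + sqnorm x) (is_deriveX 2 (is_derive_id (0 : R) 1)).
    have H3 := is_deriveD (is_derive_cst (1 : R) (0 : R) (1 : R)) (is_deriveD H1 H2).
    by apply: is_derive_eq H3 _; rewrite /GRing.scale/=; ring.
  have y0 : 0 < 1 + (2 * x ord0 ord0 * 0 + (1 + sqnorm x) * 0 ^+ 2) :> R.
    by rewrite expr0n/= !mulr0 !addr0.
  apply: is_derive_eq (is_derive_comp1 H (is_derive1_powR (s / 2) y0)) _.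
  by rewrite expr0n/= !mulr0 !addr0 powR1; field.
have [dp1 dp2] := dp.
have lim1 : h^-1 *: (p (h + 0) - p 0) @[h --> 0^'] --> s * x ord0 ord0.
  rewrite -dp2; move: dp1; rewrite /derivable /derive.
  have -> : (fun h : R => h^-1 *: ((p \o shift 0) (h *: 1) - p 0)) =
            (fun h => h^-1 *: (p (h + 0) - p 0)).
    by apply/funext => h /=; rewrite -[h *: 1]/(h * 1) mulr1.
  by move=> /cvg_ex[L HL]; rewrite (cvg_lim _ HL).
have lim3 := (cvgr_dnbhsP _ _ _).1 lim1 harmonic
  (conj (fun m => lt0r_neq0 (harmonic_gt0 m)) cvg_harmonic).
rewrite -(subrr (s * x ord0 ord0)).
apply: cvgB; last exact: cvg_cst.
apply: cvg_trans lim3; apply: near_eq_cvg; apply: nearW => m /=.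
rewrite bracket_rescale// /p addr0 invrK -[_ *: _]/(_ * _) mulr0 expr0n/= mulr0 !addr0 powR1.
by [].
Qed.

End multiplier_expansion.

(** * Explicit Fourier transforms with inversion *)

Section transform_pairs.
Context {R : realType} {n : nat}.
Local Notation V := 'rV[R]_n.+1.

(** The excess Gaussian factor is itself an amplitude. This allows sums of
    Gaussians of different widths. *)
Lemma csymbol_shrink s b b' u : b' <= b -> csymbol s b u -> @csymbol R n s b' u.
Proof.
move=> bb; have H (v : R -> V -> R) : symbol s b v -> symbol s b' v.
  move=> [a ea va]; exists (fun l x => a l x * expR (- ((b - b') * sqnorm x))).
    by apply: elem_mul => //; apply: elem_gauss; rewrite subr_ge0.
  move=> l x; rewrite va /weight -mulrA [expR _ * (_ * _)]mulrCA -expRD.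
  by congr (_ * (_ * expR _)); ring.
by move=> [u1 u2]; split; exact: H.
Qed.

Definition rapid (psi : V -> R[i]) := exists2 b, 0 < b & csymbol 0 b (fun _ => psi).

Lemma rapidD f g : rapid f -> rapid g -> rapid (fun x => f x + g x).
Proof.
move=> [b b0 fb] [c c0 gc]; exists (Num.min b c); first by rewrite lt_min b0.
apply: csymbolD.
  by apply: (csymbol_shrink _ fb); rewrite ge_min lexx.
by apply: (csymbol_shrink _ gc); rewrite ge_min lexx orbT.
Qed.

Lemma rapidZ c f : rapid f -> rapid (fun x => c * f x).
Proof. by move=> [b b0 fb]; exists b => //; exact: csymbolZ. Qed.

Lemma rapid_coord j f : rapid f -> rapid (fun x => (x ord0 j)%:C * f x).
Proof.
move=> [b b0 fb]; exists b => //.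
exact: (csymbolM (elem_coord j) (elem_cst 0) fb).
Qed.

Lemma rapid_cdominated f : rapid f -> cdominated f.
Proof. by move=> [b b0 fb]; exact: (csymbol_dominated 0 (lexx 0) b0 fb). Qed.

Lemma rapid_real b (a : V -> R) : 0 < b -> symbol 0 b (fun _ => a) ->
  rapid (fun x => (a x)%:C).
Proof. by move=> b0 sa; exists b => //; exact: csymbol_real sa. Qed.

Lemma inv_fourierD (f g : V -> R[i]) x : cdominated f -> cdominated g ->
  inv_fourier (fun y => f y + g y) x = inv_fourier f x + inv_fourier g x.
Proof. by move=> df dg; rewrite !inv_fourierE phase_intD// mulrDr. Qed.

Lemma inv_fourierZ c (f : V -> R[i]) x : cdominated f ->
  inv_fourier (fun y => c * f y) x = c * inv_fourier f x.
Proof. by move=> df; rewrite !inv_fourierE phase_intZ// mulrCA. Qed.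

(** A function with its first partial derivative [dphi] and its transform
    [psi], together with Fourier inversion for both. For Gaussians these are
    explicit computations, and they are stable under sums, which covers the
    profile, the Gaussian envelope of the wave packet and their product. *)
Definition transform_pair (phi dphi : V -> R) (psi : V -> R[i]) :=
  [/\ dominated phi, rapid psi, forall xi, fourier (fun x => (phi x)%:C) xi = psi xi,
      forall x, inv_fourier psi x = (phi x)%:C &
      forall x, inv_fourier (fun xi => (xi ord0 ord0)%:C * psi xi) x = 0 +i* - dphi x].

Lemma dominated_real (phi : V -> R) : dominated phi -> cdominated (fun x => (phi x)%:C).
Proof.
move=> dphi; split => //=; split; first exact: measurable_cst.
by exists 0 => x; rewrite normr0 mul0r.
Qed.

Lemma transform_pairD phi1 dphi1 psi1 phi2 dphi2 psi2 :
  transform_pair phi1 dphi1 psi1 -> transform_pair phi2 dphi2 psi2 ->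
  transform_pair (fun x => phi1 x + phi2 x) (fun x => dphi1 x + dphi2 x)
    (fun x => psi1 x + psi2 x).
Proof.
move=> [d1 r1 F1 I1 D1] [d2 r2 F2 I2 D2]; split.
- exact: dominatedD.
- exact: rapidD.
- move=> xi; rewrite -F1 -F2 !fourierE -phase_intD; try exact: dominated_real.
  by congr (phase_int _ _ _); apply/funext => y; rewrite rmorphD.
- move=> x; rewrite inv_fourierD; try exact: rapid_cdominated.
  by rewrite I1 I2 rmorphD.
- move=> x; under [in LHS]eq_fun do rewrite mulrDr.
  rewrite inv_fourierD; try by apply: rapid_cdominated; exact: rapid_coord.
  by rewrite D1 D2; apply: complexP; rewrite ?cReD ?cImD/=; ring.
Qed.

Lemma transform_pair0 : transform_pair (fun=> 0) (fun=> 0) (fun=> 0).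
Proof.
have r0 : rapid (fun=> 0).
  exists 1 => //; split; exists (fun _ _ => 0); try exact: elem_cst;
    by move=> l x; rewrite mul0r.
have I0 (x : V) t : phase_int t (fun=> 0) x = 0 :> R[i].
  have c0 : cdominated (fun _ : V => 0 : R[i]) by exact: rapid_cdominated.
  have {1}-> : (fun _ : V => 0 : R[i]) = (fun _ => 0 * 0).
    by apply/funext => y; rewrite mul0r.
  by rewrite (phase_intZ t 0 x c0) mul0r.
split => //.
- split; first exact: measurable_cst.
  by exists 0 => x; rewrite normr0 mul0r.
- by move=> xi; rewrite fourierE I0.
- by move=> x; rewrite inv_fourierE I0 mulr0.
- move=> x; under [in LHS]eq_fun do rewrite mulr0.
  by rewrite inv_fourierE I0 mulr0 oppr0.
Qed.

Lemma transform_pair_sum (N : nat) (phi dphi : nat -> V -> R) (psi : nat -> V -> R[i]) :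
  (forall k, transform_pair (phi k) (dphi k) (psi k)) ->
  transform_pair (fun x => \sum_(k < N) phi k x) (fun x => \sum_(k < N) dphi k x)
    (fun x => \sum_(k < N) psi k x).
Proof.
move=> H; elim: N => [|N IHN].
  by under eq_fun do rewrite big_ord0; under [X in transform_pair _ X _]eq_fun do rewrite big_ord0;
    under [X in transform_pair _ _ X]eq_fun do rewrite big_ord0; exact: transform_pair0.
by under eq_fun do rewrite big_ord_recr; under [X in transform_pair _ X _]eq_fun do rewrite big_ord_recr;
    under [X in transform_pair _ _ X]eq_fun do rewrite big_ord_recr; exact: transform_pairD.
Qed.

Section gaussian_pairs.
Context (b : R) (b0 : 0 < b).
Let beta := (4 * b)^-1.
Let beta0 : 0 < beta. Proof. by rewrite invr_gt0 mulr_gt0. Qed.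
Let K := Num.sqrt (pi / b) ^+ n.+1.

Let betaK : (4 * beta)^-1 = b.
Proof. by rewrite /beta; field; rewrite gt_eqF. Qed.

Let normalisation : (((2 * pi) ^+ n.+1)^-1)%:C * (K%:C * (Num.sqrt (pi / beta) ^+ n.+1)%:C) = 1 :> R[i].
Proof.
rewrite -!rmorphM -[RHS]/((1 : R)%:C); congr (_%:C).
rewrite /K -exprMn -sqrtrM ?divr_ge0 ?pi_ge0 ?(ltW b0)//.
have -> : pi / b * (pi / beta) = (2 * pi) ^+ 2 :> R.
  by rewrite /beta; field; rewrite gt_eqF.
by rewrite sqrtr_sqr ger0_norm ?mulr_ge0 ?pi_ge0// mulVf// expf_neq0// mulf_neq0// gt_eqF// pi_gt0.
Qed.

Let symbol_gauss c : symbol 0 c (fun _ (x : V) => gauss c x).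
Proof.
exists (fun _ _ => 1); first exact: elem_cst.
by move=> l x; rewrite /weight powRr0 !mul1r.
Qed.

Let fourier_gauss (xi : V) :
  phase_int (-1) (fun x => (gauss b x)%:C) xi = K%:C * (gauss beta xi)%:C.
Proof.
rewrite phase_int_gauss// (_ : (-1) ^+ 2 / (4 * b) = beta).
  by rewrite -/K; apply: complexP; rewrite ?cReM ?cImM/=; ring.
by rewrite sqrrN expr1n mul1r.
Qed.

Let inv_gauss (x : V) :
  (((2 * pi) ^+ n.+1)^-1)%:C * (K%:C * phase_int 1 (fun xi => (gauss beta xi)%:C) x) = (gauss b x)%:C.
Proof.
rewrite phase_int_gauss// rmorphM !mulrA -[_ * K%:C * _]mulrA normalisation mul1r.
by rewrite expr1n mul1r betaK.
Qed.

Let rapid_gauss : rapid (fun xi : V => (gauss beta xi)%:C).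
Proof. exact: rapid_real beta0 (symbol_gauss beta). Qed.

Let coordE (j : 'I_n.+1) c : (fun y : V => (y ord0 j)%:C * (gauss c y)%:C) =
  fun y : V => (y ord0 j * gauss c y)%:C.
Proof. by apply/funext => y; rewrite rmorphM. Qed.

(** The transform is a Gaussian with parameter 1 / (4 b), and transforming
    back returns to b because b -> 1 / (4 b) is an involution. *)
Lemma gauss_pair : transform_pair (gauss b) (fun x => - 2 * b * (x ord0 ord0 * gauss b x))
  (fun xi => K%:C * (gauss beta xi)%:C).
Proof.
split.
- exact: gauss_dominated.
- exact: rapidZ.
- by move=> xi; rewrite fourierE fourier_gauss.
- move=> x; rewrite inv_fourierE phase_intZ; last exact: rapid_cdominated.
  exact: inv_gauss.
- move=> x; under [in LHS]eq_fun do rewrite mulrCA.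
  rewrite inv_fourierE phase_intZ; last by apply: rapid_cdominated; exact: rapid_coord.
  rewrite coordE phase_int_coord_gauss// [K%:C * _]mulrCA [LHS]mulrCA inv_gauss.
  by apply: complexP; rewrite ?cReM ?cImM/= /beta; field; rewrite gt_eqF.
Qed.

Lemma coord_gauss_pair : transform_pair (fun x => x ord0 ord0 * gauss b x)
  (fun x => (1 - 2 * b * x ord0 ord0 ^+ 2) * gauss b x)
  (fun xi => (0 +i* - (K / (2 * b))) * ((xi ord0 ord0)%:C * (gauss beta xi)%:C)).
Proof.
have r1 := rapid_coord ord0 rapid_gauss.
have r2 := rapid_coord ord0 r1.
have cK : (0 +i* - (K / (2 * b))) = (0 +i* - (2 * b)^-1) * K%:C.
  by apply: complexP; rewrite ?cReM ?cImM/=; ring.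
split.
- exact: (symbol_dominated 0 (lexx 0) b0 (symbol_elem_gauss b (elem_coord ord0))).
- exact: rapidZ.
- move=> xi; rewrite fourierE phase_int_coord_gauss// fourier_gauss.
  by apply: complexP; rewrite ?cReM ?cImM/=; field; rewrite gt_eqF.
- move=> x; rewrite inv_fourierE phase_intZ; last exact: rapid_cdominated.
  rewrite coordE phase_int_coord_gauss// cK.
  have -> (A B C D E : R[i]) : A * (B * C * (D * E)) = B * D * (A * (C * E)) by ring.
  rewrite inv_gauss.
  by apply: complexP; rewrite ?cReM ?cImM/= /beta; field; rewrite gt_eqF.
- move=> x; under [in LHS]eq_fun do rewrite mulrCA.
  rewrite inv_fourierE phase_intZ; last exact: rapid_cdominated.
  under eq_fun do rewrite -!rmorphM.
  rewrite phase_int_coord2_gauss// cK.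
  have -> (A B C D E : R[i]) : A * (B * C * (D * E)) = B * D * (A * (C * E)) by ring.
  rewrite inv_gauss.
  by apply: complexP; rewrite ?cReM ?cImM/= /beta; field; rewrite gt_eqF.
Qed.

End gaussian_pairs.
End transform_pairs.

(** * Bessel potentials of modulated functions *)

Section modulated_bessel.
Context {R : realType} {n : nat}.
Local Notation V := 'rV[R]_n.+1.
Local Notation e0 := (delta_mx ord0 ord0 : V).
Local Notation mu := (@lebesgue_rV R n.+1).
Local Notation "\int f" := (Rintegral mu setT f) (at level 36, f at level 36).

Definition shifted_symbol (s l : R) (psi : V -> R[i]) (xi : V) : R[i] :=
  (bracket l xi `^ (s / 2))%:C * psi xi.

Lemma csymbol_shifted s psi : rapid psi ->
  exists2 b, 0 < b & csymbol (s / 2) b (fun l => shifted_symbol s l psi).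
Proof.
move=> [b b0 [[a1 e1 E1] [a2 e2 E2]]]; exists b => //; split.
  exists a1 => // l x; rewrite /shifted_symbol cReM /= mul0r subr0 (E1 l x).
  by rewrite /weight powRr0 mul1r; ring.
exists a2 => // l x; rewrite /shifted_symbol cImM /= mul0r addr0 (E2 l x).
by rewrite /weight powRr0 mul1r; ring.
Qed.

Lemma shifted_cdominated s l psi : 0 <= s -> rapid psi ->
  cdominated (shifted_symbol s l psi).
Proof.
move=> s0 /(csymbol_shifted s)[b b0 sb].
by apply: (csymbol_dominated l _ b0 sb); rewrite divr_ge0.
Qed.

Lemma cintegral_shift0 (c : R) (G : V -> R[i]) : cdominated G ->
  cintegral setT (fun x => G (x + c *: e0)) = cintegral setT G.
Proof.
move=> [[m1 _] [m2 _]]; rewrite /cintegral; congr (_ +i* _).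
  exact: (Rintegral_shift0 c m1).
exact: (Rintegral_shift0 c m2).
Qed.

Lemma dotprodDe0 (x xi : V) (c : R) :
  dotprod x (xi + c *: e0) = dotprod x xi + c * x ord0 ord0.
Proof.
rewrite -(dotprod_delta x ord0) /dotprod mulr_sumr -big_split/=.
by apply: eq_bigr => i _; rewrite !mxE; ring.
Qed.

(** Modulation translates the Fourier transform by l in the first direction;
    undoing the translation in the inversion integral shifts the multiplier
    instead. *)
Lemma bessel_modulated s l phi dphi psi : 0 <= s -> transform_pair phi dphi psi ->
  forall x, bessel s (fun y => cis (l * y ord0 ord0) * (phi y)%:C) x =
    cis (l * x ord0 ord0) * inv_fourier (shifted_symbol s l psi) x.
Proof.
move=> s0 [_ rpsi Fpsi _ _] x.
have F xi : fourier (fun y : V => cis (l * y ord0 ord0) * (phi y)%:C) xi =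
    psi (xi + (- l) *: e0).
  rewrite -Fpsi /fourier; congr cintegral; apply/funext => y.
  rewrite dotprodDe0 opprD cisD mulNr opprK.
  by rewrite [cis (l * _) * _]mulrC -mulrA; congr (_ * _); rewrite mulrC.
have ds := shifted_cdominated l s0 rpsi.
pose G (xi : V) := cis (l * x ord0 ord0) * (shifted_symbol s l psi xi * cis (1 * dotprod x xi)).
have dG : cdominated G by apply: cdominatedZ; exact: cdominated_cis.
rewrite /bessel /fourier_multiplier inv_fourierE /inv_fourier mulrCA; congr (_ * _).
transitivity (cintegral setT (fun xi => G (xi + (- l) *: e0))).
  congr cintegral; apply/funext => xi; rewrite F /G /shifted_symbol.
  have -> : bracket l (xi + - l *: e0) = 1 + sqnorm xi.
    by rewrite /bracket -addrA -scalerDl addNr scale0r addr0.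
  rewrite mul1r dotprodDe0 mulrCA; congr (_ * _).
  by rewrite -cisD; congr cis; ring.
rewrite cintegral_shift0// (cintegralZ _ (cdominated_cis 1 x ds)).
by congr (_ * cintegral _ _); apply/funext => xi; rewrite mul1r.
Qed.

Lemma bessel_unmodulated s phi dphi psi : transform_pair phi dphi psi ->
  forall x, bessel s (fun y => (phi y)%:C) x = inv_fourier (shifted_symbol s 0 psi) x.
Proof.
move=> [_ _ Fpsi _ _] x; apply: (congr1 (fun h => inv_fourier h x)).
apply/funext => xi; rewrite Fpsi /shifted_symbol /bracket scale0r addr0.
by [].
Qed.

(** The constant does not depend on l: the power of 1 + l^2 is the whole
    growth of the potential of a wave packet of frequency l. *)
Lemma inv_fourier_shifted_decay s psi : 0 <= s -> rapid psi ->
  exists2 C, 0 <= C & forall l x, normc (inv_fourier (shifted_symbol s l psi) x) <=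
    C * (1 + l ^+ 2) `^ (s / 2) * decay_wt x.
Proof.
move=> s0 /(csymbol_shifted s)[b b0 sb].
have [C C0 HC] := csymbol_decay (divr_ge0 s0 (ler0n _ 2)) b0 sb.
have pi0 : 0 <= ((2 * pi) ^+ n.+1)^-1 :> R.
  by rewrite invr_ge0 exprn_ge0// mulr_ge0// pi_ge0.
exists (((2 * pi) ^+ n.+1)^-1 * C); first by rewrite mulr_ge0.
move=> l x; rewrite inv_fourierE normcM normc_real (ger0_norm pi0) -!mulrA.
by rewrite ler_wpM2l// !mulrA HC.
Qed.

Lemma normc_phase_int_le t f x : cdominated f ->
  normc (phase_int t f x) <= 2 * (\int (fun y => `|complex.Re (f y)|) + \int (fun y => `|complex.Im (f y)|)) :> R.
Proof.
move=> df; have [f1 f2] := df; have [g1 g2] := cdominated_cis t x df.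
have dn (h : V -> R) : dominated h -> dominated (fun y => `|h y|).
  move=> [mh [C hC]]; split; first exact: measurableT_comp.
  by exists C => y; rewrite normr_id.
rewrite -IntD; try exact: dn.
have dD : dominated (fun y => `|complex.Re (f y)| + `|complex.Im (f y)|).
  by apply: dominatedD; exact: dn.
have B (h : V -> R) : dominated h -> (forall y, `|h y| <= `|complex.Re (f y)| + `|complex.Im (f y)|) ->
    `|\int h| <= \int (fun y => `|complex.Re (f y)| + `|complex.Im (f y)|).
  move=> dh hf; apply: le_trans (le_normr_Rintegral _ _) _ => //.
    exact: dominated_integrable.
  by apply: le_Rintegral => //; apply: dominated_integrable => //; exact: dn.
apply: le_trans (normc_le _) _; rewrite mulr_natl mulr2n lerD//= B// => y.
- rewrite cReM/=; apply: le_trans (ler_normB _ _) _; rewrite !normrM.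
  by rewrite lerD// ler_piMr// ?cos_max ?sin_max.
- rewrite cImM/=; apply: le_trans (ler_normD _ _) _; rewrite !normrM.
  by rewrite lerD// ler_piMr// ?cos_max ?sin_max.
Qed.

(** Dominated convergence, from [defect_bound] and [defect_cvg]. *)
Lemma Int_defect_cvg s b u : 0 <= s -> 0 < b -> symbol 0 b (fun _ => u) ->
  \int (fun y => `|defect s m y * u y|) @[m --> \oo] --> (0 : R).
Proof.
move=> s0 b0 su.
have [D [k [D0 HD]]] := @defect_bound R n s s0.
have [C C0 HC] := symbol_poly_bound k (lexx 0) b0 su.
have uC x : (1 + sqnorm x) ^+ k * `|u x| <= C * decay_wt x.
  by have := HC 0 x; rewrite powRr0 mulr1.
have mu_ : measurable_fun setT u by exact: (symbol_measurable su 0).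
have md m : measurable_fun setT (defect s m : V -> R).
  apply: measurable_funB; last by apply: measurable_funM => //; exact: measurable_coord.
  apply: measurable_funM => //; apply: measurable_funB => //; apply: measurable_funM => //.
  exact: measurableT_comp (measurable_powR _) (measurable_bracket _).
have bnd m x : `|defect s m x * u x| <= D * C * decay_wt x.
  rewrite normrM; apply: le_trans (ler_wpM2r (normr_ge0 _) (HD m x)) _.
  by rewrite -!mulrA ler_wpM2l.
have dw : dominated (fun x : V => D * C * decay_wt x).
  apply: dominatedZ; split; first exact: measurable_decay_wt.
  by exists 1 => x; rewrite mul1r ger0_norm// ltW// decay_wt_gt0.
have mm m : measurable_fun setT (fun y => `|defect s m y * u y|).
  by apply: measurableT_comp => //; exact: measurable_funM.
have := @dominated_cvg _ _ _ mu setT measurableT (fun m y => (`|defect s m y * u y|)%:E)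
  (fun=> 0%E) (fun x => (D * C * decay_wt x)%:E) _ _ _ (dominated_integrable dw) _.
move=> /(_ (fun m => (measurable_EFinP _ _).2 (mm m))).
rewrite integral0; move=> H; apply: fine_cvg; apply: H => //.
- move=> x _; apply: cvg_EFin; first exact: nearW.
  rewrite -(normr0 R); apply: cvg_norm; rewrite -(mul0r (u x)).
  by apply: cvgMl; exact: defect_cvg.
- by move=> m x _ /=; rewrite lee_fin normr_id.
Qed.

(** On inserting the expansion of the multiplier, the inversion clauses of
    [transform_pair] evaluate its first two terms; the third is bounded,
    uniformly in x, by the integral of [defect] against the transform. *)
Lemma bessel_expansion s phi dphi psi : 0 <= s -> transform_pair phi dphi psi ->
  forall e : R, 0 < e -> \forall m \near \oo, forall x, exists2 z : R[i], normc z <= e &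
    inv_fourier (shifted_symbol s m.+1%:R psi) x =
    (m.+1%:R `^ s)%:C * ((phi x)%:C + (m.+1%:R^-1)%:C * ((0 +i* - (s * dphi x)) + z)).
Proof.
move=> s0 [_ rpsi _ Ipsi Dpsi] e e0.
pose v m (xi : V) := (defect s m xi)%:C * psi xi.
have [b b0 [sy1 sy2]] := rpsi.
have c1 := Int_defect_cvg s0 b0 sy1; have c2 := Int_defect_cvg s0 b0 sy2.
pose P : R := ((2 * pi) ^+ n.+1)^-1.
have P0 : 0 < P by rewrite invr_gt0 exprn_gt0// mulr_gt0// pi_gt0.
(* The estimate below loses a factor 4 P: P from the normalisation of the
   inverse transform, 2 from [normc_phase_int_le] and 2 from the real and
   imaginary parts of psi. *)
have e2 : 0 < e / (4 * P) by rewrite divr_gt0// mulr_gt0.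
have vE m : v m = fun xi => ((m.+1%:R / (m.+1%:R `^ s))%:C * shifted_symbol s m.+1%:R psi xi +
   ((- m.+1%:R)%:C * psi xi + (- s)%:C * ((xi ord0 ord0)%:C * psi xi))).
  apply/funext => xi; rewrite /v /shifted_symbol !mulrA -!mulrDl; congr (_ * _).
  by rewrite /defect; apply: complexP; rewrite ?cReD ?cImD ?cReM ?cImM/=; ring.
have dpsi := rapid_cdominated rpsi.
have dxpsi := rapid_cdominated (rapid_coord ord0 rpsi).
have ds m := shifted_cdominated m.+1%:R s0 rpsi.
have dv m : cdominated (v m).
  by rewrite vE; apply: cdominatedD; [|apply: cdominatedD]; apply: cdominatedZ.
move/cvgr0Pnorm_le : c1 => /(_ _ e2) near1.
move/cvgr0Pnorm_le : c2 => /(_ _ e2) near2.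
near=> m; move=> x; exists (inv_fourier (v m) x).
  rewrite inv_fourierE normcM normc_real (gtr0_norm P0) -/P.
  have I1 : `|\int (fun y => `|defect s m y * complex.Re (psi y)|)| <= e / (4 * P).
    by near: m.
  have I2 : `|\int (fun y => `|defect s m y * complex.Im (psi y)|)| <= e / (4 * P).
    by near: m.
  have := normc_phase_int_le 1 x (dv m).
  under eq_Rintegral do rewrite /v cReM/= mul0r subr0.
  under [X in _ + X]eq_Rintegral do rewrite /v cImM/= mul0r addr0.
  set J1 := \int _ in I1 *; set J2 := \int _ in I2 *.
  move=> H; have H1 := le_trans (ler_norm J1) I1; have H2 := le_trans (ler_norm J2) I2.
  apply: (@le_trans _ _ (P * (2 * (e / (4 * P) + e / (4 * P))))).
    by rewrite ler_wpM2l ?(ltW P0)// (le_trans H)// ler_wpM2l// lerD.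
  by rewrite le_eqVlt; apply/orP; left; apply/eqP; field; rewrite gt_eqF.
rewrite vE inv_fourierD; [|exact: cdominatedZ|by apply: cdominatedD; exact: cdominatedZ].
rewrite inv_fourierD; [|exact: cdominatedZ|exact: cdominatedZ].
rewrite !inv_fourierZ// Ipsi Dpsi; move: (inv_fourier (shifted_symbol _ _ _) _) => F.
have ls : (m.+1%:R : R) `^ s != 0 by rewrite powR_eq0 pnatr_eq0.
by apply: complexP; rewrite ?(cReD, cImD, cReM, cImM)/=; field; rewrite ls nat1r pnatr_eq0.
Unshelve. all: by end_near. Qed.

End modulated_bessel.

(** * One scale of the profile *)

Section profile.
Context {R : realType} {n : nat}.
Local Notation V := 'rV[R]_n.+1.

(** The i-th partial derivative of the bump x_0 exp (- c^2 |x|^2) of width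
    1/c. It depends on c x only, so all scales have slopes of the same size. *)
Definition bump_slope (i : 'I_n.+1) (c : R) (x : V) : R :=
  ((delta_mx ord0 i : V) ord0 ord0 - 2 * c ^+ 2 * x ord0 ord0 * x ord0 i) * gauss (c ^+ 2) x.

Lemma is_derive_bump i c (x : V) :
  is_derive x (delta_mx ord0 i) (fun x : V => x ord0 ord0 * gauss (c ^+ 2) x) (bump_slope i c x).
Proof.
apply: is_derive_eq (is_deriveM (is_derive_coord x _ ord0) (is_derive_gauss (c ^+ 2) i x)) _.
by rewrite /GRing.scale/= /bump_slope; ring.
Qed.

(** exp y >= (1 + y/2)^2, and (1 + y) (1 + 2 y) <= 8 (1 + y/2)^2. *)
Lemma poly_expRN_le (y : R) : 0 <= y -> (1 + y) * (1 + 2 * y) * expR (- y) <= 8.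
Proof.
move=> y0; rewrite expRN ler_pdivrMr ?expR_gt0//.
have -> : expR y = expR (y / 2) ^+ 2 by rewrite -expRM_natl; congr expR; field.
have h : 0 <= 1 + y / 2 by rewrite addr_ge0// divr_ge0.
have : (1 + y / 2) ^+ 2 <= expR (y / 2) ^+ 2.
  by apply: lerXn2r; rewrite ?nnegrE ?expR_ge0// expR_ge1Dx.
have : (1 + y) * (1 + 2 * y) <= 8 * (1 + y / 2) ^+ 2 by nra.
lra.
Qed.

Lemma coord_scaled_le (c : R) (x : V) j : `|c * x ord0 j| <= 1 + c ^+ 2 * sqnorm x.
Proof.
have h : (c * x ord0 j) ^+ 2 <= c ^+ 2 * sqnorm x.
  by rewrite exprMn ler_wpM2l ?sqr_ge0// sqr_coord_le.
rewrite -(real_normK (num_real (c * x ord0 j))) in h.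
by apply: le_trans (lerD (lexx 1) h); have := sqr_ge0 (`|c * x ord0 j| - 1); nra.
Qed.

Lemma slope_factor_le i c (x : V) :
  `|(delta_mx ord0 i : V) ord0 ord0 - 2 * c ^+ 2 * x ord0 ord0 * x ord0 i| <=
  1 + 2 * (c ^+ 2 * sqnorm x).
Proof.
apply: le_trans (ler_normB _ _) _; apply: lerD.
  by rewrite mxE; case: (_ && _); rewrite ?normr1 ?normr0.
have -> : 2 * c ^+ 2 * x ord0 ord0 * x ord0 i = 2 * (c * x ord0 ord0) * (c * x ord0 i) by ring.
have h0 : (c * x ord0 ord0) ^+ 2 <= c ^+ 2 * sqnorm x.
  by rewrite exprMn ler_wpM2l ?sqr_ge0// sqr_coord_le.
have h1 : (c * x ord0 i) ^+ 2 <= c ^+ 2 * sqnorm x.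
  by rewrite exprMn ler_wpM2l ?sqr_ge0// sqr_coord_le.
rewrite ler_norml; apply/andP; split.
  have := sqr_ge0 (c * x ord0 ord0 + c * x ord0 i).
  set p := c * x ord0 ord0 in h0 *; set q := c * x ord0 i in h1 *.
  set S := c ^+ 2 * _ in h0 h1 *; nra.
have := sqr_ge0 (c * x ord0 ord0 - c * x ord0 i).
set p := c * x ord0 ord0 in h0 *; set q := c * x ord0 i in h1 *.
set S := c ^+ 2 * _ in h0 h1 *; nra.
Qed.

(** Decay in the first coordinate alone already makes averages over large
    cubes small. *)
Lemma bump_slope_decay i c (x : V) :
  `|bump_slope i c x| <= 8 * (1 + (c * x ord0 ord0) ^+ 2)^-1.
Proof.
have h0 : (c * x ord0 ord0) ^+ 2 <= c ^+ 2 * sqnorm x.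
  by rewrite exprMn ler_wpM2l ?sqr_ge0// sqr_coord_le.
have y0 : 0 <= c ^+ 2 * sqnorm x by rewrite mulr_ge0 ?sqr_ge0 ?sqnorm_ge0.
rewrite ler_pdivlMr; last by rewrite ltr_pwDl// sqr_ge0.
apply: le_trans (poly_expRN_le y0).
rewrite normrM (@ger0_norm _ (gauss _ _)) ?expR_ge0// /gauss.
rewrite mulrAC ler_wpM2r ?expR_ge0// [leLHS]mulrC ler_pM ?addr_ge0 ?sqr_ge0//.
  by rewrite lerD2l.
exact: slope_factor_le.
Qed.

Lemma is_derive_bump_slope i c (x v : V) :
  is_derive x v (bump_slope i c)
   ((- (2 * c ^+ 2 * (v ord0 ord0 * x ord0 i + x ord0 ord0 * v ord0 i)) -
     2 * c ^+ 2 * dotprod x v *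
       ((delta_mx ord0 i : V) ord0 ord0 - 2 * c ^+ 2 * x ord0 ord0 * x ord0 i)) *
     gauss (c ^+ 2) x).
Proof.
have H : is_derive x v (fun x : V => - (c ^+ 2 * sqnorm x)) _ :=
  is_deriveN (is_deriveZ (c ^+ 2) (is_derive_sqnorm x v)).
have Hg := is_derive_comp1 H (is_derive_expR _).
have H1 := is_deriveM (is_deriveZ (2 * c ^+ 2) (is_derive_coord x v ord0)) (is_derive_coord x v i).
have H2 := is_deriveB (is_derive_cst ((delta_mx ord0 i : V) ord0 ord0) x v) H1.
apply: is_derive_eq (is_deriveM H2 Hg) _.
rewrite !fctE /GRing.scale/= /gauss -[(2 * c ^+ 2) *: x ord0 ord0]/(2 * c ^+ 2 * x ord0 ord0).
by ring.
Qed.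

(** The mean value theorem on the segment from z to y; a derivative of the
    slope costs a factor c. *)
Lemma bump_slope_lipschitz i c r (y z : V) : 0 <= c ->
  (forall j, `|y ord0 j - z ord0 j| <= r) ->
  `|bump_slope i c y - bump_slope i c z| <= 8 * (4 + 2 * n.+1%:R) * (c * r).
Proof.
move=> c0 yz; pose v := y - z.
have vr j : `|v ord0 j| <= r by rewrite !mxE yz.
have r0 : 0 <= r := le_trans (normr_ge0 _) (yz ord0).
pose phi (t : R) := bump_slope i c (t *: v + z).
have dphi t : is_derive t (1 : R) phi _ :=
  @is_derive_line _ R^o _ (bump_slope i c) (fun t => t *: v + z) 1 v t _
    (fun h y => etrans (congr1 (fun w => w + z) (scalerDl v (h * 1) y))
      (etrans (congr1 (fun w => w *: v + y *: v + z) (mulr1 h)) (esym (addrA _ _ _))))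
    (is_derive_bump_slope i c (t *: v + z) v).
have [t _] := @MVT R phi _ 0 1 ltr01 (fun x _ => dphi x)
  (continuous_subspaceT (fun x => differentiable_continuous
     ((derivable1_diffP _ _).1 (@ex_derive _ _ _ _ _ _ _ (dphi x))))).
rewrite subr0 mulr1 /phi scale1r scale0r add0r subrK => ->.
set x := t *: v + z.
set Y := c ^+ 2 * sqnorm x.
have Y0 : 0 <= Y by rewrite mulr_ge0 ?sqr_ge0 ?sqnorm_ge0.
have cr : 0 <= c * r by rewrite mulr_ge0.
have B j k : `|c ^+ 2 * (v ord0 j * x ord0 k)| <= c * r * (1 + Y).
  have -> : c ^+ 2 * (v ord0 j * x ord0 k) = c * v ord0 j * (c * x ord0 k) by ring.
  rewrite normrM ler_pM// ?coord_scaled_le// normrM (ger0_norm c0).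
  by rewrite ler_wpM2l.
have Bd : `|c ^+ 2 * dotprod x v| <= n.+1%:R * (c * r * (1 + Y)).
  rewrite /dotprod mulr_sumr; apply: le_trans (ler_norm_sum _ _ _) _.
  apply: (@le_trans _ _ (\sum_(j < n.+1) (c * r * (1 + Y)))).
    by apply: ler_sum => j _; rewrite [x _ _ * _]mulrC B.
  by rewrite sumr_const card_ord mulr_natl.
rewrite normrM (@ger0_norm _ (gauss _ _)) ?expR_ge0//.
apply: (@le_trans _ _ ((4 + 2 * n.+1%:R) * (c * r) * ((1 + Y) * (1 + 2 * Y)) * gauss (c ^+ 2) x)).
  rewrite ler_wpM2r ?expR_ge0//; apply: le_trans (ler_normB _ _) _.
  have -> : (4 + 2 * n.+1%:R) * (c * r) * ((1 + Y) * (1 + 2 * Y)) =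
    4 * (c * r * (1 + Y)) * (1 + 2 * Y) + 2 * (n.+1%:R * (c * r * (1 + Y))) * (1 + 2 * Y) by ring.
  apply: lerD.
    have -> : 2 * c ^+ 2 * (v ord0 ord0 * x ord0 i + x ord0 ord0 * v ord0 i) =
      2 * (c ^+ 2 * (v ord0 ord0 * x ord0 i) + c ^+ 2 * (v ord0 i * x ord0 ord0)) by ring.
    apply: (@le_trans _ _ (4 * (c * r * (1 + Y)))); last first.
      by rewrite ler_peMr ?mulr_ge0 ?addr_ge0// lerDl mulr_ge0.
    rewrite normrN normrM ger0_norm//.
    have := le_trans (ler_normD (c ^+ 2 * (v ord0 ord0 * x ord0 i)) (c ^+ 2 * (v ord0 i * x ord0 ord0)))
      (lerD (B ord0 i) (B i ord0)).
    lra.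
  rewrite normrM ler_pM//; last exact: slope_factor_le.
  by rewrite -mulrA normrM ger0_norm// ler_wpM2l.
have := poly_expRN_le Y0; rewrite /gauss -/Y => h.
have -> : (4 + 2 * n.+1%:R) * (c * r) * ((1 + Y) * (1 + 2 * Y)) * expR (- Y) =
   ((1 + Y) * (1 + 2 * Y) * expR (- Y)) * ((4 + 2 * n.+1%:R) * (c * r)) by ring.
by rewrite -[leRHS]mulrA ler_wpM2r// mulr_ge0// addr_ge0// mulr_ge0.
Qed.

(** Two geometric series, one on either side of the scale at which 2^(-k) r
    crosses 1. The sharper bound in the proof is one that survives the step
    from r to r / 2. *)
Lemma sum_min_dyadic N (r : R) : 0 < r ->
  \sum_(k < N) Num.min (2^-1 ^+ k * r) (2^-1 ^+ k * r)^-1 <= 4.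
Proof.
move=> r0.
suff H : \sum_(k < N) Num.min (2^-1 ^+ k * r) (2^-1 ^+ k * r)^-1 <=
    if r <= 1 then 2 * r else 4 - 2 / r.
  apply: le_trans H _; case: ifPn => [r1|_]; first by lra.
  by rewrite gerBl divr_ge0// ltW.
elim: N r r0 => [|N IHN] r r0.
  rewrite big_ord0; case: ifPn => [r1|]; first by rewrite mulr_ge0// ltW.
  rewrite -ltNge => r1; have : r^-1 <= 1 by rewrite invf_le1// ltW.
  by lra.
rewrite big_ord_recl expr0 mul1r.
have -> : \sum_(i < N) Num.min (2^-1 ^+ (lift ord0 i) * r) (2^-1 ^+ (lift ord0 i) * r)^-1 =
    \sum_(i < N) Num.min (2^-1 ^+ i * (r / 2)) (2^-1 ^+ i * (r / 2))^-1.
  apply: eq_bigr => i _; have -> // : 2^-1 ^+ (lift ord0 i) * r = 2^-1 ^+ i * (r / 2).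
  by rewrite /= exprS; ring.
have r20 : 0 < r / 2 by rewrite divr_gt0.
have := IHN _ r20; set S := \sum_(_ < _) _ => HS.
have rV0 : 0 < r^-1 by rewrite invr_gt0.
have rrV : r * r^-1 = 1 by rewrite divff// gt_eqF.
have [r1|r1] := leP r 1.
  have r2 : r / 2 <= 1 by lra.
  rewrite r2 in HS; have := ge_min (r) r r^-1; rewrite lexx/= => m.
  by lra.
have m : Num.min r r^-1 <= r^-1 by rewrite ge_min lexx orbT.
move: HS; have [r2|r2] := leP (r / 2) 1 => HS.
  apply: le_trans (lerD m HS) _.
  nra.
have H4 : 2 / (r / 2) = 4 * r^-1 by field; rewrite gt_eqF.
by rewrite H4 in HS; lra.
Qed.

End profile.

(** * Mean oscillation on cubes *)

Section mean_oscillation_on_cubes.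
Context {R : realType}.
Local Notation leb := (@lebesgue_measure R).
Local Notation mu := (@lebesgue_rV R).

Lemma cubeE n (a : 'rV[R]_n) (r : R) :
  cube a r = [set x : 'rV[R]_n | forall i, `[a ord0 i, a ord0 i + r]%classic (x ord0 i)].
Proof. by apply/seteqP; split => x /= h i; have := h i; rewrite /= in_itv. Qed.

Lemma measurable_cube n (a : 'rV[R]_n) (r : R) : measurable (cube a r).
Proof.
rewrite cubeE (_ : mkset _ = \bigcap_(i in [set: 'I_n])
   ((fun x : 'rV[R]_n => x ord0 i) @^-1` `[a ord0 i, a ord0 i + r]%classic)).
  apply: fin_bigcap_measurable => [|i _]; first exact: finite_finset.
  rewrite -[X in measurable X]setTI.
  by apply: (measurable_coord i) => //; exact: measurable_itv.
by apply/seteqP; split => [x Bx i _|x Bx i]; exact: Bx.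
Qed.

Lemma lebesgue_cube n (a : 'rV[R]_n) (r : R) : 0 < r -> mu n (cube a r) = (r ^+ n)%:E.
Proof.
move=> r0; rewrite cubeE.
have H := @lebesgue_rV_box R n (fun i => `[a ord0 i, a ord0 i + r]%classic)
  (fun i => measurable_itv _).
apply: (etrans H); rewrite (eq_bigr (fun=> r%:E)).
  by rewrite prodEFin prodr_const card_ord.
move=> i _; rewrite lebesgue_measure_itv/= lte_fin ltrDl r0 -EFinB.
by congr (_%:E); ring.
Qed.

(** The primitive atan (c t) / c has total variation pi / c. *)
Lemma integral_cauchy_le (c x r : R) : 0 < c -> 0 < r ->
  (\int[leb]_(t in `[x, (x + r)%R]) ((1 + (c * t) ^+ 2)^-1)%:E <= (pi / c)%:E)%E.
Proof.
move=> c0 r0; pose F (t : R) := c^-1 * atan (c * t).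
pose f (t : R) := (1 + (c * t) ^+ 2)^-1.
have dF t : is_derive t (1 : R) F (f t).
  have H1 : is_derive t (1 : R) (fun t => c * t) c.
    by apply: is_derive_eq (is_deriveZ c (is_derive_id t 1)) _; rewrite /GRing.scale/= mulr1.
  have H2 : is_derive (c * t) (1 : R) atan (1 + (c * t) ^+ 2)^-1.
    by split; [exact: derivable_atan|rewrite -derive1E derive1_atan].
  apply: is_derive_eq (is_deriveZ c^-1 (is_derive_comp1 H1 H2)) _.
  by rewrite /GRing.scale/= mulrCA mulVf ?mulr1// gt_eqF.
have cF : continuous F.
  by move=> t; apply: differentiable_continuous; apply/derivable1_diffP; have [] := dF t.
have cf : continuous f.
  move=> t; apply: (@continuous_comp _ _ _ (fun t => c * t) (fun t => (1 + t ^+ 2)^-1)).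
    by apply: continuousM; [exact: cst_continuous|].
  exact: continuous_decay_wt1.
rewrite (@continuous_FTC2 _ f F); last 4 first.
- by rewrite ltrDl.
- exact: continuous_subspaceT.
- split.
  + by move=> t _; have [] := dF t.
  + by apply: cvg_at_right_filter; exact: cF.
  + by apply: cvg_at_left_filter; exact: cF.
- by move=> t _; rewrite derive1E; have [_ ->] := dF t.
rewrite -EFinB lee_fin /F -mulrBr mulrC ler_wpM2r ?invr_ge0 ?(ltW c0)//.
have := atan_ltpi2 (c * (x + r)); have := atan_gtNpi2 (c * x); lra.
Qed.

Lemma integral_cube_first n (a : 'rV[R]_n.+1) r (phi : R -> R) : 0 < r ->
  measurable_fun setT phi -> (forall t, 0 <= phi t) ->
  (\int[mu n.+1]_(x in cube a r) (phi (x ord0 ord0))%:E =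
   \int[leb]_(t in `[a ord0 ord0, (a ord0 ord0 + r)%R]) (phi t)%:E * (r ^+ n)%:E)%E.
Proof.
move=> r0 mphi phi0.
have mQ := measurable_cube a r.
pose a' : 'rV[R]_n := \row_j a ord0 (lift ord0 j).
pose I := `[a ord0 ord0, (a ord0 ord0 + r)%R]%classic.
have mf : measurable_fun setT (fun x : 'rV[R]_n.+1 => (phi (x ord0 ord0))%:E).
  by apply/measurable_EFinP; exact: measurableT_comp mphi (measurable_coord ord0).
have mI : measurable (I : set (measurableTypeR R)) by exact: measurable_itv.
rewrite integral_mkcond ge0_integral_cons; last 2 first.
- by apply/(measurable_restrictT _ _).1 => //; exact: measurable_funS mf.
- by move=> x; apply: erestrict_ge0 => y _; rewrite lee_fin.
rewrite [X in _ = (X * _)%E]integral_mkcond -ge0_integralZr//; last 3 first.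
- apply/(measurable_restrictT _ _).1 => //.
  by apply/measurable_EFinP; exact: measurable_funS mphi.
- by move=> t _; apply: erestrict_ge0 => y _; rewrite lee_fin.
- by rewrite lee_fin exprn_ge0// ltW.
apply: eq_integral => t _.
have Qt v : cube a r (cons_rV (t, v)) <-> I t /\ cube a' r v.
  split=> [h|[h1 h2] i].
    split; first by have := h ord0; rewrite cons_rV0 /I/= in_itv.
    by move=> j; have := h (lift ord0 j); rewrite cons_rVS mxE.
  have [j|] := unliftP ord0 i => ->.
    by have := h2 j; rewrite cons_rVS mxE.
  by move: h1; rewrite cons_rV0 /I/= in_itv.
rewrite patchE; case: ifPn => tI.
  rewrite -(lebesgue_cube a' r0) -integral_cst; last exact: measurable_cube.
  rewrite [RHS]integral_mkcond; apply: eq_integral => v _.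
  rewrite !patchE cons_rV0; congr (if _ then _ else _).
  apply/idP/idP; rewrite !inE; first by move/Qt => [].
  by move=> h; apply/Qt; split => //; rewrite inE in tI.
rewrite mul0e; apply: integral0_eq => v _.
rewrite patchE ifN// notin_setE => /Qt[h _].
by move/negP: tI; apply; rewrite inE.
Qed.

Section one_cube.
Context (n : nat) (a : 'rV[R]_n.+1) (r : R) (r0 : 0 < r).
Let Q := cube a r.
Let mQ : measurable Q. Proof. exact: measurable_cube. Qed.
Let vol : R := r ^+ n.+1.
Let vol0 : 0 < vol. Proof. by rewrite exprn_gt0. Qed.
Let muQ : mu n.+1 Q = vol%:E. Proof. exact: lebesgue_cube. Qed.

Definition bounded_measurable (v : 'rV[R]_n.+1 -> R) :=
  measurable_fun setT v /\ exists C : R, forall x, `|v x| <= C.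

Let integrable_bm v : bounded_measurable v -> (mu n.+1).-integrable Q (EFin \o v).
Proof.
move=> [mv [C vC]]; have C0 : 0 <= C := le_trans (normr_ge0 _) (vC 0).
apply: (@le_integrable _ _ _ _ _ mQ _ (fun _ => C%:E)).
- by apply/measurable_EFinP; exact: measurable_funS mv.
- by move=> x _ /=; rewrite lee_fin (ger0_norm C0).
- apply/integrableP; split; first exact: measurable_cst.
  rewrite integral_cst//; rewrite [X in (_ * X)%E](_ : _ = vol%:E)//.
  by rewrite -EFinM ltry.
Qed.

Definition avg (v : 'rV[R]_n.+1 -> R) : R := vol^-1 * Rintegral (mu n.+1) Q v.

Lemma bmD u v : bounded_measurable u -> bounded_measurable v ->
  bounded_measurable (fun x => u x + v x).
Proof.
move=> [mu_ [C uC]] [mv [D vD]]; split; first exact: measurable_funD.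
by exists (C + D) => x; exact: le_trans (ler_normD _ _) (lerD (uC x) (vD x)).
Qed.

Lemma bm_cst c : bounded_measurable (fun=> c).
Proof. by split; [exact: measurable_cst|exists `|c|]. Qed.

Lemma bmN u : bounded_measurable u -> bounded_measurable (fun x => - u x).
Proof.
move=> [mu_ [C uC]]; split; first exact: measurableT_comp.
by exists C => x; rewrite normrN.
Qed.

Lemma bm_norm u : bounded_measurable u -> bounded_measurable (fun x => `|u x|).
Proof.
move=> [mu_ [C uC]]; split; first exact: measurableT_comp.
by exists C => x; rewrite normr_id.
Qed.

Lemma avgD u v : bounded_measurable u -> bounded_measurable v ->
  avg (fun x => u x + v x) = avg u + avg v.
Proof. by move=> bu bv; rewrite /avg RintegralD ?mulrDr//; exact: integrable_bm. Qed.

Lemma avgZ c u : bounded_measurable u -> avg (fun x => c * u x) = c * avg u.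
Proof.
move=> bu; have -> : avg (fun x => c * u x) = vol^-1 * (c * Rintegral (mu n.+1) Q u).
  by congr *%R; apply: RintegralZl => //; exact: integrable_bm.
by rewrite mulrCA.
Qed.

Lemma avg_cst c : avg (fun=> c) = c.
Proof.
rewrite /avg Rintegral_cst//; rewrite [X in fine X](_ : _ = vol%:E)//=.
by rewrite mulrCA mulVf ?mulr1// gt_eqF.
Qed.

Lemma avgN u : bounded_measurable u -> avg (fun x => - u x) = - avg u.
Proof.
move=> bu; apply/eqP; rewrite -addr_eq0 -avgD//; last exact: bmN.
by under eq_fun do rewrite addNr; rewrite avg_cst.
Qed.

Lemma le_avg u v : bounded_measurable u -> bounded_measurable v ->
  (forall x, Q x -> u x <= v x) -> avg u <= avg v.
Proof.
move=> bu bv uv; rewrite /avg ler_wpM2l ?invr_ge0 ?(ltW vol0)//.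
by apply: le_Rintegral => //; exact: integrable_bm.
Qed.

Lemma norm_avg_le u : bounded_measurable u -> `|avg u| <= avg (fun x => `|u x|).
Proof.
move=> bu; rewrite /avg normrM ger0_norm ?invr_ge0 ?(ltW vol0)//.
rewrite ler_wpM2l ?invr_ge0 ?(ltW vol0)//.
by apply: le_normr_Rintegral => //; exact: integrable_bm.
Qed.

Definition oscillation v := avg (fun y => `|v y - avg v|).

Let bm_dev v c : bounded_measurable v -> bounded_measurable (fun y => `|v y - c|).
Proof. by move=> bv; apply: bm_norm; apply: bmD => //; exact: bm_cst. Qed.

Lemma oscillationD u v : bounded_measurable u -> bounded_measurable v ->
  oscillation (fun x => u x + v x) <= oscillation u + oscillation v.
Proof.
move=> bu bv; rewrite /oscillation -avgD; try exact: bm_dev.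
apply: le_avg; [by apply: bm_dev; exact: bmD|by apply: bmD; exact: bm_dev|].
move=> x _; rewrite avgD// opprD addrACA; exact: ler_normD.
Qed.

Lemma oscillation_le_avg v : bounded_measurable v ->
  oscillation v <= 2 * avg (fun x => `|v x|).
Proof.
move=> bv; rewrite mulr_natl mulr2n.
apply: (@le_trans _ _ (avg (fun x => `|v x| + `|avg v|))).
  apply: le_avg; [exact: bm_dev|by apply: bmD; [exact: bm_norm|exact: bm_cst]|].
  by move=> x _; exact: ler_normB.
rewrite avgD; [|exact: bm_norm|exact: bm_cst].
by rewrite lerD2l avg_cst norm_avg_le.
Qed.

Lemma oscillation_le_variation v (L : R) : bounded_measurable v ->
  (forall x y, Q x -> Q y -> `|v x - v y| <= L) -> oscillation v <= L.
Proof.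
move=> bv vL; rewrite -[leRHS]avg_cst.
apply: le_avg; [exact: bm_dev|exact: bm_cst|] => x Qx.
have -> : v x - avg v = avg (fun y => v x - v y).
  by rewrite avgD; [rewrite avg_cst avgN|exact: bm_cst|exact: bmN].
apply: le_trans (norm_avg_le _) _; first by apply: bmD; [exact: bm_cst|exact: bmN].
rewrite -[leRHS]avg_cst; apply: le_avg; [|exact: bm_cst|by move=> y Qy; exact: vL].
by apply: bm_norm; apply: bmD; [exact: bm_cst|exact: bmN].
Qed.

Lemma mean_oscillation_real v : bounded_measurable v ->
  mean_oscillation Q (fun x => (v x)%:C) = (oscillation v)%:E.
Proof.
move=> bv.
have avgE : average Q (fun x => (v x)%:C) = (avg v)%:C.
  rewrite /average (_ : fine _ = vol); last by rewrite [X in fine X](_ : _ = vol%:E).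
  apply: complexP; rewrite ?cReM ?cImM/= ?mul0r ?subr0//.
  by rewrite Rintegral_cst// !mul0r mulr0 addr0.
rewrite /mean_oscillation avgE (_ : fine _ = vol); last by rewrite [X in fine X](_ : _ = vol%:E).
rewrite /oscillation {2}/avg EFinM; congr (_ * _)%E.
rewrite /Rintegral fineK; last by apply: integrable_fin_num => //; apply: integrable_bm; exact: bm_dev.
apply: eq_integral => y _; congr (_%:E).
by rewrite -[X in normc X]/((v y)%:C - (avg v)%:C) -rmorphB normc_real.
Qed.

(** The integrand depends on the first coordinate only, so the average is
    one-dimensional. *)
Lemma avg_decay c : 0 < c ->
  avg (fun x => (1 + (c * x ord0 ord0) ^+ 2)^-1) <= pi / (c * r).
Proof.
move=> c0.
pose phi (t : R) := (1 + (c * t) ^+ 2)^-1.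
have phi0 t : 0 <= phi t by rewrite invr_ge0 addr_ge0// sqr_ge0.
have mphi : measurable_fun setT phi.
  apply: (measurableT_comp (@measurable_decay_wt1 R) (_ : measurable_fun setT (fun t => c * t))).
  exact: measurable_funM.
have H := integral_cube_first a r0 mphi phi0.
rewrite /avg /Rintegral -/Q in H *; rewrite H.
have H2 := integral_cauchy_le (a ord0 ord0) c0 r0.
set J := (\int[_]_(t in _) _)%E in H2 *.
have J0 : (0 <= J)%E by apply: integral_ge0 => t _; rewrite lee_fin; exact: phi0.
have Jfin : J \is a fin_num by rewrite ge0_fin_numE// (le_lt_trans H2)// ltry.
rewrite fineM//= mulrC.
have h : fine J <= pi / c by rewrite -lee_fin fineK.
rewrite /vol exprS invfM.
have -> : fine J * r ^+ n * (r^-1 * r ^- n) = fine J / r.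
  by field; rewrite ?expf_neq0 ?gt_eqF.
by rewrite invfM mulrA ler_wpM2r// invr_ge0 ltW.
Qed.

End one_cube.
End mean_oscillation_on_cubes.

(** * The profile: large slope, bounded mean oscillation *)

Section profile_BMO.
Context {R : realType} {n : nat}.
Local Notation V := 'rV[R]_n.+1.

Definition dyadic (k : nat) : R := 2^-1 ^+ k.

Lemma dyadic_gt0 k : 0 < dyadic k.
Proof. by rewrite exprn_gt0// invr_gt0. Qed.

Lemma dyadic_le1 k : dyadic k <= 1.
Proof. by rewrite exprn_ile1// ?invr_ge0// invf_le1// ler1n. Qed.

(** A superposition of bumps at all dyadic scales up to N: near the origin
    the slopes add up to order N, while a cube of side r sees essentially
    the oscillation of the scales close to r. *)
Definition profile (N : nat) (x : V) : R :=
  \sum_(k < N) x ord0 ord0 * gauss (dyadic k ^+ 2) x.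

Lemma is_derive_profile N i (x : V) :
  is_derive x (delta_mx ord0 i) (profile N) (\sum_(k < N) bump_slope i (dyadic k) x).
Proof.
have -> : profile N = \sum_(k < N) (fun x : V => x ord0 ord0 * gauss (dyadic k ^+ 2) x).
  by apply/funext => y; rewrite fct_sumE.
by apply: is_derive_sum => k; exact: is_derive_bump.
Qed.

Lemma bump_slope_bounded_measurable i c : bounded_measurable (bump_slope i c : V -> R).
Proof.
split.
  apply: measurable_funM.
    apply: measurable_funB => //; apply: measurable_funM; last exact: measurable_coord.
    by apply: measurable_funM => //; exact: measurable_coord.
  apply: measurableT_comp; first exact: measurable_expR.
  by apply: measurableT_comp => //; apply: measurable_funM => //; exact: measurable_sqnorm.
exists 8 => x; apply: le_trans (bump_slope_decay i c x) _.
by rewrite ler_piMr// invf_le1 ?lerDl ?sqr_ge0// ltr_pwDl// sqr_ge0.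
Qed.

Let K : R := 8 * (4 + 2 * n.+1%:R) + 16 * pi.

(** On cubes smaller than the width of the bump the Lipschitz bound is the
    better one, on larger cubes the decay. *)
Lemma oscillation_bump_slope (a : V) r i c : 0 < r -> 0 < c ->
  oscillation a r (bump_slope i c) <= K * Num.min (c * r) (c * r)^-1.
Proof.
move=> r0 c0; have bm := bump_slope_bounded_measurable i c.
have cr : 0 < c * r by rewrite mulr_gt0.
have pi0 : 0 <= pi :> R by exact: pi_ge0.
have H1 : oscillation a r (bump_slope i c) <= K * (c * r).
  apply: le_trans (oscillation_le_variation r0 bm (L := 8 * (4 + 2 * n.+1%:R) * (c * r)) _) _.
    move=> x y Qx Qy; apply: bump_slope_lipschitz; first exact: ltW.
    move=> j; have /andP[x1 x2] := Qx j; have /andP[y1 y2] := Qy j.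
    by rewrite ler_norml; apply/andP; split; lra.
  by rewrite ler_wpM2r ?(ltW cr)// lerDl mulr_ge0.
have H2 : oscillation a r (bump_slope i c) <= K * (c * r)^-1.
  apply: le_trans (oscillation_le_avg a r0 bm) _.
  have bd : bounded_measurable (fun x : V => (1 + (c * x ord0 ord0) ^+ 2)^-1).
    split.
      apply: (measurableT_comp (@measurable_decay_wt1 R)
        (_ : measurable_fun setT (fun x : V => c * x ord0 ord0))).
      by apply: measurable_funM => //; exact: measurable_coord.
    exists 1 => x; rewrite ger0_norm ?invr_ge0 ?addr_ge0 ?sqr_ge0//.
    by rewrite invf_le1 ?lerDl ?sqr_ge0// ltr_pwDl// sqr_ge0.
  have bd8 : bounded_measurable (fun x : V => 8 * (1 + (c * x ord0 ord0) ^+ 2)^-1).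
    case: bd => m [D HD]; split; first exact: measurable_funM.
    by exists (8 * D) => x; rewrite normrM ger0_norm// ler_wpM2l.
  have h1 : avg a r (fun x => `|bump_slope i c x|) <=
      avg a r (fun x => 8 * (1 + (c * x ord0 ord0) ^+ 2)^-1).
    by apply: le_avg => //; [exact: bm_norm|move=> x _; exact: bump_slope_decay].
  have h2 : avg a r (fun x => 8 * (1 + (c * x ord0 ord0) ^+ 2)^-1) =
      8 * avg a r (fun x => (1 + (c * x ord0 ord0) ^+ 2)^-1).
    exact: avgZ.
  have h3 := avg_decay a r0 c0.
  have -> : K * (c * r)^-1 = 8 * (4 + 2 * n.+1%:R) / (c * r) + 16 * (pi / (c * r)).
    by rewrite /K; ring.
  have : 0 <= 8 * (4 + 2 * n.+1%:R) / (c * r).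
    by rewrite divr_ge0 ?(ltW cr)// mulr_ge0// addr_ge0// mulr_ge0.
  rewrite h2 in h1; lra.
by rewrite /Num.min; case: ifP.
Qed.

Lemma oscillation_sum (a : V) r (v : nat -> V -> R) N : 0 < r ->
  (forall k, bounded_measurable (v k)) ->
  bounded_measurable (fun x => \sum_(k < N) v k x) /\
  oscillation a r (fun x => \sum_(k < N) v k x) <= \sum_(k < N) oscillation a r (v k).
Proof.
move=> r0 bv; elim: N => [|N [IH1 IH2]].
  have -> : (fun x => \sum_(k < 0) v k x) = fun=> 0.
    by apply/funext => x; rewrite big_ord0.
  split; first exact: bm_cst.
  rewrite big_ord0; apply: oscillation_le_variation => //; first exact: bm_cst.
  by move=> x y _ _; rewrite subrr normr0.
have -> : (fun x => \sum_(k < N.+1) v k x) = fun x => \sum_(k < N) v k x + v N x.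
  by apply/funext => x; rewrite big_ord_recr.
split; first exact: bmD.
rewrite big_ord_recr/=; apply: le_trans (oscillationD a r0 IH1 (bv N)) _.
by rewrite lerD2r.
Qed.

(** By [sum_min_dyadic], the bounds for the single scales have a sum
    independent of N and of the cube. *)
Lemma BMO_profile_bounded : exists2 C : R, 0 <= C & forall N i,
  (BMO_norm (partial i (fun x => (profile N x)%:C)) <= C%:E)%E.
Proof.
have K0 : 0 <= K.
  by rewrite addr_ge0 ?mulr_ge0 ?pi_ge0// addr_ge0// mulr_ge0.
exists (K * 4) => [|N i]; first by rewrite mulr_ge0.
apply: ge_ereal_sup => _ [[a r] /= r0 <-].
have -> : partial i (fun x => (profile N x)%:C) =
    fun x => (\sum_(k < N) bump_slope i (dyadic k) x)%:C.
  by apply/funext => x; apply: partial_real; exact: is_derive_profile.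
have [bs os] := @oscillation_sum a r (fun k => bump_slope i (dyadic k)) N r0
  (fun k => bump_slope_bounded_measurable i (dyadic k)).
rewrite mean_oscillation_real// lee_fin; apply: le_trans os _.
apply: (@le_trans _ _ (\sum_(k < N) K * Num.min (dyadic k * r) (dyadic k * r)^-1)).
  by apply: ler_sum => k _; apply: oscillation_bump_slope => //; exact: dyadic_gt0.
by rewrite -mulr_sumr ler_wpM2l//; exact: sum_min_dyadic.
Qed.

End profile_BMO.

(** * Lebesgue norms *)

Section Lebesgue_norms.
Context {R : realType} {n : nat}.
Local Notation V := 'rV[R]_n.+1.
Local Notation mu := (@lebesgue_rV R n.+1).

(** The integral of a nonnegative function is a supremum over its simple
    minorants, which is monotone whether or not the functions are
    measurable. *)
Lemma ge0_integral_mono (f g : V -> \bar R) : (forall x, 0 <= f x)%E ->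
  (forall x, f x <= g x)%E -> (\int[mu]_x f x <= \int[mu]_x g x)%E.
Proof.
move=> f0 fg; rewrite !ge0_integralTE//; last by move=> x; exact: le_trans (f0 x) (fg x).
apply: le_ereal_sup => _ [h hf <-]; exists h => // x.
exact: le_trans (hf x) (fg x).
Qed.

(** As [decay_wt] is at most 1 and p > 1, its p-th power is at most itself,
    hence integrable. *)
Lemma cLnorm_le_decay_wt (p : R) : 1 < p -> exists2 L : R, 0 <= L &
  forall (K : R) (u : V -> R[i]), 0 <= K -> (forall x, normc (u x) <= K * decay_wt x) ->
  (cLnorm p%:E u <= (K * L)%:E)%E.
Proof.
move=> p1; have p0 : 0 < p by exact: lt_trans p1.
have I0 : (0 <= \int[mu]_x (decay_wt x)%:E)%E.
  by apply: integral_ge0 => x _; rewrite lee_fin ltW// decay_wt_gt0.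
have Ifin : (\int[mu]_x (decay_wt x)%:E)%E \is a fin_num.
  by rewrite ge0_fin_numE// integral_decay_wt_lty.
pose I := fine (\int[mu]_x (decay_wt x)%:E)%E.
exists (I `^ p^-1); first exact: powR_ge0.
move=> K u K0 uK; rewrite /cLnorm unlock.
have H : (\int[mu]_x (`|(normc (u x))%:E| `^ p) <= (K `^ p * I)%:E)%E.
  apply: (@le_trans _ _ (\int[mu]_x ((K `^ p)%:E * (decay_wt x)%:E))%E).
    apply: ge0_integral_mono => x; first exact: poweR_ge0.
    rewrite /= -EFinM lee_fin ger0_norm ?normc_ge0//.
    have w0 := decay_wt_gt0 x.
    apply: (@le_trans _ _ ((K * decay_wt x) `^ p)).
      by apply: ge0_ler_powR => //; rewrite ?nnegrE ?normc_ge0// ?mulr_ge0// ltW.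
    rewrite powRM ?(ltW w0)// ler_wpM2l ?powR_ge0//.
    apply: ge1r_powR; last exact: ltW.
    rewrite w0/= /decay_wt; apply: prodr_ile1 => i _.
    by rewrite decay_wt1_le1 ltW// decay_wt1_gt0.
  rewrite ge0_integralZl//; last 3 first.
  - by apply/measurable_EFinP; exact: measurable_decay_wt.
  - by move=> x _; rewrite lee_fin ltW// decay_wt_gt0.
  - by rewrite lee_fin powR_ge0.
  by rewrite EFinM /I fineK.
have -> : (K * I `^ p^-1)%:E = ((K `^ p * I)%:E `^ p^-1)%E.
  rewrite poweR_EFin powRM ?powR_ge0// ?fine_ge0//.
  by rewrite -powRrM divff ?gt_eqF// powRr1.
apply: gt0_ler_poweR => //.
- by rewrite invr_ge0 ltW.
- by rewrite in_itv/= leey andbT; apply: integral_ge0 => x _; rewrite lee_fin powR_ge0.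
- by rewrite in_itv/= leey andbT lee_fin mulr_ge0 ?powR_ge0// fine_ge0.
Qed.

(** A cube of side 1 has measure 1. *)
Lemma cLnorm_ge (p : R) (a : V) (c : R) (u : V -> R[i]) : 1 < p -> 0 <= c ->
  (forall x, cube a 1 x -> c <= normc (u x)) -> (c%:E <= cLnorm p%:E u)%E.
Proof.
move=> p1 c0 uc; have p0 : 0 < p by exact: lt_trans p1.
rewrite /cLnorm unlock.
have -> : c%:E = ((c `^ p)%:E `^ p^-1)%E.
  by rewrite poweR_EFin -powRrM divff ?gt_eqF// powRr1.
apply: gt0_ler_poweR.
- by rewrite invr_ge0 ltW.
- by rewrite in_itv/= leey andbT lee_fin powR_ge0.
- by rewrite in_itv/= leey andbT; apply: integral_ge0 => x _; rewrite lee_fin powR_ge0.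
have mQ := measurable_cube a 1.
have -> : (c `^ p)%:E = (\int[mu]_(x in cube a 1) (c `^ p)%:E)%E.
  rewrite integral_cst//; rewrite [X in (_ * X)%E](_ : _ = 1%E) ?mule1//.
  by have := lebesgue_cube a (@ltr01 R); rewrite expr1n.
rewrite [leLHS]integral_mkcond; apply: ge0_integral_mono => x.
  by apply: erestrict_ge0 => y _; rewrite lee_fin powR_ge0.
rewrite patchE; case: ifPn => [|_]; last exact: poweR_ge0.
rewrite inE => Qx; rewrite /= lee_fin ger0_norm ?normc_ge0//.
by apply: ge0_ler_powR; rewrite ?nnegrE ?normc_ge0 ?(ltW p0)//; exact: uc.
Qed.

Lemma cLnormy_le1 (u : V -> R[i]) : (forall x, normc (u x) <= 1) ->
  (cLnorm +oo%E u <= 1)%E.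
Proof.
move=> u1; rewrite /cLnorm unlock; case: ifP => // _.
by apply/ess_supP; apply: nearW => x /=; rewrite lee_fin ger0_norm ?normc_ge0.
Qed.

Lemma cLnorm_ge0 q (u : V -> R[i]) : (0 <= cLnorm q u)%E.
Proof. exact: Lnorm_ge0. Qed.

End Lebesgue_norms.

(** * Schwartz functions *)

Section schwartz_functions.
Context {R : realType} {n : nat}.
Local Notation V := 'rV[R]_n.+1.

(** All partial derivatives stay in the class, whose members decay faster
    than any power. *)
Lemma rapid_schwartz (u : V -> R[i]) : rapid u -> schwartz u.
Proof.
move=> [b b0 su] l.
have [v sv vE] : exists2 v, csymbol 0 b v & partials l u = v 0.
  elim: l => [|j l [v sv vE]]; first by exists (fun=> u).
  have [w sw wE] := csymbol_partial j sv; exists w => //=.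
  by rewrite vE; apply/funext => x; exact: wE.
rewrite vE; split; first by move=> x; exact: csymbol_differentiable sv.
move=> k; have [s1 s2] := sv.
have [C1 C10 H1] := symbol_poly_bound k (lexx 0) b0 s1.
have [C2 C20 H2] := symbol_poly_bound k (lexx 0) b0 s2.
exists (C1 + C2) => x.
have w1 : decay_wt x <= 1 by apply: prodr_ile1 => i _; rewrite decay_wt1_le1 ltW// decay_wt1_gt0.
have B (C t : R) : 0 <= C -> t <= C * (1 + 0 ^+ 2) `^ 0 * decay_wt x -> t <= C.
  by move=> C0 /le_trans; apply; rewrite powRr0 mulr1 ler_piMr.
have y0 : 0 <= (1 + sqnorm x) ^+ k by rewrite exprn_ge0// addr_ge0// sqnorm_ge0.
apply: le_trans (ler_wpM2l y0 (normc_le _)) _; rewrite mulrDr lerD//.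
  by apply: B => //; exact: H1.
by apply: B => //; exact: H2.
Qed.

Lemma rapid_profile N : rapid (fun x : V => (profile N x)%:C).
Proof.
elim: N => [|N IHN].
  exists 1 => //; have -> : (fun x : V => (profile 0 x)%:C) = fun=> 0.
    by apply/funext => x; rewrite /profile big_ord0.
  by split; exists (fun _ _ => 0); try exact: elem_cst; move=> l x; rewrite mul0r.
have -> : (fun x : V => (profile N.+1 x)%:C) =
    fun x => (profile N x)%:C + (x ord0 ord0 * gauss (dyadic N ^+ 2) x)%:C.
  by apply/funext => x; rewrite /profile big_ord_recr rmorphD.
apply: rapidD => //; apply: (rapid_real (b := dyadic N ^+ 2)).
  by rewrite exprn_gt0// dyadic_gt0.
exact: symbol_elem_gauss (elem_coord ord0).
Qed.

Lemma rapid_wave (l : R) : rapid (fun x : V => cis (l * x ord0 ord0) * (gauss 1 x)%:C).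
Proof.
exists 1 => //; split.
  have -> : (fun (_ : R) (x : V) => complex.Re (cis (l * x ord0 ord0) * (gauss 1 x)%:C)) =
      fun _ x => cos (l * x ord0 ord0) * gauss 1 x.
    by apply/funext => k; apply/funext => x; rewrite cReM/= mulr0 subr0.
  exact: symbol_elem_gauss (elem_cos l).
have -> : (fun (_ : R) (x : V) => complex.Im (cis (l * x ord0 ord0) * (gauss 1 x)%:C)) =
    fun _ x => sin (l * x ord0 ord0) * gauss 1 x.
  by apply/funext => k; apply/funext => x; rewrite cImM/= mulr0 add0r.
exact: symbol_elem_gauss (elem_sin l).
Qed.

End schwartz_functions.

(** * The commutator of the profile with a wave packet *)

Section commutator.
Context {R : realType} {n : nat}.
Local Notation V := 'rV[R]_n.+1.

Definition wave (l : R) (x : V) : R[i] := cis (l * x ord0 ord0) * (gauss 1 x)%:C.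

Definition commutator (s : R) (f g : V -> R[i]) (x : V) : R[i] :=
  bessel s (fun y => f y * g y) x - f x * bessel s g x.

(** The corner of the unit cube centred at the origin. *)
Let corner : V := \row_i (- 2^-1).

Let sqnorm_corner (x : V) : cube corner 1 x -> sqnorm x <= n.+1%:R / 4 /\
  (x ord0 ord0) ^+ 2 <= 1 / 4.
Proof.
move=> Qx; have H i : x ord0 i ^+ 2 <= 1 / 4.
  by have /andP[] := Qx i; rewrite !mxE => h1 h2; nra.
split=> //; rewrite sqnormE; apply: le_trans (ler_sum _ (fun i _ => H i)) _.
by rewrite sumr_const card_ord -[leLHS]mulr_natl mulrA mulr1.
Qed.

(** On that cube and for c <= 1, 1/2 is a lower bound for 1 - 2 c^2 x_0^2,
    and the exponential is one for exp (- 2 |x|^2). *)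
Definition floor_const : R := 2^-1 * expR (- (n.+1%:R / 2)).

Lemma floor_const_gt0 : 0 < floor_const.
Proof. by rewrite mulr_gt0 ?expR_gt0// invr_gt0. Qed.

Let slope_lower N (x : V) : cube corner 1 x ->
  N%:R * floor_const <=
  \sum_(k < N) (1 - 2 * dyadic k ^+ 2 * x ord0 ord0 ^+ 2) * gauss (dyadic k ^+ 2 + 1) x.
Proof.
move=> /sqnorm_corner[S1 S2].
apply: (@le_trans _ _ (\sum_(k < N) floor_const)).
  by rewrite sumr_const card_ord mulr_natl.
apply: ler_sum => k _; have d0 := @dyadic_gt0 R k; have d1 := @dyadic_le1 R k.
have a0 : 0 <= dyadic k ^+ 2 :> R by rewrite sqr_ge0.
have a1 : dyadic k ^+ 2 <= 1 :> R by rewrite expr2; nra.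
set c := dyadic k ^+ 2 in a0 a1 *.
rewrite /floor_const; apply: ler_pM; rewrite ?invr_ge0 ?expR_ge0//.
  have := sqr_ge0 (x ord0 ord0); set q := x ord0 ord0 ^+ 2 in S2 *; nra.
rewrite /gauss ler_expR lerN2.
have := sqnorm_ge0 x; set S := sqnorm x in S1 *; nra.
Qed.

Let profile_le N (x : V) : cube corner 1 x -> `|profile N x| <= N%:R.
Proof.
move=> /sqnorm_corner[_ S2]; rewrite /profile; apply: le_trans (ler_norm_sum _ _ _) _.
apply: (@le_trans _ _ (\sum_(k < N) 1)); last by rewrite sumr_const card_ord.
apply: ler_sum => k _; rewrite normrM mulr_ile1//.
  have := S2; rewrite -(real_normK (num_real (x ord0 ord0))).
  have := normr_ge0 (x ord0 ord0); set q := `|_|; nra.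
rewrite ger0_norm ?expR_ge0// -expR0 ler_expR oppr_le0 mulr_ge0 ?sqr_ge0//.
exact: sqnorm_ge0.
Qed.

(** The terms of order l^s cancel in the commutator. At order l^(s-1) the
    derivative of the Gaussian envelope of the wave cancels as well, and the
    slope of the profile remains, which is of order N on the whole cube. The
    remainders are o(l^(s-1)) uniformly in x. *)
Lemma commutator_lower_bound (s p : R) N : 1 < s -> 1 < p -> (0 < N)%N ->
  \forall m \near \oo,
    (((m.+1%:R `^ s / m.+1%:R) * (s * N%:R * floor_const / 2))%:E <=
     cLnorm p%:E (commutator s (fun x => (profile N x)%:C) (wave m.+1%:R)))%E.
Proof.
move=> s1 p1 N0; have s0 : 0 < s by exact: lt_trans s1.
have k0 := floor_const_gt0.
have Nr : 0 < N%:R :> R by rewrite ltr0n.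
pose phi (k : nat) (x : V) : R := x ord0 ord0 * gauss (dyadic k ^+ 2 + 1) x.
pose dphi (k : nat) (x : V) : R :=
  (1 - 2 * (dyadic k ^+ 2 + 1) * x ord0 ord0 ^+ 2) * gauss (dyadic k ^+ 2 + 1) x.
have [psifg tpfg] : exists psi, transform_pair (fun x => \sum_(k < N) phi k x)
    (fun x => \sum_(k < N) dphi k x) psi.
  eexists; apply: transform_pair_sum => k; apply: coord_gauss_pair.
  by rewrite ltr_wpDl// sqr_ge0.
have [psig tpg] : exists psi, transform_pair (gauss 1 : V -> R)
    (fun x => - 2 * 1 * (x ord0 ord0 * gauss 1 x)) psi.
  by eexists; apply: gauss_pair.
(* One remainder is multiplied by the profile, at most N on the cube;
   together they stay below (1 + N) e, half of the main term. *)
pose e := s * N%:R * floor_const / (2 * (N%:R + 1)).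
have e0 : 0 < e by rewrite divr_gt0 ?mulr_gt0// addr_gt0.
have Efg := bessel_expansion (ltW s0) tpfg e0.
have Eg := bessel_expansion (ltW s0) tpg e0.
apply: filterS2 Efg Eg => m Efg Eg; set l : R := m.+1%:R in Efg Eg *.
have l0 : 0 < l by rewrite /l ltr0n.
have ll0 : 0 < l `^ s / l by rewrite divr_gt0// powR_gt0.
apply: (@cLnorm_ge R n p corner) => //.
  by rewrite mulr_ge0 ?(ltW ll0)// divr_ge0// mulr_ge0 ?(ltW k0)// mulr_ge0// ltW.
move=> x Qx.
have [z1 z1e E1] := Efg x; have [z2 z2e E2] := Eg x.
have fgE : (fun y : V => (profile N y)%:C * wave l y) =
    (fun y => cis (l * y ord0 ord0) * (\sum_(k < N) phi k y)%:C).
  apply/funext => y; rewrite /wave mulrCA; congr (_ * _).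
  rewrite -rmorphM; congr (_%:C); rewrite /profile mulr_suml; apply: eq_bigr => k _.
  rewrite /phi -mulrA; congr (_ * _); rewrite /gauss -expRD; congr expR; ring.
pose D := \sum_(k < N) (1 - 2 * dyadic k ^+ 2 * x ord0 ord0 ^+ 2) * gauss (dyadic k ^+ 2 + 1) x.
have phiE : \sum_(k < N) phi k x = profile N x * gauss 1 x.
  rewrite /profile mulr_suml; apply: eq_bigr => k _.
  rewrite /phi -mulrA; congr (_ * _); rewrite /gauss -expRD; congr expR; ring.
have DE : \sum_(k < N) dphi k x - profile N x * (- 2 * 1 * (x ord0 ord0 * gauss 1 x)) = D.
  rewrite /profile mulr_suml -sumrB; apply: eq_bigr => k _.
  have -> : gauss (dyadic k ^+ 2 + 1) x = gauss (dyadic k ^+ 2) x * gauss 1 x.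
    by rewrite /gauss -expRD; congr expR; ring.
  by rewrite /dphi (_ : gauss (dyadic k ^+ 2 + 1) x = gauss (dyadic k ^+ 2) x * gauss 1 x);
    [ring|rewrite /gauss -expRD; congr expR; ring].
have FE : commutator s (fun x => (profile N x)%:C) (wave l) x =
    cis (l * x ord0 ord0) * ((l `^ s / l)%:C *
      ((0 +i* - (s * D)) + (z1 - (profile N x)%:C * z2))).
  rewrite /commutator fgE (bessel_modulated _ (ltW s0) tpfg) (bessel_modulated _ (ltW s0) tpg).
  have fac (A B C F : R[i]) : A * B - C * (A * F) = A * (B - C * F) by ring.
  rewrite fac E1 E2; congr (_ * _).
  rewrite -DE phiE; move: (\sum_(k < N) dphi k x) (profile N x) (l `^ s) => A B C.
  by apply: complexP; rewrite ?(cReD, cImD, cReN, cImN, cReM, cImM)/=; field; rewrite gt_eqF.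
rewrite FE !normcM normc_cis mul1r normc_real (gtr0_norm ll0) ler_wpM2l ?(ltW ll0)//.
have DN := slope_lower N Qx; rewrite -/D in DN.
have fN := profile_le N Qx.
set w := z1 - _; set u := (0 +i* - (s * D)).
have uw : normc u <= normc (u + w) + normc w.
  have -> : u = (u + w) + (- w) by rewrite addrK.
  by apply: le_trans (ler_normcD _ _) _; rewrite addrK normcN.
have nu : s * D <= normc u.
  apply: le_trans (Im_le_normc u); rewrite /u/= normrN; exact: ler_norm.
have nw : normc w <= e + N%:R * e.
  apply: le_trans (ler_normcD _ _) _; rewrite normcN normcM normc_real lerD//.
  by rewrite ler_pM// normc_ge0.
have ee : e + N%:R * e = s * N%:R * floor_const / 2.
  by rewrite /e; field; rewrite gt_eqF// addr_gt0.
have sD : s * (N%:R * floor_const) <= s * D by rewrite ler_wpM2l// ltW.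
by lra.
Qed.

End commutator.

(** * Choice of the parameters *)

Lemma powR_sub1_ge (R : realType) (s A : R) : 1 < s ->
  \forall m \near \oo, A <= m.+1%:R `^ s / m.+1%:R.
Proof.
move=> s1; have t0 : 0 < s - 1 by rewrite subr_gt0.
pose B := `|A| + 1; have B0 : 0 < B by rewrite ltr_pwDr.
near=> m; have m0 : 0 < m.+1%:R :> R by rewrite ltr0n.
have -> : m.+1%:R `^ s / m.+1%:R = m.+1%:R `^ (s - 1) :> R.
  by rewrite powRB ?powRr1 ?(ltW m0)// gt_eqF// implybT.
apply: (@le_trans _ _ B); first by rewrite (le_trans (ler_norm _))// lerDl.
have -> : B = (B `^ (s - 1)^-1) `^ (s - 1).
  by rewrite -powRrM mulVf ?gt_eqF// powRr1// ltW.
apply: ge0_ler_powR; rewrite ?nnegrE ?powR_ge0 ?(ltW t0) ?(ltW m0)//.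
apply: (@le_trans _ _ m%:R); last by rewrite ler_nat.
by near: m; exact: nbhs_infty_ger.
Unshelve. all: by end_near. Qed.

Theorem proposition7p8 (R : realType) (d : nat) (p s : R)
    (hd : (1 <= d)%N) (hp : (1 < p)%R) (hs : (1 + d%:R / p < s)%R)
    (M : R) (hM : (0 < M)%R) :
  exists f g : 'rV[R]_d -> R[i], [/\ schwartz f, schwartz g &
    (M%:E * (cLnorm p%:E (bessel s f) * cLnorm +oo g
             + cLnorm p%:E (bessel (s - 1) g) * BMO_norm_gradient f)
     < cLnorm p%:E (fun x => bessel s (fun y => f y * g y) x
                             - f x * bessel s g x)%R)%E].
Proof.
case: d hd hs => // n _ hs.
have s1 : 1 < s by apply: le_lt_trans hs; rewrite lerDl divr_ge0// ltW// (lt_trans ltr01).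
have s0 : 0 < s by exact: lt_trans s1.
have t0 : 0 <= s - 1 by rewrite subr_ge0 ltW.
have [L L0 HL] := @cLnorm_le_decay_wt R n p hp.
have [CB CB0 HB] := @BMO_profile_bounded R n.
have [psig tpg] : exists psi, transform_pair (gauss 1 : 'rV[R]_n.+1 -> R)
    (fun x => - 2 * 1 * (x ord0 ord0 * gauss 1 x)) psi.
  by eexists; apply: gauss_pair.
have [C1 C10 H1] : exists2 C, 0 <= C & forall l x,
    normc (inv_fourier (shifted_symbol (s - 1) l psig) x) <=
    C * (1 + l ^+ 2) `^ ((s - 1) / 2) * decay_wt x.
  by apply: inv_fourier_shifted_decay => //; case: tpg.
(* T times l^(s-1) bounds the second product on the left, whatever N is, and
   N is chosen to beat it. Then the Bessel norm of f is at most a constant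
   A, and l is taken with A <= l^(s-1). *)
pose T := C1 * 2 `^ ((s - 1) / 2) * L * (n.+1%:R * CB).
have T0 : 0 <= T by rewrite !mulr_ge0// powR_ge0.
pose c0 := @floor_const R n; have c00 : 0 < c0 := @floor_const_gt0 R n.
pose N := (Num.trunc (2 * M * (1 + T) / (s * c0))).+1.
have NP : M * (1 + T) < s * N%:R * c0 / 2.
  have := truncnS_gt (2 * M * (1 + T) / (s * c0)).
  rewrite -/N ltr_pdivrMr ?mulr_gt0// => h; lra.
have [psif tpf] : exists psi, transform_pair (@profile R n N)
    (fun x => \sum_(k < N) (1 - 2 * dyadic k ^+ 2 * x ord0 ord0 ^+ 2) * gauss (dyadic k ^+ 2) x) psi.
  eexists; apply: (transform_pair_sum N
    (phi := fun k (x : 'rV[R]_n.+1) => x ord0 ord0 * gauss (dyadic k ^+ 2) x)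
    (dphi := fun k x => (1 - 2 * dyadic k ^+ 2 * x ord0 ord0 ^+ 2) * gauss (dyadic k ^+ 2) x)) => k.
  by apply: coord_gauss_pair; rewrite exprn_gt0// dyadic_gt0.
have [Cf Cf0 Hf] : exists2 C, 0 <= C & forall l x,
    normc (inv_fourier (shifted_symbol s l psif) x) <=
    C * (1 + l ^+ 2) `^ (s / 2) * decay_wt x.
  by apply: inv_fourier_shifted_decay; [exact: ltW|case: tpf].
pose A := Cf * L.
have A0 : 0 <= A by rewrite mulr_ge0.
have [m [mA mlow]] := filter_ex (filterI (powR_sub1_ge A s1)
  (@commutator_lower_bound R n s p N s1 hp isT)).
pose l : R := m.+1%:R; rewrite -/l in mA mlow.
pose f (x : 'rV[R]_n.+1) : R[i] := (profile N x)%:C.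
exists f, (wave l); split; first exact: rapid_schwartz (rapid_profile N).
  exact: rapid_schwartz (rapid_wave l).
apply: lt_le_trans mlow.
have l1 : 1 <= l by rewrite /l ler1n.
have l0 : 0 < l by exact: lt_le_trans l1.
have bf : (cLnorm p%:E (bessel s f) <= A%:E)%E.
  apply: HL => // x; rewrite /f (bessel_unmodulated _ tpf).
  by have := Hf 0 x; rewrite expr0n/= addr0 powR1 mulr1.
have bg : (cLnorm p%:E (bessel (s - 1) (@wave R n l)) <=
    (C1 * 2 `^ ((s - 1) / 2) * (l `^ s / l) * L)%:E)%E.
  apply: HL => [|x]; first by rewrite !mulr_ge0 ?powR_ge0// invr_ge0 ltW.
  rewrite (bessel_modulated _ t0 tpg) normcM normc_cis mul1r.
  apply: le_trans (H1 l x) _; rewrite ler_wpM2r ?(ltW (decay_wt_gt0 x))//.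
  rewrite -mulrA ler_wpM2l//.
  have -> : l `^ s / l = (l ^+ 2) `^ ((s - 1) / 2).
    rewrite -powR_mulrn ?(ltW l0)// -powRrM [2 * _]mulrC divfK//.
    by rewrite powRB ?powRr1 ?(ltW l0)// gt_eqF// implybT.
  rewrite -powRM ?sqr_ge0//; apply: ge0_ler_powR; rewrite ?nnegrE ?addr_ge0 ?mulr_ge0 ?sqr_ge0//.
  by rewrite expr2; nra.
have g1 : (cLnorm +oo (@wave R n l) <= 1)%E.
  apply: cLnormy_le1 => x; rewrite normcM normc_cis mul1r normc_real.
  by rewrite ger0_norm ?expR_ge0// /gauss mul1r -[leRHS]expR0 ler_expR oppr_le0 sqnorm_ge0.
have bmo0 i : (0 <= BMO_norm (partial i f))%E.
  apply: ereal_sup_ge; exists (mean_oscillation (cube 0 1) (partial i f)).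
    by exists (0, 1); rewrite /= ?ltr01.
  rewrite mule_ge0//; last by apply: integral_ge0 => x _; rewrite lee_fin normc_ge0.
  by rewrite lee_fin invr_ge0 fine_ge0.
have bmo : (BMO_norm_gradient f <= (n.+1%:R * CB)%:E)%E.
  rewrite /BMO_norm_gradient.
  apply: (@le_trans _ _ (\sum_(i < n.+1) CB%:E)%E); first by apply: lee_sum => i _; exact: HB.
  by rewrite sumEFin lee_fin sumr_const card_ord mulr_natl.
have bmog0 : (0 <= BMO_norm_gradient f)%E by apply: sume_ge0 => i _.
apply: (@le_lt_trans _ _ (M%:E * (A%:E * 1 +
   (C1 * 2 `^ ((s - 1) / 2) * (l `^ s / l) * L)%:E * (n.+1%:R * CB)%:E))%E).
  rewrite lee_pmul2l ?lte_fin//; apply: leeD; apply: lee_pmul => //; exact: cLnorm_ge0.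
rewrite mule1.
change ((M * (A + C1 * 2 `^ ((s - 1) / 2) * (l `^ s / l) * L * (n.+1%:R * CB)))%:E <
  (l `^ s / l * (s * N%:R * c0 / 2))%:E)%E.
rewrite lte_fin.
have ll0 : 0 < l `^ s / l by rewrite divr_gt0// powR_gt0.
have -> : C1 * 2 `^ ((s - 1) / 2) * (l `^ s / l) * L * (n.+1%:R * CB) = T * (l `^ s / l).
  by rewrite /T; ring.
apply: (@le_lt_trans _ _ (M * (1 + T) * (l `^ s / l))).
  by rewrite -mulrA ler_wpM2l ?(ltW hM)// mulrDl mul1r lerD2r.
by rewrite mulrC ltr_pM2l.
Qed.
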